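(* Let $w$ be a positive superharmonic function on the open unit disk $\mathbb{D}$, and let $\mathcal{D}_w$ be the associated weighted Dirichlet space. Let $\Lambda:\mathcal{D}_w\to\mathbb{C}$ be a linear functional (not assumed continuous) such that $\Lambda(1)=1$ and $\Lambda(g)\neq 0$ for all nowhere-vanishing functions $g\in\mathcal{D}_w$. Then there exists $a\in\mathbb{D}$ such that $\Lambda(f)=f(a)$ for all $f\in\mathcal{D}_w$.
   Context: $\mathbb{D}=\{z\in\mathbb{C}:|z|<1\}$, and $\mathrm{Hol}(\mathbb{D})$ is the set of holomorphic functions $\mathbb{D}\to\mathbb{C}$. Superharmonic functions are understood in the usual sense: $w:\mathbb{D}\to(-\infty,\infty]$ is lower semicontinuous, satisfies the super-mean-value inequality, and is not identically $+\infty$; positive means $w(z)>0$ for all $z\in\mathbb{D}$. For such $w$ and $f\in\mathrm{Hol}(\mathbb{D})$, set $\mathcal{D}_w(f):=\frac{1}{\pi}\int_{\mathbb{D}}|f'(z)|^2w(z)\,dA(z)$, where $dA$ is area (planar Lebesgue) measure, and let $\mathcal{D}_w:=\{f\in\mathrm{Hol}(\mathbb{D}):\mathcal{D}_w(f)<\infty\}$, a complex vector space. The symbol $1$ in $\Lambda(1)$ denotes the constant function $1$. A function $g$ is nowhere-vanishing if $g(z)\neq 0$ for all $z\in\mathbb{D}$. Linear means complex-linear. *)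

(* Defs.v *)
From HB Require Import structures.
From mathcomp Require Export all_boot all_order all_algebra.
From mathcomp Require Export all_classical all_reals all_analysis.
From mathcomp Require Export complex.

Set Implicit Arguments.
Unset Strict Implicit.
Unset Printing Implicit Defensive.

Import Order.TTheory GRing.Theory Num.Theory.
Import numFieldNormedType.Exports.
Import ComplexField.Normc.

Local Open Scope classical_set_scope.
Local Open Scope ring_scope.
Local Open Scope complex_scope.

(* [R[i]] itself carries no topology in the libraries; its copy [R[i]^o] is the
   complex plane as a one-dimensional normed space over itself, so that
   [derivable f z 1] and [derive1 f z] are complex differentiability and the
   complex derivative. *)
Notation plane R := (R[i]^o).

Definition unit_disk (R : realType) : set (plane R) := [set z | `|z| < 1].
Arguments unit_disk : clear implicits.

(* Functions on the disk have type [unit_disk R -> _]. The operator ['valL_0]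
   extends them by 0 to the plane; the value chosen off the disk is never
   relevant, as the disk is open. *)
Definition holomorphic (R : realType) (f : unit_disk R -> plane R) : Prop :=
  forall z : unit_disk R, derivable ('valL_0 f) (val z) 1.

Definition circle_mean (R : realType) (w : unit_disk R -> \bar R)
    (z : plane R) (r : R) : \bar R :=
  ((2 * pi)^-1%:E * \int[lebesgue_measure]_(t in `[0%R, (2 * pi)%R])
     'valL_0 w (z + r%:C * (cos t +i* sin t)%C)%R)%E.

Record superharmonic (R : realType) (w : unit_disk R -> \bar R) : Prop := {
  superharmonic_gtNy : forall z, (-oo < w z)%E;
  superharmonic_lsc : lower_semicontinuous w;
  superharmonic_mean : forall (z : unit_disk R) (r : R), 0 < r ->
    closed_ball_ Num.norm (val z) r%:C `<=` unit_disk R ->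
    (circle_mean w (val z) r <= w z)%E;
  superharmonic_nontriv : exists z, (w z < +oo)%E }.

Definition area_integral (R : realType) (F : plane R -> \bar R) : \bar R :=
  (\int[lebesgue_measure \x lebesgue_measure]_(p in
       [set p : R * R | unit_disk R (p.1 +i* p.2)%C])
     F (p.1 +i* p.2)%C)%E.

Definition dirichlet_integral (R : realType) (w : unit_disk R -> \bar R)
    (f : unit_disk R -> plane R) : \bar R :=
  (pi^-1%:E * area_integral (fun z =>
     (normc (derive1 ('valL_0 f) z) ^+ 2)%:E * 'valL_0 w z))%E.

Definition dirichlet_space (R : realType) (w : unit_disk R -> \bar R) :
    set (unit_disk R -> plane R) :=
  [set f | holomorphic f /\ (dirichlet_integral w f < +oo)%E].

(* Linear on the subspace [V]; the values off [V] are unconstrained. *)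
Definition linear_on (R : realType) (V : set (unit_disk R -> plane R))
    (L : (unit_disk R -> plane R) -> R[i]) : Prop :=
  forall (c : R[i]) f g, V f -> V g -> L (c *: f + g) = c * L f + L g.

(* Main.v *)
(* On the bounded elements of the space, which form an algebra, the
   Gleason-Kahane-Zelazko argument applies: the polynomial L((1 - X f)^n) has no
   small roots, which forces L(f^2) = L(f)^2, hence multiplicativity and
   L f = f(a) with a = L(z). If Re G >= 1, the factors 1 - r/G with |r| < 1 never
   vanish; multiplying G by such factors perturbs it by a bounded element, and a
   suitable product would be a nowhere vanishing function killed by L unless
   L G = G(a). Finally every f is a difference of two functions with real part at
   least 1, because |Re f| has a harmonic majorant Re F with F in the space.

   F is the limit of the Poisson extensions of |Re f| from the circles |z| = r,
   r -> 1. With u = Re f and U the extension, U^2 - u^2 is nonnegative and vanishes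
   on the circle, and its Laplacian is 2|F'|^2 - 2|f'|^2; testing the
   superharmonicity of w against it gives that the energy of F does not exceed
   that of f. Laplacians are avoided by working with circular means, Tonelli and
   translation invariance. A Hopf type bound w >= c (1 - |z|^2) keeps U(0)
   bounded as r -> 1, and the Schwarz formula gives locally uniform convergence. *)

(* [L] is not assumed continuous, so no limit can be taken under [L]: whatever is learned about [L]
   comes from one zero-free element of the space, obtained by finitely many algebraic operations.
   Limits occur only on the side of the functions, in the construction of F. Unbounded functions
   escape the algebra argument, and the factors 1 - r/G are the remedy: |(1/G)'| <= |G'|, so 1/G is
   a bounded element of the space, and G times such factors stays in G plus the algebra, where [L]
   is already known. Any nonzero value can be produced at a, since every neighbourhood of 1
   generates the multiplicative group of nonzero complex numbers.

   In the analytic half the weight may be discontinuous or infinite, so only its circular means of a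
   small radius x are compared with it. The Taylor errors of order x^3 in the test function are then
   multiplied by the total mass of w, which is why w must first be shown integrable over the whole
   disk. Slack terms are fixed rather than sent to 0, so the energy obtained is M + 1 instead of M;
   finiteness is all that the functional argument asks for. *)
Require Import Defs.
From HB Require Import structures.
From mathcomp Require Import measurable_realfun.
From mathcomp Require Import ring lra.
Import Order.TTheory GRing.Theory Num.Theory.
Import numFieldNormedType.Exports.
Import ComplexField.Normc.
Set Implicit Arguments.
Unset Strict Implicit.
Unset Printing Implicit Defensive.
Local Open Scope classical_set_scope.
Local Open Scope ring_scope.
Local Open Scope complex_scope.
Local Notation Re := complex.Re.
Local Notation Im := complex.Im.

(** * Goursat's theorem for closed forms *)

Section RealIntegral.
Variable R : realType.
Implicit Types (f g : R -> R) (a b c : R).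

Definition itg f a b : R := \int[lebesgue_measure]_(x in `[a, b]) f x.

Lemma itg_integrable f a b : continuous f ->
  lebesgue_measure.-integrable `[a, b] (EFin \o f).
Proof.
move=> cf; apply: continuous_compact_integrable; first exact: segment_compact.
exact: continuous_subspaceT.
Qed.

Lemma itgD f g a b : continuous f -> continuous g ->
  itg (fun x => f x + g x) a b = itg f a b + itg g a b.
Proof. by move=> cf cg; rewrite /itg RintegralD//; exact: itg_integrable. Qed.

Lemma itgB f g a b : continuous f -> continuous g ->
  itg (fun x => f x - g x) a b = itg f a b - itg g a b.
Proof. by move=> cf cg; rewrite /itg RintegralB//; exact: itg_integrable. Qed.

Lemma itgZ k f a b : continuous f ->
  itg (fun x => k * f x) a b = k * itg f a b.
Proof. by move=> cf; rewrite /itg RintegralZl//; exact: itg_integrable. Qed.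

Lemma itg_cst k a b : a <= b -> itg (fun=> k) a b = k * (b - a).
Proof.
move=> ab; rewrite /itg Rintegral_cst//= lebesgue_measure_itv/= lte_fin.
by case: ltgtP ab => // ->; rewrite subrr.
Qed.

Lemma le_itg f g a b : continuous f -> continuous g ->
  (forall x, a <= x <= b -> f x <= g x) -> itg f a b <= itg g a b.
Proof.
move=> cf cg fg; rewrite /itg le_Rintegral//; exact: itg_integrable.
Qed.

Lemma itg_chasles f a b c : continuous f -> a <= b -> b <= c ->
  itg f a b + itg f b c = itg f a c.
Proof.
move=> cf ab bc; have cf' := itg_integrable a c cf.
rewrite -[itg f b c](@Rintegral_itv_obnd_cbnd _ b (BRight c)); last first.
  by apply: integrableS (itg_integrable b c cf) => //; apply: subset_itvr; rewrite bnd_simp.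
rewrite /itg -(@Rintegral_itvB _ f (BLeft a) (BRight c) b)//.
by rewrite addrC subrK.
Qed.

Lemma itg_bound f a b M : continuous f -> a <= b ->
  (forall x, a <= x <= b -> `|f x| <= M) -> `|itg f a b| <= M * (b - a).
Proof.
move=> cf ab fM; rewrite ler_norml -mulNr -!itg_cst//.
apply/andP; split; apply: le_itg => //; try exact: cst_continuous;
  by move=> x /fM; rewrite ler_norml => /andP[].
Qed.

Lemma continuous_of_increments f :
  (forall x e, 0 < e -> exists2 d, 0 < d &
     forall h, `|h| <= d -> `|f (x + h) - f x| < e) -> continuous f.
Proof.
move=> H x; apply/cvgrPdist_lt => e /(H x)[d d0 hd]; near=> t.
have tx : `|t - x| <= d by rewrite distrC; near: t; exact: cvgr_dist_le.
by have := hd _ tx; rewrite subrKC distrC.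
Unshelve. all: by end_near. Qed.

(* The 1-form [P dx + Q dy] is closed in the weak, pointwise sense: [P] and [Q]
   are differentiable and the two mixed partial derivatives agree. *)
Definition closed_form (P Q : R -> R -> R) := forall x y, exists a b c,
  forall e, 0 < e -> exists2 d, 0 < d & forall h k, `|h| <= d -> `|k| <= d ->
    `|P (x + h) (y + k) - P x y - a * h - b * k| <= e * (`|h| + `|k|) /\
    `|Q (x + h) (y + k) - Q x y - b * h - c * k| <= e * (`|h| + `|k|).

(** The integral of P dx + Q dy counterclockwise around the rectangle with opposite corners (x, y)
    and (x + A, y + B). *)
Definition boundary_itg (P Q : R -> R -> R) x y A B :=
  (itg (P^~ y) x (x + A) - itg (P^~ (y + B)) x (x + A)) +
  (itg (Q (x + A)) y (y + B) - itg (Q x) y (y + B)).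

Section Goursat.
Variables (P Q : R -> R -> R).
Hypothesis PQ : closed_form P Q.

Lemma closed_form_continuous :
  [/\ forall y, continuous (P^~ y), forall x, continuous (P x),
      forall y, continuous (Q^~ y) & forall x, continuous (Q x)].
Proof.
suff H x y e : 0 < e -> exists2 d, 0 < d & forall h k, `|h| <= d -> `|k| <= d ->
    `|P (x + h) (y + k) - P x y| < e /\ `|Q (x + h) (y + k) - Q x y| < e.
  split=> u; apply: continuous_of_increments => v e /H.
  - move=> /(_ v u)[d d0 hd]; exists d => // h hh.
    have d' : `|0 : R| <= d by rewrite normr0 ltW.
    by have [+ _] := hd h 0 hh d'; rewrite addr0.
  - move=> /(_ u v)[d d0 hd]; exists d => // h hh.
    have d' : `|0 : R| <= d by rewrite normr0 ltW.
    by have [+ _] := hd 0 h d' hh; rewrite addr0.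
  - move=> /(_ v u)[d d0 hd]; exists d => // h hh.
    have d' : `|0 : R| <= d by rewrite normr0 ltW.
    by have [_ +] := hd h 0 hh d'; rewrite addr0.
  - move=> /(_ u v)[d d0 hd]; exists d => // h hh.
    have d' : `|0 : R| <= d by rewrite normr0 ltW.
    by have [_ +] := hd 0 h d' hh; rewrite addr0.
move=> e0; have [a [b [c /(_ 1 ltr01)[d d0 hd]]]] := PQ x y.
(* Large enough for both coefficient pairs, (a, b) and (b, c). *)
pose M := 2 + `|a| + 2 * `|b| + `|c|.
have M0 : 0 < M by rewrite /M; have := (normr_ge0 a, normr_ge0 b, normr_ge0 c);
  move=> [] [] *; lra.
exists (Num.min d (e / (2 * M))); first by rewrite lt_min d0 divr_gt0// mulr_gt0.
move=> h k; rewrite !le_min => /andP[hd1 he] /andP[kd1 ke].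
have [HP HQ] := hd h k hd1 kd1.
have le_e t : 0 <= t <= M -> t * (e / (2 * M)) < e.
  move=> /andP[t0 tM]; apply: (@le_lt_trans _ _ (M * (e / (2 * M)))).
    by rewrite ler_wpM2r// divr_ge0 ?mulr_ge0 ?ltW.
  by rewrite (_ : M * _ = e / 2); [lra | field; lra].
have a0 := normr_ge0 a; have b0 := normr_ge0 b; have c0 := normr_ge0 c.
have H F p q : `|F - p * h - q * k| <= 1 * (`|h| + `|k|) -> 
    `|F| <= (2 + `|p| + `|q|) * (e / (2 * M)).
  move=> HF; have -> : F = (F - p * h - q * k) + p * h + q * k by ring.
  apply: le_trans (ler_normD _ _) _.
  have hp : `|p * h| <= `|p| * (e / (2 * M)) by rewrite normrM ler_wpM2l.
  have hq : `|q * k| <= `|q| * (e / (2 * M)) by rewrite normrM ler_wpM2l.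
  have := ler_normD (F - p * h - q * k) (p * h); lra.
split; [apply: le_lt_trans (H _ _ _ HP) _|apply: le_lt_trans (H _ _ _ HQ) _];
  apply: le_e; rewrite /M; lra.
Qed.

Local Notation W := (boundary_itg P Q).

Lemma boundary_itg_split x y A B : 0 <= A -> 0 <= B ->
  W x y (A + A) (B + B) = W x y A B + W (x + A) y A B + W x (y + B) A B
    + W (x + A) (y + B) A B.
Proof.
have [cP _ _ cQ] := closed_form_continuous => A0 B0.
have split_itg f u D : continuous f -> 0 <= D ->
    itg f u (u + (D + D)) = itg f u (u + D) + itg f (u + D) (u + D + D).
  by move=> cf D0; rewrite itg_chasles// ?addrA// lerDl.
by rewrite /boundary_itg !split_itg// !addrA; ring.
Qed.

(** The affine part of a closed form contributes b (s A)(s B) on the vertical sides and the opposite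
    on the horizontal ones, because the mixed derivatives agree. What remains is e times O(s) on
    sides of length O(s). *)
Lemma boundary_itg_small A B : 0 <= A -> 0 <= B -> forall x y e, 0 < e ->
  exists2 d, 0 < d & forall s u v, 0 <= s <= d -> u <= x <= u + s * A ->
    v <= y <= v + s * B -> `|W u v (s * A) (s * B)| <= e * s ^+ 2.
Proof.
move=> A0 B0 x y e e0; have [cP _ _ cQ] := closed_form_continuous.
have [a [b [c hd]]] := PQ x y.
(* The sides contribute 2 t (s A + s B) with t = (e / N)(s A + s B), hence at most e s^2. The added
   1 keeps N positive for a degenerate rectangle. *)
pose N := 2 * (A + B + 1) ^+ 2.
have N0 : 0 < N by rewrite mulr_gt0// exprn_gt0//; lra.
have [d d0 {}hd] := hd _ (divr_gt0 e0 N0).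
exists (d / (A + B + 1)); first by rewrite divr_gt0//; lra.
move=> s u v /andP[s0]; rewrite ler_pdivlMr; last lra.
move=> sd /andP[ux xu] /andP[vy yv].
have sA : 0 <= s * A by exact: mulr_ge0.
have sB : 0 <= s * B by exact: mulr_ge0.
pose t := e / N * (s * A + s * B).
have near_xy p q : u <= p <= u + s * A -> v <= q <= v + s * B ->
    `|P p q - P x y - a * (p - x) - b * (q - y)| <= t /\
    `|Q p q - Q x y - b * (p - x) - c * (q - y)| <= t.
  move=> /andP[up pu] /andP[vq qv].
  have hp : `|p - x| <= s * A by rewrite ler_norml; lra.
  have hq : `|q - y| <= s * B by rewrite ler_norml; lra.
  have [||] := hd (p - x) (q - y); [nra|nra|rewrite !subrKC => h1 h2].
  by split; [apply: le_trans h1 _|apply: le_trans h2 _];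
    (apply: ler_wpM2l; [by rewrite divr_ge0// ltW|exact: lerD]).
have cPd : continuous (fun p => P p v - P p (v + s * B)).
  by move=> p; apply: cvgB; exact: cP.
have cQd : continuous (fun q => Q (u + s * A) q - Q u q).
  by move=> p; apply: cvgB; exact: cQ.
have cc (k : R) : continuous (fun _ : R => k) by move=> z; exact: cvg_cst.
have HP : `|itg (fun p => P p v - P p (v + s * B) + b * (s * B)) u (u + s * A)|
    <= 2 * t * (s * A).
  have -> : 2 * t * (s * A) = 2 * t * (u + s * A - u) by rewrite addrAC subrr add0r.
  apply: itg_bound; rewrite ?lerDl//.
    by move=> p; apply: cvgD; [exact: cPd|exact: cc].
  move=> p pu; have vv : v <= v <= v + s * B by rewrite lexx lerDl.
  have vv' : v <= v + s * B <= v + s * B by rewrite lexx lerDl sB.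
  have [h1 _] := near_xy _ _ pu vv; have [h2 _] := near_xy _ _ pu vv'.
  by move: h1 h2; rewrite !ler_norml; lra.
have HQ : `|itg (fun q => Q (u + s * A) q - Q u q - b * (s * A)) v (v + s * B)|
    <= 2 * t * (s * B).
  have -> : 2 * t * (s * B) = 2 * t * (v + s * B - v) by rewrite addrAC subrr add0r.
  apply: itg_bound; rewrite ?lerDl//.
    by move=> p; apply: cvgB; [exact: cQd|exact: cc].
  move=> q qv; have uu : u <= u <= u + s * A by rewrite lexx lerDl.
  have uu' : u <= u + s * A <= u + s * A by rewrite lexx lerDl sA.
  have [_ h1] := near_xy _ _ uu qv; have [_ h2] := near_xy _ _ uu' qv.
  by move: h1 h2; rewrite !ler_norml; lra.
have -> : W u v (s * A) (s * B) =
    itg (fun p => P p v - P p (v + s * B) + b * (s * B)) u (u + s * A) +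
    itg (fun q => Q (u + s * A) q - Q u q - b * (s * A)) v (v + s * B).
  rewrite itgD// itgB// itgB// itgB// !itg_cst ?lerDl// /boundary_itg.
  by ring.
apply: le_trans (ler_normD _ _) _; apply: le_trans (lerD HP HQ) _.
have -> : 2 * t * (s * A) + 2 * t * (s * B) =
    e * s ^+ 2 * ((A + B) ^+ 2 / (A + B + 1) ^+ 2).
  by rewrite /t /N; field; lra.
apply: ler_piMr; first by rewrite mulr_ge0 ?sqr_ge0 ?ltW.
by rewrite ler_pdivrMr ?mul1r; [nra | rewrite exprn_gt0//; lra].
Qed.

(* Bisection: if [|W| > K s^2] on a rectangle of scale [s], the same holds on
   one of its four quarters; the quarters shrink to a point at which
   [boundary_itg_small] is violated. *)
Theorem goursat x y A B : 0 <= A -> 0 <= B -> W x y A B = 0.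
Proof.
move=> A0 B0; apply/eqP; rewrite -normr_le0 leNgt; apply/negP => K0.
set K := `|_| in K0.
pose bad (p : R * R * R) := 0 <= p.2 /\
  K * p.2 ^+ 2 <= `|W p.1.1 p.1.2 (p.2 * A) (p.2 * B)|.
have child p : exists q, bad p -> [/\ bad q, q.2 = p.2 / 2,
    p.1.1 <= q.1.1 /\ q.1.1 + q.2 * A <= p.1.1 + p.2 * A &
    p.1.2 <= q.1.2 /\ q.1.2 + q.2 * B <= p.1.2 + p.2 * B].
  case: p => [[u v] s]; rewrite /bad/=.
  have [|//] := pselect (0 <= s /\ K * s ^+ 2 <= `|W u v (s * A) (s * B)|);
    last by move=> nb; exists (u, v, s).
  move=> [s0 Ks].
  have sA : 0 <= s / 2 * A by rewrite !mulr_ge0.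
  have sB : 0 <= s / 2 * B by rewrite !mulr_ge0.
  have := boundary_itg_split u v sA sB.
  have eA : s / 2 * A + s / 2 * A = s * A by lra.
  have eB : s / 2 * B + s / 2 * B = s * B by lra.
  rewrite eA eB.
  have A1 : u <= u + s / 2 * A by rewrite lerDl.
  have A2 : u + s / 2 * A <= u + s * A by rewrite lerD2l -eA lerDl.
  have A3 : u + s / 2 * A + s / 2 * A <= u + s * A by rewrite -addrA eA.
  have B1 : v <= v + s / 2 * B by rewrite lerDl.
  have B2 : v + s / 2 * B <= v + s * B by rewrite lerD2l -eB lerDl.
  have B3 : v + s / 2 * B + s / 2 * B <= v + s * B by rewrite -addrA eB.
  have s2 : 0 <= s / 2 by lra.
  have K2 : K * (s / 2) ^+ 2 = K * s ^+ 2 / 4 by field.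
  move=> splitW; have [h1|h1] := leP (K * (s / 2) ^+ 2) `|W u v (s/2*A) (s/2*B)|.
    by exists (u, v, s / 2) => _ /=; split => //; split => //.
  have [h2|h2] := leP (K * (s / 2) ^+ 2) `|W (u + s/2*A) v (s/2*A) (s/2*B)|.
    by exists (u + s/2*A, v, s / 2) => _ /=; split => //; split => //.
  have [h3|h3] := leP (K * (s / 2) ^+ 2) `|W u (v + s/2*B) (s/2*A) (s/2*B)|.
    by exists (u, v + s/2*B, s / 2) => _ /=; split => //; split => //.
  exists (u + s/2*A, v + s/2*B, s / 2) => _ /=; split => //; split => //.
  rewrite leNgt; apply/negP => h4.
  move: Ks; rewrite splitW; apply/negP; rewrite -ltNge.
  do 3 (apply: le_lt_trans (ler_normD _ _) _; rewrite -?ltrBrDr).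
  lra.
have [f Hf] := boolp.choice child.
pose p n := iter n f (x, y, 1).
have bad_p n : bad (p n) /\ (p n).2 = 2 ^- n.
  elim: n => [|n [/Hf[? e _ _] IH]]; first by rewrite /bad/= expr0 invr1 expr1n !mul1r mulr1.
  by split => //; rewrite [LHS]e IH exprS invfM mulrC.
have nest n : [/\ (p n).1.1 <= (p n.+1).1.1,
    (p n.+1).1.1 + 2 ^- n.+1 * A <= (p n).1.1 + 2 ^- n * A,
    (p n).1.2 <= (p n.+1).1.2 &
    (p n.+1).1.2 + 2 ^- n.+1 * B <= (p n).1.2 + 2 ^- n * B].
  have [/Hf[_ _ [h1 h2] [h3 h4]] e] := bad_p n; have [_ e'] := bad_p n.+1.
  by rewrite -e -e'.
have lim_of (a : nat -> R) D : 0 <= D -> (forall n, a n <= a n.+1) ->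
    (forall n, a n.+1 + 2 ^- n.+1 * D <= a n + 2 ^- n * D) ->
    exists l, forall n, a n <= l <= a n + 2 ^- n * D.
  move=> D0 ha hb.
  have ha' m n : (m <= n)%N -> a m <= a n.
    by move=> mn; apply: (homo_leq (@lexx _ R) (@le_trans _ R)) mn; exact: ha.
  have hb' m n : (m <= n)%N -> a n + 2 ^- n * D <= a m + 2 ^- m * D.
    move=> mn; rewrite -lerN2; move: m n mn.
    by apply: (homo_leq (@lexx _ R) (@le_trans _ R)) => n; rewrite lerN2; exact: hb.
  have ub m n : a m <= a n + 2 ^- n * D.
    have D' k : 0 <= 2 ^- k * D by rewrite mulr_ge0.
    have [mn|/ltnW nm] := leqP m n.
      by apply: le_trans (ha' _ _ mn) _; rewrite lerDl.
    by apply: le_trans (hb' _ _ nm); rewrite lerDl.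
  exists (sup (range a)) => n; apply/andP; split.
    apply: ub_le_sup; last by exists n.
    by exists (a 0%N + 2 ^- 0 * D) => _ [m _ <-].
  by apply: ge_sup; [exists (a 0%N), 0%N|move=> _ [m _ <-]].
have [X HX] : exists l, forall n, (p n).1.1 <= l <= (p n).1.1 + 2 ^- n * A.
  by apply: lim_of => // n; have [] := nest n.
have [Y HY] : exists l, forall n, (p n).1.2 <= l <= (p n).1.2 + 2 ^- n * B.
  by apply: lim_of => // n; have [] := nest n.
have [|d d0 Hd] := boundary_itg_small A0 B0 X Y (e := K / 2); first by lra.
have [n Hn] : exists n, (2 : R) ^- n <= d.
  have /(cvgr_dist_le (F:=\oo))/(_ _ d0)[n _ /(_ n (leqnn n))] :
      (fun n => (2 : R) ^- n) @ \oo --> 0.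
    under eq_fun do rewrite -exprVn.
    by apply: cvg_expr; rewrite ger0_norm ?invr_ge0// invf_lt1// ltr1n.
  by rewrite /= sub0r normrN ger0_norm ?invr_ge0 ?exprn_ge0//; exists n.
case: (bad_p n) => -[_ Kn] en; rewrite en in Kn.
have s0 : 0 < (2 : R) ^- n by rewrite invr_gt0 exprn_gt0.
have sd : 0 <= (2 : R) ^- n <= d by rewrite ltW.
have := le_trans Kn (Hd _ _ _ sd (HX n) (HY n)).
by rewrite ler_pM2r ?exprn_gt0//; lra.
Qed.

End Goursat.
End RealIntegral.

(** * The Cauchy formula on a disk *)

Section ComplexToolkit.
Variable R : realType.
Local Notation C := R[i].
Implicit Types (z w : C).

Lemma normc_ge0 z : 0 <= normc z. Proof. by case: z => x y; exact: sqrtr_ge0. Qed.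

Lemma normc_sqr z : normc z ^+ 2 = Re z ^+ 2 + Im z ^+ 2.
Proof. by case: z => x y; rewrite sqr_sqrtr// addr_ge0// sqr_ge0. Qed.

Lemma normc_eq0 z : (normc z == 0) = (z == 0).
Proof. by apply/eqP/eqP => [/eq0_normc//|->]; exact: normc0. Qed.

Lemma normc_gt0 z : (0 < normc z) = (z != 0).
Proof. by rewrite lt_def normc_ge0 andbT normc_eq0. Qed.

Lemma le_normcB z w : normc (z - w) <= normc z + normc w.
Proof. by rewrite -(normcN w) le_normcD. Qed.

Lemma le_normcBD z w : normc z <= normc (z - w) + normc w.
Proof. by rewrite -{1}(subrK w z) le_normcD. Qed.

Lemma normcBC z w : normc (z - w) = normc (w - z).
Proof. by rewrite -normcN opprB. Qed.

Lemma normc_real (x : R) : normc x%:C = `|x|.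
Proof. by rewrite /normc/= expr0n addr0 sqrtr_sqr. Qed.

Lemma normcJ' z : normc z^*%C = normc z.
Proof. by case: z => x y; rewrite /normc/= sqrrN. Qed.

Lemma normcX z n : normc (z ^+ n) = normc z ^+ n.
Proof. by elim: n => [|n IH]; rewrite ?expr0 ?normc1// !exprS normcM IH. Qed.

Lemma normr_Re z : `|Re z| <= normc z.
Proof.
rewrite -ler_sqr ?nnegrE ?normc_ge0// normc_sqr -normrX ger0_norm ?sqr_ge0//.
by rewrite lerDl sqr_ge0.
Qed.

Lemma normr_Im z : `|Im z| <= normc z.
Proof.
rewrite -ler_sqr ?nnegrE ?normc_ge0// normc_sqr -normrX ger0_norm ?sqr_ge0//.
by rewrite lerDr sqr_ge0.
Qed.

Lemma normc_le z : normc z <= `|Re z| + `|Im z|.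
Proof.
rewrite -ler_sqr ?nnegrE ?normc_ge0 ?addr_ge0// normc_sqr.
have := mulr_ge0 (normr_ge0 (Re z)) (normr_ge0 (Im z)).
have := real_normK (num_real (Re z)); have := real_normK (num_real (Im z)).
nra.
Qed.

Lemma mulJc z : z * z^*%C = (normc z ^+ 2)%:C.
Proof.
case: z => x y; rewrite normc_sqr; apply/eqP; rewrite eq_complex/=.
by apply/andP; split; apply/eqP; ring.
Qed.

Lemma Re_mulrC (x : R) z : Re (x%:C * z) = x * Re z.
Proof. by case: z => a b /=; rewrite mul0r subr0. Qed.

Lemma Im_mulrC (x : R) z : Im (x%:C * z) = x * Im z.
Proof. by case: z => a b /=; rewrite mul0r addr0. Qed.

Lemma cReD z w : Re (z + w) = Re z + Re w. Proof. by case: z w => ? ? []. Qed.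
Lemma cImD z w : Im (z + w) = Im z + Im w. Proof. by case: z w => ? ? []. Qed.
Lemma cReN z : Re (- z) = - Re z. Proof. by case: z. Qed.
Lemma cImN z : Im (- z) = - Im z. Proof. by case: z. Qed.
Lemma cReM z w : Re (z * w) = Re z * Re w - Im z * Im w.
Proof. by case: z w => ? ? []. Qed.
Lemma cImM z w : Im (z * w) = Re z * Im w + Im z * Re w.
Proof. by case: z w => ? ? []. Qed.

Lemma complex_ext z w : Re z = Re w -> Im z = Im w -> z = w.
Proof. by case: z w => ? ? [? ?] /= -> ->. Qed.

(** The radii and errors are real and the norm is [normc], so that estimates take place in [R];
    [cderiv_derivable] and [derivable_cderiv] link this to the derivative used in the statement. *)
Definition cderiv (f : C -> C) z d := forall e, 0 < e -> exists2 r, 0 < r &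
  forall h : C, normc h <= r -> normc (f (z + h) - f z - d * h) <= e * normc h.

Lemma cderiv_lip f z d : cderiv f z d -> exists2 r, 0 < r &
  forall h : C, normc h <= r -> normc (f (z + h) - f z) <= (1 + normc d) * normc h.
Proof.
move=> /(_ 1 ltr01)[r r0 H]; exists r => // h /H {}H.
rewrite -(subrK (d * h) (f (z + h) - f z)).
by apply: le_trans (le_normcD _ _) _; rewrite mulrDl normcM lerD.
Qed.

Lemma cderiv_ext (f g : C -> C) z d r : 0 < r ->
  (forall h : C, normc h <= r -> f (z + h) = g (z + h)) -> cderiv f z d -> cderiv g z d.
Proof.
move=> r0 fg H e e0; have [s s0 {}H] := H e e0.
exists (Num.min r s); first by rewrite lt_min r0.
move=> h; rewrite le_min => /andP[hr hs].
have gz : f z = g z by have := fg 0; rewrite normc0 addr0; apply; exact: ltW.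
by rewrite -fg// -gz; exact: H.
Qed.

(** Total differentiability of a complex function of two real variables, with partial derivatives a
    and b. It serves to verify that pulled-back forms are closed. *)
Definition cdiff2 (F : R -> R -> C) (x y : R) (a b : C) :=
  forall e, 0 < e -> exists2 r, 0 < r & forall h k : R, `|h| <= r -> `|k| <= r ->
    normc (F (x + h) (y + k) - F x y - a * h%:C - b * k%:C) <= e * (`|h| + `|k|).

Lemma cdiff2_lip F x y a b : cdiff2 F x y a b -> exists2 r, 0 < r &
  forall h k : R, `|h| <= r -> `|k| <= r -> normc (F (x + h) (y + k) - F x y) <=
    (1 + normc a + normc b) * (`|h| + `|k|).
Proof.
move=> /(_ 1 ltr01)[r r0 H]; exists r => // h k hr kr.
have -> : F (x + h) (y + k) - F x y =
  (F (x + h) (y + k) - F x y - a * h%:C - b * k%:C) + a * h%:C + b * k%:C by ring.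
have h0 := normr_ge0 h; have k0 := normr_ge0 k.
have := le_normcD (F (x + h) (y + k) - F x y - a * h%:C - b * k%:C) (a * h%:C).
have := le_normcD (F (x + h) (y + k) - F x y - a * h%:C - b * k%:C + a * h%:C) (b * k%:C).
have := H h k hr kr; have := normc_ge0 a; have := normc_ge0 b.
by rewrite !normcM !normc_real; nra.
Qed.

Lemma cdiff2_cst c x y : cdiff2 (fun _ _ => c) x y 0 0.
Proof.
move=> e e0; exists 1 => // h k _ _; rewrite !mul0r !subr0 subrr normc0.
by apply: mulr_ge0; [exact: ltW|exact: addr_ge0].
Qed.

Lemma cdiff2D F G x y a b c d : cdiff2 F x y a b -> cdiff2 G x y c d ->
  cdiff2 (fun p q => F p q + G p q) x y (a + c) (b + d).
Proof.
move=> HF HG e e0; have e2 : 0 < e / 2 by lra.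
have [r r0 {}HF] := HF _ e2; have [s s0 {}HG] := HG _ e2.
exists (Num.min r s); first by rewrite lt_min r0.
move=> h k; rewrite !le_min => /andP[hr hs] /andP[kr ks].
have -> : F (x + h) (y + k) + G (x + h) (y + k) - (F x y + G x y) -
    (a + c) * h%:C - (b + d) * k%:C = (F (x + h) (y + k) - F x y - a * h%:C - b * k%:C) +
    (G (x + h) (y + k) - G x y - c * h%:C - d * k%:C) by ring.
apply: le_trans (le_normcD _ _) _.
have := HF h k hr kr; have := HG h k hs ks; lra.
Qed.

Lemma cdiff2_comp f F x y a b d : cderiv f (F x y) d -> cdiff2 F x y a b ->
  cdiff2 (fun p q => f (F p q)) x y (d * a) (d * b).
Proof.
move=> Hf HF e e0; have [s s0 LF] := cdiff2_lip HF.
set L := 1 + _ + _ in LF.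
have L0 : 0 < L by rewrite /L -addrA ltr_wpDr ?addr_ge0 ?normc_ge0.
have d1 : 0 < 1 + normc d by rewrite ltr_wpDr ?normc_ge0.
have eL : 0 < e / (2 * L) by rewrite divr_gt0//; lra.
have ed : 0 < e / (2 * (1 + normc d)) by rewrite divr_gt0//; lra.
have [t t0 {}Hf] := Hf _ eL; have [r r0 {}HF] := HF _ ed.
exists (Num.min (Num.min r s) (t / (2 * L))).
  by rewrite !lt_min r0 s0 divr_gt0//; lra.
move=> h k; rewrite !le_min => /andP[/andP[hr hs] ht] /andP[/andP[kr ks] kt].
have {}LF := LF h k hs ks; have {}HF := HF h k hr kr.
set v := F (x + h) (y + k) - F x y in LF HF *.
have N0 : 0 <= `|h| + `|k| by rewrite addr_ge0.
have vt : normc v <= t.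
  apply: le_trans LF _; rewrite mulrC -ler_pdivlMr//.
  by apply: le_trans (lerD ht kt) _; rewrite le_eqVlt; apply/orP; left; apply/eqP; field; lra.
have {}Hf := Hf v vt; rewrite subrKC in Hf.
have -> : f (F (x + h) (y + k)) - f (F x y) - d * a * h%:C - d * b * k%:C =
  (f (F (x + h) (y + k)) - f (F x y) - d * v) + d * (v - a * h%:C - b * k%:C) by ring.
apply: le_trans (le_normcD _ _) _; rewrite normcM.
have h1 : e / (2 * L) * normc v <= e / 2 * (`|h| + `|k|).
  have -> : e / 2 * (`|h| + `|k|) = e / (2 * L) * (L * (`|h| + `|k|)) by field; lra.
  by apply: ler_wpM2l => //; rewrite divr_ge0; lra.
have h2 : normc d * normc (v - a * h%:C - b * k%:C) <= e / 2 * (`|h| + `|k|).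
  have -> : e / 2 * (`|h| + `|k|) =
    (1 + normc d) * (e / (2 * (1 + normc d)) * (`|h| + `|k|)) by field; lra.
  by apply: ler_pM; rewrite ?normc_ge0//; lra.
lra.
Qed.

Lemma cdiff2M F G x y a b c d : cdiff2 F x y a b -> cdiff2 G x y c d ->
  cdiff2 (fun p q => F p q * G p q) x y
    (a * G x y + F x y * c) (b * G x y + F x y * d).
Proof.
move=> HF HG e e0; have [s1 s10 LF] := cdiff2_lip HF; have [s2 s20 LG] := cdiff2_lip HG.
set L := 1 + _ + _ in LF; set M := 1 + _ + _ in LG.
have L0 : 0 < L by rewrite /L -addrA ltr_wpDr ?addr_ge0 ?normc_ge0.
have M0 : 0 < M by rewrite /M -addrA ltr_wpDr ?addr_ge0 ?normc_ge0.
have gF := normc_ge0 (F x y); have gG := normc_ge0 (G x y).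
pose e' := e / (3 * (1 + normc (F x y) + normc (G x y))).
have e'0 : 0 < e' by rewrite divr_gt0//; lra.
have [r1 r10 {}HF] := HF _ e'0; have [r2 r20 {}HG] := HG _ e'0.
exists (Num.min (Num.min (Num.min s1 s2) (Num.min r1 r2)) (e / (6 * L * M))).
  by rewrite !lt_min s10 s20 r10 r20 divr_gt0// !mulr_gt0.
move=> h k; rewrite !le_min => /andP[/andP[/andP[hs1 hs2] /andP[hr1 hr2]] he].
move=> /andP[/andP[/andP[ks1 ks2] /andP[kr1 kr2]] ke].
have {}LF := LF h k hs1 ks1; have {}LG := LG h k hs2 ks2.
have {}HF := HF h k hr1 kr1; have {}HG := HG h k hr2 kr2.
have N0 : 0 <= `|h| + `|k| by rewrite addr_ge0.
set N := `|h| + `|k| in LF LG HF HG N0 *.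
set F1 := F (x + h) (y + k) in LF HF *; set G1 := G (x + h) (y + k) in LG HG *.
have -> : F1 * G1 - F x y * G x y - (a * G x y + F x y * c) * h%:C -
    (b * G x y + F x y * d) * k%:C =
  (F1 - F x y - a * h%:C - b * k%:C) * G x y +
  F x y * (G1 - G x y - c * h%:C - d * k%:C) + (F1 - F x y) * (G1 - G x y) by ring.
apply: le_trans (le_normcD _ _) _; apply: le_trans (lerD (le_normcD _ _) (lexx _)) _.
rewrite !normcM.
have e'K : e' * (normc (F x y) + normc (G x y)) <= e / 3.
  have -> : e / 3 = e' * (1 + normc (F x y) + normc (G x y)) by rewrite /e'; field; lra.
  by rewrite ler_wpM2l; lra.
have h1 : normc (F1 - F x y - a * h%:C - b * k%:C) * normc (G x y) <= e' * N * normc (G x y).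
  by rewrite ler_wpM2r.
have h2 : normc (F x y) * normc (G1 - G x y - c * h%:C - d * k%:C) <= normc (F x y) * (e' * N).
  by rewrite ler_wpM2l.
have h3 : normc (F1 - F x y) * normc (G1 - G x y) <= (L * N) * (M * N).
  by apply: ler_pM; rewrite ?normc_ge0.
have h4 : L * M * N <= e / 3.
  have -> : e / 3 = L * M * (e / (6 * L * M) + e / (6 * L * M)) by field; lra.
  by rewrite ler_wpM2l ?lerD// mulr_ge0// ltW.
have := mulr_ge0 (ltW e0) N0; have := ler_wpM2r N0 h4; have := ler_wpM2r N0 e'K; lra.
Qed.

Lemma cdiff2_x x y : cdiff2 (fun p _ => p%:C) x y 1 0.
Proof.
move=> e e0; exists 1 => // h k _ _.
have -> : (x + h)%:C - x%:C - 1 * h%:C - 0 * k%:C = 0 by rewrite rmorphD/=; ring.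
by rewrite normc0; apply: mulr_ge0; [exact: ltW|exact: addr_ge0].
Qed.

Lemma cdiff2_y (g : R -> R) (x y d : R) : is_derive y 1 g d ->
  cdiff2 (fun _ q => (g q)%:C) x y 0 d%:C.
Proof.
move=> dg e e0; have [dgd dgE] := dg.
have : (fun h => h^-1 *: ((g \o shift y) (h *: 1) - g y)) @ 0^' --> d.
  by rewrite -dgE; exact: dgd.
move=> /cvgrPdist_le/(_ e e0)[r r0 H]; rewrite /= in r0; exists (r / 2); first by lra.
move=> h k _ kr; 
rewrite [X in normc X](_ : _ = (g (y + k) - g y - d * k)%:C); last first.
  by apply: complex_ext => /=; ring.
rewrite normc_real.
have [->|k0] := eqVneq k 0.
  rewrite addr0 mulr0 subrr subr0 normr0 addr0.
  by apply: mulr_ge0; [exact: ltW|exact: normr_ge0].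
have kn : 0 < `|k| by rewrite normr_gt0.
have /H : ball_ Num.norm 0 r k by rewrite /= sub0r normrN; lra.
move=> /(_ k0); rewrite /= /shift/= [k *: 1]mulr1 (addrC k) => Hk.
have -> : g (y + k) - g y - d * k = - ((d - k^-1 *: (g (y + k) - g y)) * k).
  by rewrite /GRing.scale/=; field.
rewrite normrN normrM; apply: (@le_trans _ _ (e * `|k|)).
  by rewrite ler_wpM2r.
by apply: ler_wpM2l; [exact: ltW|rewrite lerDr].
Qed.

Lemma cdiff2_eq F (x y : R) a b a' b' : a = a' -> b = b' ->
  cdiff2 F x y a b -> cdiff2 F x y a' b'.
Proof. by move=> -> ->. Qed.

Lemma cderivV z : z != 0 -> cderiv (fun w => w^-1) z (- z ^- 2).
Proof.
move=> z0 e e0; have nz : 0 < normc z by rewrite normc_gt0.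
exists (Num.min (normc z / 2) (e * normc z ^+ 3 / 2)).
  by rewrite lt_min !divr_gt0// mulr_gt0// exprn_gt0.
move=> h; rewrite le_min => /andP[h1 h2].
have zh : normc z / 2 <= normc (z + h).
  by have := le_normcBD z (z + h); rewrite opprD addNKr normcN; lra.
have zh0 : z + h != 0 by rewrite -normc_gt0; lra.
have -> : (z + h)^-1 - z^-1 - - z ^- 2 * h = h * h * (z ^- 2 * (z + h)^-1).
  by field; rewrite z0 zh0.
rewrite !normcM !normcV normcX -mulrA mulrC; apply: ler_wpM2r; first exact: normc_ge0.
rewrite -invfM ler_pdivrMr; last by rewrite mulr_gt0 ?exprn_gt0//; lra.
apply: (le_trans h2).
have : 0 <= e * normc z ^+ 2 * (normc (z + h) - normc z / 2).
  by apply: mulr_ge0; [rewrite mulr_ge0 ?exprn_ge0 ?ltW|lra].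
by rewrite !exprS expr0; lra.
Qed.

Lemma cderiv_comp f g z a b : cderiv f (g z) a -> cderiv g z b ->
  cderiv (fun w => f (g w)) z (a * b).
Proof.
move=> Hf Hg e e0; have [s s0 Lg] := cderiv_lip Hg.
have b1 : 0 < 1 + normc b by rewrite ltr_wpDr ?normc_ge0.
have a1 : 0 < 1 + normc a by rewrite ltr_wpDr ?normc_ge0.
have e1 : 0 < e / (2 * (1 + normc b)) by rewrite divr_gt0//; lra.
have e2 : 0 < e / (2 * (1 + normc a)) by rewrite divr_gt0//; lra.
have [t t0 {}Hf] := Hf _ e1; have [r r0 {}Hg] := Hg _ e2.
exists (Num.min (Num.min r s) (t / (1 + normc b))).
  by rewrite !lt_min r0 s0 divr_gt0.
move=> h; rewrite !le_min => /andP[/andP[hr hs] ht].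
have {}Lg := Lg h hs; have {}Hg := Hg h hr.
set v := g (z + h) - g z in Lg Hg *.
have vt : normc v <= t.
  by apply: le_trans Lg _; rewrite mulrC -ler_pdivlMr.
have {}Hf := Hf v vt; rewrite subrKC in Hf.
have -> : f (g (z + h)) - f (g z) - a * b * h =
  (f (g (z + h)) - f (g z) - a * v) + a * (v - b * h) by ring.
apply: le_trans (le_normcD _ _) _; rewrite normcM.
have h1 : e / (2 * (1 + normc b)) * normc v <= e / 2 * normc h.
  have -> : e / 2 * normc h = e / (2 * (1 + normc b)) * ((1 + normc b) * normc h) by field; lra.
  by apply: ler_wpM2l => //; rewrite divr_ge0; lra.
have h2 : normc a * normc (v - b * h) <= e / 2 * normc h.
  have -> : e / 2 * normc h =
    (1 + normc a) * (e / (2 * (1 + normc a)) * normc h) by field; lra.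
  by apply: ler_pM; rewrite ?normc_ge0//; lra.
lra.
Qed.

Lemma cderiv_id z : cderiv id z 1.
Proof.
move=> e e0; exists 1 => // h _.
rewrite (_ : id (z + h) - id z - 1 * h = 0); last by rewrite /id; ring.
by rewrite normc0 mulr_ge0 ?normc_ge0// ltW.
Qed.

Lemma cderiv_cst c z : cderiv (fun=> c) z 0.
Proof.
by move=> e e0; exists 1 => // h _; rewrite mul0r !subrr normc0 mulr_ge0 ?normc_ge0// ltW.
Qed.

Lemma cderiv_affine u v z : cderiv (fun w => u * w + v) z u.
Proof.
move=> e e0; exists 1 => // h _; have -> : u * (z + h) + v - (u * z + v) - u * h = 0 by ring.
by rewrite normc0 mulr_ge0 ?normc_ge0// ltW.
Qed.

End ComplexToolkit.

(** * Averages over the circle *)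

Section CircleMean.
Variable R : realType.
Local Notation C := R[i].
Implicit Types (f g : R -> R) (p q : R -> C) (z w : C).

Definition avg f : R := (2 * pi)^-1 * itg f 0 (2 * pi).

Definition cavg p : C := avg (fun t => Re (p t)) +i* avg (fun t => Im (p t)).

Definition expi (t : R) : C := cos t +i* sin t.

Definition ccont p := continuous (fun t => Re (p t)) /\ continuous (fun t => Im (p t)).

Lemma pi2_gt0 : 0 < 2 * pi :> R.
Proof. by rewrite mulr_gt0// pi_gt0. Qed.

Lemma avgD f g : continuous f -> continuous g ->
  avg (fun t => f t + g t) = avg f + avg g.
Proof. by move=> cf cg; rewrite /avg itgD// mulrDr. Qed.

Lemma avgB f g : continuous f -> continuous g ->
  avg (fun t => f t - g t) = avg f - avg g.
Proof. by move=> cf cg; rewrite /avg itgB// mulrBr. Qed.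

Lemma avgZ k f : continuous f -> avg (fun t => k * f t) = k * avg f.
Proof. by move=> cf; rewrite /avg itgZ// mulrCA. Qed.

Lemma avg_cst k : avg (fun=> k) = k.
Proof.
rewrite /avg itg_cst ?subr0 ?ltW ?pi2_gt0// mulrC mulfK//.
by rewrite gt_eqF// pi2_gt0.
Qed.

Lemma le_avg f g : continuous f -> continuous g -> (forall t, f t <= g t) ->
  avg f <= avg g.
Proof.
move=> cf cg fg; apply: ler_wpM2l; first by rewrite invr_ge0 ltW// pi2_gt0.
exact: le_itg.
Qed.

Lemma avg_norm f g : continuous f -> continuous g -> (forall t, `|f t| <= g t) ->
  `|avg f| <= avg g.
Proof.
move=> cf cg fg; have cNg : continuous (fun t => -1 * g t).
  by move=> t; apply: cvgM; [exact: cvg_cst|exact: cg].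
rewrite ler_norml -mulN1r -avgZ//; apply/andP; split; apply: le_avg => // t;
  by move: (fg t); rewrite ler_norml ?mulN1r => /andP[].
Qed.

Lemma eq_avg f g : f =1 g -> avg f = avg g.
Proof. by move=> /funext ->. Qed.

Lemma eq_cavg p q : p =1 q -> cavg p = cavg q.
Proof. by move=> /funext ->. Qed.

Lemma ccont_cst z : ccont (fun=> z).
Proof. by split=> t; exact: cvg_cst. Qed.

Lemma ccont_real f : continuous f -> ccont (fun t => (f t)%:C).
Proof. by move=> cf; split=> t //=; exact: cvg_cst. Qed.

Lemma ccontD p q : ccont p -> ccont q -> ccont (fun t => p t + q t).
Proof.
move=> [a b] [c d]; split.
  by under eq_fun do rewrite cReD; move=> t; apply: cvgD; [exact: a|exact: c].
by under eq_fun do rewrite cImD; move=> t; apply: cvgD; [exact: b|exact: d].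
Qed.

Lemma ccontM p q : ccont p -> ccont q -> ccont (fun t => p t * q t).
Proof.
move=> [a b] [c d]; split.
  under eq_fun do rewrite cReM; move=> t.
  by apply: cvgB; apply: cvgM; [exact: a|exact: c|exact: b|exact: d].
under eq_fun do rewrite cImM; move=> t.
by apply: cvgD; apply: cvgM; [exact: a|exact: d|exact: b|exact: c].
Qed.

Lemma ccontN p : ccont p -> ccont (fun t => - p t).
Proof.
by move=> cp; under eq_fun do rewrite -mulN1r; apply: ccontM => //; exact: ccont_cst.
Qed.

Lemma ccontB p q : ccont p -> ccont q -> ccont (fun t => p t - q t).
Proof. by move=> cp cq; apply: ccontD => //; exact: ccontN. Qed.

Lemma ccont_expi : ccont expi.
Proof. by split; [exact: continuous_cos|exact: continuous_sin]. Qed.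

Lemma ccont_circle z (r : R) : ccont (fun t => z + r%:C * expi t).
Proof.
by apply: ccontD; [exact: ccont_cst|apply: ccontM; [exact: ccont_cst|exact: ccont_expi]].
Qed.

Lemma ccont_Re p : ccont p -> continuous (fun t => Re (p t)).
Proof. by case. Qed.

Lemma ccont_incr p : (forall t e, 0 < e -> exists2 d, 0 < d &
  forall h, `|h| <= d -> normc (p (t + h) - p t) < e) -> ccont p.
Proof.
move=> H; split; apply: continuous_of_increments => t e /(H t)[d d0 {}H];
  exists d => // h /H; apply: le_lt_trans.
  by rewrite -cReN -cReD normr_Re.
by rewrite -cImN -cImD normr_Im.
Qed.

Lemma ccont_incrE p t e : ccont p -> 0 < e -> exists2 d, 0 < d &
  forall h, `|h| <= d -> normc (p (t + h) - p t) < e.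
Proof.
move=> [/(_ t)/cvgrPdist_lt Hr /(_ t)/cvgrPdist_lt Hi] e0.
have e2 : 0 < e / 2 by lra.
have [a a0 {}Hr] := Hr _ e2; have [b b0 {}Hi] := Hi _ e2.
rewrite /= in a0 b0; exists (Num.min (a / 2) (b / 2)).
  by rewrite lt_min !divr_gt0.
move=> h; rewrite le_min => /andP[ha hb].
have /Hr/= h1 : ball_ Num.norm t a (t + h).
  by rewrite /= opprD addNKr normrN; lra.
have /Hi/= h2 : ball_ Num.norm t b (t + h).
  by rewrite /= opprD addNKr normrN; lra.
apply: le_lt_trans (normc_le _) _; rewrite cReD cImD cReN cImN.
by rewrite distrC (distrC (Im _)); lra.
Qed.

Lemma ccont_comp (f : C -> C) p : ccont p ->
  (forall t e, 0 < e -> exists2 r, 0 < r &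
    forall h : C, normc h <= r -> normc (f (p t + h) - f (p t)) < e) ->
  ccont (fun t => f (p t)).
Proof.
move=> cp H; apply: ccont_incr => t e /(H t)[r r0 {}H].
have [d d0 Hd] := ccont_incrE t cp r0; exists d => // h /Hd/ltW/H.
by rewrite subrKC.
Qed.

Lemma cderiv_cont (f : C -> C) z d : cderiv f z d -> forall e, 0 < e -> exists2 r, 0 < r &
    forall h : C, normc h <= r -> normc (f (z + h) - f z) < e.
Proof.
move=> /cderiv_lip[s s0 H] e e0; have d1 : 0 < 1 + normc d by rewrite ltr_wpDr ?normc_ge0.
exists (Num.min s (e / (2 * (1 + normc d)))).
  by rewrite lt_min s0 divr_gt0//; lra.
move=> h; rewrite le_min => /andP[/H h1 h2]; apply: le_lt_trans h1 _.
apply: le_lt_trans (ler_wpM2l (ltW d1) h2) _.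
by rewrite (_ : (1 + normc d) * _ = e / 2); [lra|field; lra].
Qed.

Lemma ccont_cderiv (f : C -> C) p : ccont p ->
  (forall t, exists d, cderiv f (p t) d) -> ccont (fun t => f (p t)).
Proof.
by move=> cp H; apply: ccont_comp => // t; have [d /cderiv_cont] := H t; exact.
Qed.

Lemma ccontV p : ccont p -> (forall t, p t != 0) -> ccont (fun t => (p t)^-1).
Proof.
move=> cp p0; apply: (@ccont_cderiv (fun w : C => w^-1) p) => // t.
by exists (- p t ^- 2); exact: cderivV.
Qed.

Lemma ccontJ p : ccont p -> ccont (fun t => (p t)^*%C).
Proof.
move=> [a b]; split.
  by rewrite (_ : (fun _ => _) = (fun t => Re (p t)))//; apply/funext => t; case: (p t).
rewrite (_ : (fun _ => _) = (fun t => - Im (p t))); last first.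
  by apply/funext => t; case: (p t).
by move=> t; apply: cvgN; exact: b.
Qed.

Lemma cavg_cst z : cavg (fun=> z) = z.
Proof. by rewrite /cavg !avg_cst; case: z. Qed.

Lemma cavgD p q : ccont p -> ccont q ->
  cavg (fun t => p t + q t) = cavg p + cavg q.
Proof.
move=> [a b] [c d]; apply: complex_ext; rewrite ?cReD ?cImD /=.
  by rewrite -avgD//; apply: eq_avg => t; rewrite cReD.
by rewrite -avgD//; apply: eq_avg => t; rewrite cImD.
Qed.

Lemma cavgZ z p : ccont p -> cavg (fun t => z * p t) = z * cavg p.
Proof.
move=> [a b]; have cZ k f : continuous f -> continuous (fun t => k * f t).
  by move=> cf t; apply: cvgM; [exact: cvg_cst|exact: cf].
apply: complex_ext; rewrite ?cReM ?cImM /=.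
  rewrite -!avgZ// -avgB//; first by apply: eq_avg => t; rewrite cReM.
    exact: cZ.
  exact: cZ.
rewrite -!avgZ// -avgD//; first by apply: eq_avg => t; rewrite cImM.
  exact: cZ.
exact: cZ.
Qed.

Lemma cavgB p q : ccont p -> ccont q ->
  cavg (fun t => p t - q t) = cavg p - cavg q.
Proof.
move=> cp cq; rewrite cavgD//; last exact: ccontN.
under [X in _ + cavg X]eq_fun do rewrite -mulN1r.
by rewrite cavgZ// mulN1r.
Qed.

Lemma cavgJ p : ccont p -> cavg (fun t => (p t)^*%C) = (cavg p)^*%C.
Proof.
move=> [a b]; rewrite /cavg /=; congr (_ +i* _).
  by apply: eq_avg => t; case: (p t).
by rewrite -mulN1r -avgZ//; apply: eq_avg => t; rewrite mulN1r; case: (p t).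
Qed.

(** The factor 2 comes from bounding real and imaginary parts separately; later constants absorb
    it. *)
Lemma normc_cavg p g : ccont p -> continuous g -> (forall t, normc (p t) <= g t) ->
  normc (cavg p) <= 2 * avg g.
Proof.
move=> [a b] cg pg; apply: le_trans (normc_le _) _; rewrite mulr2n mulrDl mul1r.
by apply: lerD; apply: avg_norm => // t; apply: le_trans (pg t);
  [exact: normr_Re|exact: normr_Im].
Qed.

Lemma normc_cavg_cst p M : ccont p -> (forall t, normc (p t) <= M) ->
  normc (cavg p) <= 2 * M.
Proof.
move=> cp pM; rewrite -(avg_cst M); apply: normc_cavg => //.
by move=> t; exact: cvg_cst.
Qed.

Lemma normc_expi t : normc (expi t) = 1.
Proof. by rewrite /normc /expi cos2Dsin2 sqrtr1. Qed.

Lemma expi_neq0 t : expi t != 0.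
Proof. by rewrite -normc_gt0 normc_expi. Qed.

Lemma expiJ t : (expi t)^*%C = (expi t)^-1.
Proof.
apply: (mulfI (expi_neq0 t)); rewrite mulJc normc_expi expr1n.
by rewrite mulfV ?expi_neq0.
Qed.

Lemma cdiff2_expi (x y : R) : cdiff2 (fun _ t => expi t) x y 0 ('i%C * expi y).
Proof.
have -> : (fun _ : R => expi) = (fun _ t => (cos t)%:C + 'i%C * (sin t)%:C).
  by apply/funext => _; apply/funext => t; apply: complex_ext => /=; ring.
apply: cdiff2_eq; last first.
  apply: cdiff2D; first exact: cdiff2_y.
  by apply: cdiff2M; [exact: cdiff2_cst|exact: cdiff2_y].
- by apply: complex_ext => /=; ring.
- by ring.
Qed.

End CircleMean.

(** * Contraction of a circle to a point *)

Section Contraction.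
Variable R : realType.
Local Notation C := R[i].
Implicit Types (z w c : C) (r : R).

(** [goursat] is about real forms. Complex identities are recovered from real parts by multiplying
    the form with 1 and with [- 'i]. *)
Lemma closed_form_Re (F G : R -> R -> C) :
  (forall x y, exists a b d, cdiff2 F x y a b /\ cdiff2 G x y b d) ->
  closed_form (fun x y => Re (F x y)) (fun x y => Re (G x y)).
Proof.
move=> H x y; have [a [b [d [HF HG]]]] := H x y; exists (Re a), (Re b), (Re d) => e e0.
have [r r0 {}HF] := HF _ e0; have [s s0 {}HG] := HG _ e0.
exists (Num.min r s); first by rewrite lt_min r0.
move=> h k; rewrite !le_min => /andP[hr hs] /andP[kr ks]; split.
  apply: le_trans (HF h k hr kr); apply: le_trans (normr_Re _).
  by rewrite !(cReD, cReN) [a * _]mulrC [b * _]mulrC !Re_mulrC ![_ * h]mulrC ![_ * k]mulrC.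
apply: le_trans (HG h k hs ks); apply: le_trans (normr_Re _).
by rewrite !(cReD, cReN) [b * _]mulrC [d * _]mulrC !Re_mulrC ![_ * h]mulrC ![_ * k]mulrC.
Qed.

Definition circle c r t : C := c + r%:C * expi t.

(** As dw = i r exp(it) dt on the circle, [cavg] of f times this kernel is the Cauchy integral of
    f(w) dw / (2 pi i (w - z)). *)
Definition cauchy_kernel c r z t : C := r%:C * expi t / (circle c r t - z).

Definition cdiff_on_disk (f : C -> C) c r :=
  forall w, normc (w - c) <= r -> exists d, cderiv f w d.

Lemma circle_sub c r t : 0 < r -> normc (circle c r t - c) = r.
Proof.
move=> r0; rewrite /circle addrAC subrr add0r normcM normc_real normc_expi mulr1.
exact: gtr0_norm.
Qed.

Lemma circle_neq c r z t : normc (z - c) < r -> circle c r t - z != 0.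
Proof.
move=> zr; have r0 : 0 < r by apply: le_lt_trans zr; exact: normc_ge0.
rewrite -normc_gt0; have := le_normcBD (circle c r t - c) (z - c).
by rewrite circle_sub// opprB addrA subrK; lra.
Qed.

Lemma ccont_kernel c r z : normc (z - c) < r -> ccont (cauchy_kernel c r z).
Proof.
move=> zr; apply: ccontM.
  by apply: ccontM; [exact: ccont_cst|exact: ccont_expi].
apply: ccontV => [|t]; last exact: circle_neq.
by apply: ccontB; [exact: ccont_circle|exact: ccont_cst].
Qed.

Lemma ccont_disk f c r : cdiff_on_disk f c r -> 0 < r ->
  ccont (fun t => f (circle c r t)).
Proof.
move=> Hf r0; apply: (@ccont_cderiv _ f) => [|t]; first exact: ccont_circle.
by apply: Hf; rewrite circle_sub.
Qed.

(* The circle [|w - c| = r] is contracted to [z] along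
   [z + (circle c r t - z) / (1 + x^2)], [x >= 0]; the pull-back of
   [f w dw / (w - z)] is closed on the whole plane. *)
Lemma cauchy_contraction f c r z : 0 < r -> cdiff_on_disk f c r -> normc (z - c) < r ->
  cavg (fun t => f (circle c r t) * cauchy_kernel c r z t) =
  f z * cavg (cauchy_kernel c r z).
Proof.
move=> r0 Hf zr; set k := cauchy_kernel c r z; set ze := circle c r.
(* s falls from 1 at x = 0 to 0 at infinity: z is approached but never reached, so the form has no
   singularity, and s is smooth on the whole line as [closed_form] demands. *)
pose s (x : R) : C := (1 + x%:C * x%:C)^-1.
pose ga x t : C := z + s x * (ze t - z).
have sE x : s x = ((1 + x ^+ 2)^-1)%:C.
  rewrite /s fmorphV/= rmorphD/= rmorphXn/= rmorph1.
  by rewrite expr2.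
have s01 (x : R) : 0 < (1 + x ^+ 2)^-1 <= 1.
  have x2 := sqr_ge0 x.
  by rewrite invr_gt0 invf_le1; lra.
have den0 (x : R) : 1 + x%:C * x%:C != 0.
  have x2 := sqr_ge0 x.
  rewrite -invr_eq0 -/(s x) sE -normc_eq0 normc_real normr_eq0 gt_eqF//.
  by have /andP[] := s01 x.
have ga_disk x t : normc (ga x t - c) <= r.
  have /andP[a b] := s01 x.
  rewrite /ga sE.
  have -> : z + ((1 + x ^+ 2)^-1)%:C * (ze t - z) - c =
     (1 - (1 + x ^+ 2)^-1)%:C * (z - c) + ((1 + x ^+ 2)^-1)%:C * (ze t - c).
    by rewrite rmorphB rmorph1/=; ring.
  apply: le_trans (le_normcD _ _) _; rewrite !normcM !normc_real circle_sub//.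
  rewrite (gtr0_norm a) ger0_norm; last lra.
  by have := normc_ge0 (z - c); nra.
have zeN t : ze t - z != 0 by exact: circle_neq.
(* Since w - z = s(x) (ze t - z), dw / (w - z) is the sum of the logarithmic derivatives: s'/s = - 2
   x s(x) in dx and i k(t) in dt. *)
have Hga mu : exists2 P, closed_form P (fun x t => Re (mu * f (ga x t) * ('i%C * k t)))
    & (forall x, P x 0 = P x (2 * pi)).
  exists (fun x t => Re (mu * f (ga x t) * ((- 2) * x%:C * s x))); last first.
    by move=> x; rewrite /ga /ze /circle /expi cos0 sin0 [2 * pi]mulr_natl
      cos2pi sin2pi.
  apply: closed_form_Re => x t.
  have hs : cdiff2 (fun p _ => s p) x t (- (1 + x%:C * x%:C) ^- 2 * (2 * x%:C)) 0.
    apply: cdiff2_eq; last first.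
      apply: (cdiff2_comp (f := fun w => w^-1) (F := fun p _ => 1 + p%:C * p%:C)).
        exact: cderivV.
      apply: cdiff2D; first exact: cdiff2_cst.
      by apply: cdiff2M; exact: cdiff2_x.
    - by cbv beta; ring.
    - by cbv beta; ring.
  have he : cdiff2 (fun _ q => r%:C * expi q) x t 0 (r%:C * ('i%C * expi t)).
    apply: cdiff2_eq; last by apply: cdiff2M; [exact: cdiff2_cst|exact: cdiff2_expi].
    - by cbv beta; ring.
    - by cbv beta; ring.
  have hze : cdiff2 (fun _ q => ze q - z) x t 0 (r%:C * ('i%C * expi t)).
    rewrite (_ : (fun _ _ => _) = (fun _ q => (c - z) + r%:C * expi q)); last first.
      by apply/funext => _; apply/funext => q; rewrite /ze /circle; ring.
    apply: cdiff2_eq; last by apply: cdiff2D; [exact: cdiff2_cst|exact: he].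
    - by cbv beta; ring.
    - by cbv beta; ring.
  have hga : cdiff2 ga x t (- (1 + x%:C * x%:C) ^- 2 * (2 * x%:C) * (ze t - z))
      (s x * (r%:C * ('i%C * expi t))).
    apply: cdiff2_eq; last first.
      by apply: cdiff2D; [exact: cdiff2_cst|apply: cdiff2M; [exact: hs|exact: hze]].
    - by cbv beta; ring.
    - by cbv beta; ring.
  have [D HD] := Hf _ (ga_disk x t); have hf := cdiff2_comp HD hga.
  have hsig : exists d, cdiff2 (fun p _ => (- 2) * p%:C * s p) x t d 0.
    exists ((-2) * s x + (-2) * x%:C * (- (1 + x%:C * x%:C) ^- 2 * (2 * x%:C))).
    apply: cdiff2_eq; last first.
      apply: cdiff2M; last exact: hs.
      by apply: cdiff2M; [exact: cdiff2_cst|exact: cdiff2_x].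
    - by cbv beta; ring.
    - by cbv beta; ring.
  have hk : exists d, cdiff2 (fun _ q => 'i%C * k q) x t 0 d.
    eexists; apply: cdiff2_eq; last first.
      apply: cdiff2M; first exact: cdiff2_cst.
      apply: cdiff2M; first exact: he.
      apply: (cdiff2_comp (f := fun w => w^-1) (F := fun _ q => ze q - z)) hze.
      exact: cderivV.
    - by [].
    - by cbv beta; ring.
  have [dsig {}hsig] := hsig; have [dk {}hk] := hk.
  exists (mu * (D * (- (1 + x%:C * x%:C) ^- 2 * (2 * x%:C) * (ze t - z))) *
      ((- 2) * x%:C * s x) + mu * f (ga x t) * dsig),
    (mu * (D * (s x * (r%:C * ('i%C * expi t)))) * ((- 2) * x%:C * s x)),
    (mu * (D * (s x * (r%:C * ('i%C * expi t)))) * ('i%C * k t) + mu * f (ga x t) * dk).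
  split.
    apply: cdiff2_eq; last first.
      apply: cdiff2M; last exact: hsig.
      by apply: cdiff2M; [exact: cdiff2_cst|exact: hf].
    - by cbv beta; ring.
    - by cbv beta; ring.
  apply: cdiff2_eq; last first.
    apply: cdiff2M; last exact: hk.
    by apply: cdiff2M; [exact: cdiff2_cst|exact: hf].
  - by cbv beta; ring.
  - rewrite /k /cauchy_kernel -/ze /s; cbv beta; field.
    by rewrite den0 zeN.
(* The edges t = 0 and t = 2 pi of the rectangle carry the same integrand and cancel, so the circles
   at parameters X and 0 give equal integrals. *)
have main mu (X : R) : 0 <= X ->
    itg (fun t => Re (mu * f (ga X t) * ('i%C * k t))) 0 (2 * pi) =
    itg (fun t => Re (mu * f (ga 0 t) * ('i%C * k t))) 0 (2 * pi).
  move=> X0; have [P HP per] := Hga mu.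
  have := goursat HP 0 0 X0 (ltW (pi2_gt0 R)); rewrite /boundary_itg !add0r.
  have -> : P^~ (2 * pi) = P^~ 0 by apply/funext => x; rewrite -per.
  by rewrite subrr add0r => /subr0_eq.
have dK : 0 < r - normc (z - c) by rewrite subr_gt0.
set K := r / (r - normc (z - c)).
have K0 : 0 < K by rewrite divr_gt0.
have kK t : normc (k t) <= K.
  rewrite /k /cauchy_kernel -/ze normcM normcM normc_real normc_expi mulr1 normcV gtr0_norm//.
  rewrite ler_pM2l// lef_pV2 ?posrE// ?normc_gt0//.
  have := le_normcBD (ze t - c) (z - c).
  by rewrite circle_sub// opprB addrA subrK; lra.
have ck : ccont k by exact: ccont_kernel.
have cfze : ccont (fun t => f (ze t)) by exact: ccont_disk.
have cA mu : ccont (fun t => mu * f (ze t) * ('i%C * k t)).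
  apply: ccontM; first by apply: ccontM => //; exact: ccont_cst.
  by apply: ccontM => //; exact: ccont_cst.
have cB mu : ccont (fun t => mu * f z * ('i%C * k t)).
  apply: ccontM; first exact: ccont_cst.
  by apply: ccontM => //; exact: ccont_cst.
have ga0 t : ga 0 t = ze t by rewrite /ga sE expr0n addr0 invr1 mul1r subrKC.
have avg_mu mu : avg (fun t => Re (mu * f (ze t) * ('i%C * k t))) =
    avg (fun t => Re (mu * f z * ('i%C * k t))).
  apply/eqP; rewrite -subr_eq0 -normr_le0; apply/ler_addgt0Pl => e e0; rewrite addr0.
  have [D /cderiv_cont Hz] := Hf z (ltW zr).
  have m1 : 0 < 1 + normc mu by rewrite ltr_wpDr ?normc_ge0.
  have [d d0 {}Hz] := Hz _ (divr_gt0 e0 (mulr_gt0 m1 K0)).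
  (* Makes the contracted circle lie within d of z: |ze t - z| <= 2 r = d (X - 1) <= d (1 + X^2). *)
  pose X := 2 * r / d + 1; have X1 : 1 <= X by rewrite lerDr divr_ge0//; lra.
  have -> : avg (fun t => Re (mu * f (ze t) * ('i%C * k t))) =
      avg (fun t => Re (mu * f (ga X t) * ('i%C * k t))).
    rewrite /avg main; last by lra.
    by congr (_ * itg _ _ _); apply/funext => t; rewrite ga0.
  have cga : ccont (ga X).
    apply: ccontD; first exact: ccont_cst.
    apply: ccontM; first exact: ccont_cst.
    by apply: ccontB; [exact: ccont_circle|exact: ccont_cst].
  have cX : ccont (fun t => mu * f (ga X t) * ('i%C * k t)).
    apply: ccontM; last by apply: ccontM => //; exact: ccont_cst.
    apply: ccontM; first exact: ccont_cst.
    by apply: (@ccont_cderiv _ f) => // t; apply: Hf; exact: ga_disk.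
  rewrite -avgB; [|exact: ccont_Re|exact: ccont_Re].
  rewrite -[leRHS]avg_cst; apply: avg_norm.
  - by move=> t; apply: cvgB; [exact: (ccont_Re cX)|exact: (ccont_Re (cB mu))].
  - by move=> t; exact: cvg_cst.
  move=> t; rewrite -cReN -cReD; apply: le_trans (normr_Re _) _.
  have -> : mu * f (ga X t) * ('i%C * k t) - mu * f z * ('i%C * k t) =
    'i%C * (mu * (f (ga X t) - f z) * k t) by ring.
  have ni : normc ('i%C : C) = 1 by rewrite /normc/= expr0n expr1n add0r sqrtr1.
  rewrite normcM ni mul1r normcM [normc (mu * _)]normcM.
  have /Hz/ltW h1 : normc (s X * (ze t - z)) <= d.
    rewrite sE normcM normc_real ger0_norm; last by rewrite invr_ge0 addr_ge0// sqr_ge0.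
    have h2 : normc (ze t - z) <= 2 * r.
      have -> : ze t - z = (ze t - c) - (z - c) by ring.
      by apply: le_trans (le_normcB _ _) _; rewrite circle_sub//; lra.
    rewrite mulrC ler_pdivrMr; last by have := sqr_ge0 X; lra.
    apply: le_trans h2 _; have -> : 2 * r = d * (X - 1) by rewrite /X; field; lra.
    by rewrite ler_pM2l//; nra.
  apply: (@le_trans _ _ ((1 + normc mu) * (e / ((1 + normc mu) * K)) * K)); last first.
    by rewrite le_eqVlt; apply/orP; left; apply/eqP; field; lra.
  apply: ler_pM; [by apply: mulr_ge0; exact: normc_ge0|exact: normc_ge0| |exact: kK].
  by apply: ler_pM; [exact: normc_ge0|exact: normc_ge0|lra|exact: h1].
(* The cases mu = 1 and mu = - i give the real and the imaginary part. *)
have Heq : cavg (fun t => 'i%C * (f (ze t) * k t)) = cavg (fun t => 'i%C * (f z * k t)).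
  apply: complex_ext.
    have := avg_mu 1; rewrite /cavg/= => l1.
    transitivity (avg (fun t => Re (1 * f (ze t) * ('i%C * k t)))).
      by apply: eq_avg => t; congr Re; ring.
    by rewrite l1; apply: eq_avg => t; congr Re; ring.
  have l1 := avg_mu (- 'i%C).
  transitivity (avg (fun t => Re (- 'i%C * f (ze t) * ('i%C * k t)))).
    apply: eq_avg => t; rewrite (_ : - 'i%C * f (ze t) * ('i%C * k t) =
      - 'i%C * ('i%C * (f (ze t) * k t))); last by ring.
    by rewrite [RHS]cReM/=; ring.
  rewrite l1; apply: eq_avg => t; rewrite (_ : - 'i%C * f z * ('i%C * k t) =
      - 'i%C * ('i%C * (f z * k t))); last by ring.
  by rewrite [LHS]cReM/=; ring.
move: Heq; rewrite !cavgZ//; last 2 first.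
- by apply: ccontM => //; exact: ccont_cst.
- by apply: ccontM.
have i0 : 'i%C != 0 :> C by apply/eqP => /(congr1 (@complex.Im R))/eqP; rewrite /= oner_eq0.
exact: (mulfI i0).
Qed.

End Contraction.

(** * Cauchy's formula and Cauchy type integrals *)

Section CauchyFormula.
Variable R : realType.
Local Notation C := R[i].
Implicit Types (z w c : C) (r : R).

Lemma conjcM z w : (z * w)^*%C = z^*%C * w^*%C. Proof. exact: rmorphM. Qed.

Lemma conjcB z w : (z - w)^*%C = z^*%C - w^*%C. Proof. exact: rmorphB. Qed.

Lemma mean_value f c r : 0 < r -> cdiff_on_disk f c r ->
  cavg (fun t => f (circle c r t)) = f c.
Proof.
move=> r0 Hf; have cc : normc (c - c) < r by rewrite subrr normc0.
have := cauchy_contraction r0 Hf cc.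
have -> : cauchy_kernel c r c = (fun=> 1).
  apply/funext => t; rewrite /cauchy_kernel /circle addrAC subrr add0r mulfV//.
  by rewrite -normc_eq0 normcM normc_real normc_expi mulr1 normr_eq0 gt_eqF.
by rewrite cavg_cst mulr1 => <-; apply: eq_cavg => t; rewrite mulr1.
Qed.

(* On [|w - c| = r] the Schwarz reflection of the Cauchy kernel is
   [1 / (1 - conj (z - c) (w - c) / r^2)], which is holomorphic in the disk and
   takes the value 1 at the centre. *)
Lemma kernelJ c r z t : 0 < r -> normc (z - c) < r ->
  (cauchy_kernel c r z t)^*%C =
  (1 - (z - c)^*%C / (r ^+ 2)%:C * (circle c r t - c))^-1.
Proof.
move=> r0 zr; have rC : r%:C != 0 :> C by rewrite -normc_eq0 normc_real normr_eq0 gt_eqF.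
have e0 := expi_neq0 t.
have eJ : (expi t)^*%C != 0 by rewrite expiJ invr_eq0.
have := circle_neq t zr; rewrite /cauchy_kernel /circle.
have -> : c + r%:C * expi t - z = r%:C * expi t - (z - c) by ring.
have -> : c + r%:C * expi t - c = r%:C * expi t by ring.
set v := z - c => nz.
have nzJ : (r%:C * expi t - v)^*%C != 0 by rewrite conjc_eq0.
rewrite conjcM conjc_inv conjcM conjc_real.
have -> : (r%:C * expi t - v)^*%C = r%:C * (expi t)^*%C - v^*%C.
  by rewrite conjcB conjcM conjc_real.
move: nzJ; rewrite conjcB conjcM conjc_real.
move: v^*%C => u; rewrite expiJ (rmorphXn (real_complex R)) => nzJ.
apply: (mulfI nzJ); rewrite mulrCA mulfV// mulr1.
have nz1 : 1 - u / r%:C ^+ 2 * (r%:C * expi t) != 0.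
  have -> : 1 - u / r%:C ^+ 2 * (r%:C * expi t) = expi t / r%:C * (r%:C / expi t - u).
    by field; rewrite rC e0.
  by rewrite !mulf_neq0// invr_neq0.
apply: (mulIf nz1); rewrite mulfVK//.
by field; rewrite rC e0.
Qed.

Lemma reflected_kernel_diff c r z : 0 < r -> normc (z - c) < r ->
  cdiff_on_disk (fun w => (1 - (z - c)^*%C / (r ^+ 2)%:C * (w - c))^-1) c r.
Proof.
move=> r0 zr w wr; set u := _ / _.
have nz : 1 - u * (w - c) != 0.
  apply/eqP => /subr0_eq/(congr1 (@normc R)); rewrite normc1 normcM.
  rewrite /u normcM normcV normc_real normcJ' ger0_norm ?sqr_ge0// => /esym.
  apply/eqP; rewrite lt_eqF// mulrAC ltr_pdivrMr ?exprn_gt0// mul1r expr2.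
  have := normc_ge0 (w - c); have := normc_ge0 (z - c); nra.
eexists; apply: (cderiv_comp (f := fun w : C => w^-1) (g := fun w => 1 - u * (w - c))).
  exact: cderivV.
apply: (cderiv_ext (f := fun w => (- u) * w + (1 + u * c)) (r := 1)) => //.
  by move=> h _; ring.
exact: cderiv_affine.
Qed.

(** The conjugate of the kernel is the trace of a function differentiable on the closed disk, so the
    mean value property gives its average. *)
Lemma cavg_kernel c r z : 0 < r -> normc (z - c) < r -> cavg (cauchy_kernel c r z) = 1.
Proof.
move=> r0 zr; apply: (can_inj (@conjcK R)); rewrite -cavgJ; last exact: ccont_kernel.
transitivity (cavg (fun t => (fun w => (1 - (z - c)^*%C / (r ^+ 2)%:C * (w - c))^-1)
    (circle c r t))); first by apply: eq_cavg => t; exact: kernelJ.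
rewrite (mean_value r0 (reflected_kernel_diff r0 zr)).
by rewrite subrr mulr0 subr0 invr1 rmorph1.
Qed.

Theorem cauchy_formula f c r z : 0 < r -> cdiff_on_disk f c r -> normc (z - c) < r ->
  cavg (fun t => f (circle c r t) * cauchy_kernel c r z t) = f z.
Proof.
by move=> r0 Hf zr; rewrite cauchy_contraction// cavg_kernel// mulr1.
Qed.

Lemma cderivD f g z a b : cderiv f z a -> cderiv g z b -> cderiv (fun w => f w + g w) z (a + b).
Proof.
move=> Hf Hg e e0; have e2 : 0 < e / 2 by lra.
have [r r0 {}Hf] := Hf _ e2; have [s s0 {}Hg] := Hg _ e2.
exists (Num.min r s); first by rewrite lt_min r0.
move=> h; rewrite le_min => /andP[hr hs].
rewrite (_ : _ - _ = (f (z + h) - f z - a * h) + (g (z + h) - g z - b * h)); last by ring.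
by apply: le_trans (le_normcD _ _) _; have := Hf h hr; have := Hg h hs; lra.
Qed.

Lemma cderivZ u f z a : cderiv f z a -> cderiv (fun w => u * f w) z (u * a).
Proof.
move=> Hf; apply: (cderiv_comp (f := fun w => u * w)) Hf.
apply: (cderiv_ext (f := fun w => u * w + 0) (r := 1)) => //.
  by move=> h _; rewrite addr0.
exact: cderiv_affine.
Qed.

(** By polarization, 4 f g = (f + g)^2 - (f - g)^2, only the derivative of a square has to be
    estimated. *)
Lemma cderivM f g z a b : cderiv f z a -> cderiv g z b ->
  cderiv (fun w => f w * g w) z (a * g z + f z * b).
Proof.
have sq (p : C -> C) d : cderiv p z d -> cderiv (fun w => p w * p w) z (2 * p z * d).
  move=> Hp; apply: (cderiv_comp (f := fun w => w * w)) Hp => e e0.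
  exists e => // h he; rewrite (_ : _ - _ = h * h); last by ring.
  by rewrite normcM ler_wpM2r ?normc_ge0.
move=> Hf Hg.
have := cderivZ (4^-1) (cderivD (sq _ _ (cderivD Hf Hg))
  (cderivZ (-1) (sq _ _ (cderivD Hf (cderivZ (-1) Hg))))).
rewrite (_ : 4^-1 * _ = a * g z + f z * b); last by field.
by apply: (cderiv_ext ltr01) => h _; field.
Qed.

Definition cauchy_int (p : R -> C) c r z : C := cavg (fun t => p t * cauchy_kernel c r z t).

Definition cauchy_int' (p : R -> C) c r z : C :=
  cavg (fun t => p t * (cauchy_kernel c r z t / (circle c r t - z))).

(** The second-order remainder of 1/(w - z) in z is exactly h^2 / ((w - z)^2 (w - z - h)). Hence the
    error is quadratic in h, with a constant that sees the density only through its bound M. *)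
Lemma cauchy_int_taylor p c r z h M d : 0 < d -> ccont p -> (forall t, normc (p t) <= M) ->
  normc (z - c) <= r - d -> normc (z + h - c) <= r - d ->
  normc (cauchy_int p c r (z + h) - cauchy_int p c r z - cauchy_int' p c r z * h) <=
  2 * (M * (`|r| / d ^+ 3)) * normc h ^+ 2.
Proof.
move=> d0 cp pM zr zhr.
have zr' : normc (z - c) < r by lra.
have zhr' : normc (z + h - c) < r by lra.
have r0 : 0 < r by apply: le_lt_trans zr'; exact: normc_ge0.
have low u t : normc (u - c) <= r - d -> d <= normc (circle c r t - u).
  move=> ur; have := le_normcBD (circle c r t - c) (u - c).
  by rewrite circle_sub// opprB addrA subrK; lra.
have cK := ccont_kernel zr'; have cKh := ccont_kernel zhr'.
have cN : ccont (fun t => (circle c r t - z)^-1).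
  apply: ccontV => [|t]; last exact: circle_neq.
  by apply: ccontB; [exact: ccont_circle|exact: ccont_cst].
have cNh : ccont (fun t => (circle c r t - (z + h))^-1).
  apply: ccontV => [|t]; last exact: circle_neq.
  by apply: ccontB; [exact: ccont_circle|exact: ccont_cst].
rewrite /cauchy_int /cauchy_int' mulrC -cavgZ; last first.
  by apply: ccontM => //; exact: ccontM.
rewrite -cavgB; [|exact: ccontM|exact: ccontM].
rewrite -cavgB; [|by apply: ccontB; exact: ccontM|]; last first.
  by apply: ccontM; [exact: ccont_cst|apply: ccontM => //; exact: ccontM].
rewrite -mulrA; apply: normc_cavg_cst.
  apply: ccontB; first by apply: ccontB; exact: ccontM.
  by apply: ccontM; [exact: ccont_cst|apply: ccontM => //; exact: ccontM].
move=> t; have nz := circle_neq t zr'; have nzh := circle_neq t zhr'.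
have -> : p t * cauchy_kernel c r (z + h) t - p t * cauchy_kernel c r z t -
    h * (p t * (cauchy_kernel c r z t / (circle c r t - z))) =
    p t * (r%:C * expi t / ((circle c r t - z) ^+ 2 * (circle c r t - (z + h)))) * h ^+ 2.
  by rewrite /cauchy_kernel; field; rewrite nz nzh.
rewrite normcM normcX ler_wpM2r ?exprn_ge0 ?normc_ge0//.
rewrite normcM normcM normcM normc_expi mulr1 normcV normcM normcX normc_real.
have lz := low _ t zr; have lzh := low _ t zhr.
apply: ler_pM; rewrite ?normc_ge0//.
  by rewrite divr_ge0// mulr_ge0 ?exprn_ge0 ?normc_ge0.
rewrite ler_pM2l ?normr_gt0 ?gt_eqF// lef_pV2 ?posrE ?mulr_gt0 ?exprn_gt0//; try lra.
rewrite exprSr; apply: ler_pM => //; [exact: exprn_ge0 (ltW d0)|exact: ltW|].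
by apply: lerXn2r => //; rewrite nnegrE ?normc_ge0//; exact: ltW.
Qed.

End CauchyFormula.

(** * Holomorphic functions on a disk centred at 0 *)

Section DiskHol.
Variable R : realType.
Local Notation C := R[i].
Implicit Types (z w c : C) (r s : R).

Definition dc (f : C -> C) (z : C) : C := derive1 (f : plane R -> plane R) (z : plane R).

Lemma normC_lt (z : plane R) (e : R) : (`|z| < e%:C) = (normc z < e).
Proof. exact: ltcR. Qed.

Lemma normC_le (z : plane R) (e : R) : (`|z| <= e%:C) = (normc z <= e).
Proof. exact: lecR. Qed.

Lemma unit_diskE (z : C) : unit_disk R z <-> normc z < 1.
Proof. by rewrite /unit_disk /= (normC_lt z 1). Qed.

Lemma derivable_epsE (K : numFieldType) (f : K -> K) (z d : K) :
  (forall e : K, 0 < e -> exists2 r : K, 0 < r & forall h : K, `|h| < r -> h != 0 ->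
     `|d - h^-1 * (f (h + z) - f z)| <= e) ->
  derivable (f : K^o -> K^o) (z : K^o) 1 /\ derive1 (f : K^o -> K^o) (z : K^o) = d.
Proof.
move=> H; have Hd : (fun h : K => h^-1 *: ((f : K^o -> K^o) (h *: 1 + z : K^o) - f z)) @ 0^' --> (d : K^o).
  apply/cvgrPdist_le => e /H[r r0 {}H]; exists r => // h /=.
  by rewrite sub0r normrN [h *: 1]mulr1; exact: H.
by split; [apply/cvg_ex; exists d|rewrite derive1E; exact: cvg_lim Hd].
Qed.

Lemma derivable_epsP (K : numFieldType) (f : K -> K) (z e : K) :
  derivable (f : K^o -> K^o) (z : K^o) 1 -> 0 < e -> exists2 r : K, 0 < r & forall h : K, `|h| < r -> h != 0 ->
     `|derive1 (f : K^o -> K^o) (z : K^o) - h^-1 * (f (h + z) - f z)| <= e.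
Proof.
move=> fz e0; have : (fun h : K => h^-1 *: ((f : K^o -> K^o) (h *: 1 + z : K^o) - f z)) @ 0^' -->
    derive1 (f : K^o -> K^o) (z : K^o).
  by rewrite derive1E; exact: fz.
move=> /cvgrPdist_le/(_ e e0)[r r0 H]; exists r => // h hr.
have /H : ball_ Num.norm 0 r h by rewrite /= sub0r normrN.
by rewrite /= [h *: 1]mulr1.
Qed.

Lemma cderiv_derivable (f : C -> C) z d : cderiv f z d ->
  derivable (f : plane R -> plane R) (z : plane R) 1 /\ dc f z = d.
Proof.
move=> H; apply: derivable_epsE => e e0.
have [e' ee'] : exists e' : R, e = e'%:C.
  by exists (Re e); apply/esym/RRe_real; exact: gtr0_real.
rewrite ee' in e0 *; have e'0 : 0 < e' by rewrite -ltcR.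
have [r r0 {}H] := H _ e'0.
exists r%:C; first by rewrite ltcR.
move=> h; rewrite normC_lt => hr h0.
have hn : 0 < normc h by rewrite normc_gt0.
rewrite normC_le -(ler_pM2r hn) -normcM.
apply: le_trans (H h (ltW hr)); rewrite -normcN.
rewrite (_ : - (_ * h) = f (z + h) - f z - d * h)//.
by rewrite (addrC h); field.
Qed.

Lemma derivable_cderiv (f : C -> C) z : derivable (f : plane R -> plane R) (z : plane R) 1 ->
  cderiv f z (dc f z).
Proof.
move=> fz e e0; have e0' : 0 < e%:C :> C by rewrite ltcR.
have [r r0 H] := derivable_epsP fz e0'.
have [r' rr'] : exists r' : R, r = r'%:C.
  by exists (Re r); apply/esym/RRe_real; exact: gtr0_real.
rewrite rr' in r0 H; have r'0 : 0 < r' by rewrite -ltcR.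
exists (r' / 2); first by lra.
move=> h hr; have [->|h0] := eqVneq h 0.
  by rewrite addr0 subrr mulr0 subr0 normc0 mulr0.
have hr' : `|h : C| < r'%:C by rewrite normC_lt; lra.
have hn : 0 < normc h by rewrite normc_gt0.
have := H h hr' h0; rewrite normC_le -(ler_pM2r hn) -normcM; apply: le_trans.
rewrite -normcN (_ : - (_ - _ * h) = (dc f z - h^-1 * (f (h + z) - f z)) * h)//.
by rewrite (addrC h); field.
Qed.

Lemma dcE (f : C -> C) z d : cderiv f z d -> dc f z = d.
Proof. by move=> /cderiv_derivable[]. Qed.

Lemma expi_period t : exists2 t', 0 <= t' <= 2 * pi & expi t = expi t' :> C.
Proof.
have ct : -1 <= cos t <= 1 by rewrite cos_geN1 cos_le1.
have [/andP[a0 api] ca] := acos_def ct.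
have st : sin (acos (cos t)) = `|sin t|.
  by rewrite sin_acos// -sin2cos2 sqrtr_sqr.
have [s0|s0] := leP 0 (sin t).
  exists (acos (cos t)); first by rewrite a0/=; have := pi_gt0 R; lra.
  by apply: complex_ext; rewrite /= ?ca// st ger0_norm.
exists (2 * pi - acos (cos t)); first by have := pi_gt0 R; lra.
have e : 2 * pi - acos (cos t) = pi *+ 2 - acos (cos t) :> R by rewrite mulr_natl.
apply: complex_ext; rewrite /= e.
  by rewrite addrC cosD2pi cosN ca.
by rewrite addrC sinD2pi sinN st ltr0_norm// opprK.
Qed.

Lemma cont_circle_bounded (f : C -> C) c r : ccont (fun t => f (circle c r t)) ->
  exists2 B, 0 < B & forall t, normc (f (circle c r t)) <= B.
Proof.
move=> [cr ci]; have pi0 := ltW (pi2_gt0 R).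
have bnd (g : R -> R) : continuous g -> exists B, forall t, 0 <= t <= 2 * pi -> `|g t| <= B.
  move=> cg; have cN : continuous (fun t => `|g t|).
    by move=> t; apply: (continuous_comp (cg t)); exact: norm_continuous.
  have [t _ H] := EVT_max pi0 (continuous_subspaceT cN).
  by exists `|g t| => s st; apply: H; rewrite in_itv.
have [A HA] := bnd _ cr; have [B HB] := bnd _ ci.
exists (A + B + 1).
  have t0 : 0 <= (0 : R) <= 2 * pi by rewrite lexx.
  by have := HA _ t0; have := HB _ t0; have := normr_ge0 (Re (f (circle c r 0)));
    have := normr_ge0 (Im (f (circle c r 0))); lra.
move=> t; have [s st] := expi_period t; rewrite /circle => ->.
by apply: le_trans (normc_le _) _; have := HA _ st; have := HB _ st; rewrite /circle; lra.
Qed.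

Section Radius.
Variable rad : R.
Hypothesis rad_gt0 : 0 < rad.

(** The radius is a parameter because each approximating majorant is holomorphic only on a disk
    smaller than the unit disk. *)
Definition hol (f : C -> C) := forall z, normc z < rad -> exists d, cderiv f z d.

Lemma hol_cderiv f z : hol f -> normc z < rad -> cderiv f z (dc f z).
Proof.
by move=> Hf /Hf[d /[dup] H /cderiv_derivable[_ ->]].
Qed.

Lemma hol_disk f r : hol f -> r < rad -> cdiff_on_disk f 0 r.
Proof. by move=> Hf r1 w; rewrite subr0 => wr; apply: Hf; lra. Qed.

Lemma ccont_hol f p : hol f -> ccont p -> (forall t, normc (p t) < rad) ->
  ccont (fun t => f (p t)).
Proof. by move=> Hf cp Hp; apply: (@ccont_cderiv _ f) => // t; exact: Hf. Qed.

Lemma cauchy_int_cderiv p r z M : ccont p -> (forall t, normc (p t) <= M) ->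
  normc z < r -> cderiv (cauchy_int p 0 r) z (cauchy_int' p 0 r z).
Proof.
move=> cp pM zr e e0; pose d := (r - normc z) / 2.
have d0 : 0 < d by rewrite /d; lra.
have M0 : 0 <= M by apply: le_trans (pM 0); exact: normc_ge0.
pose K := 2 * (M * (`|r| / d ^+ 3)) + 1.
have K1 : 0 < K.
  by rewrite ltr_wpDl// mulr_ge0// mulr_ge0// divr_ge0// exprn_ge0// ltW.
exists (Num.min d (e / K)); first by rewrite lt_min d0 divr_gt0.
move=> h; rewrite le_min => /andP[hd he].
have zh : normc (z + h) <= r - d by have := le_normcD z h; rewrite /d in hd *; lra.
apply: le_trans (cauchy_int_taylor (h := h) (c := 0) (z := z) d0 cp pM _ _) _; rewrite ?subr0//.
  by rewrite /d; lra.
rewrite expr2 mulrA ler_wpM2r ?normc_ge0//.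
apply: (@le_trans _ _ (K * normc h)).
  by rewrite ler_wpM2r ?normc_ge0// lerDl.
by rewrite mulrC -ler_pdivlMr.
Qed.

Lemma hol_cauchy_int f r z : hol f -> r < rad -> normc z < r ->
  f z = cauchy_int (fun t => f (circle 0 r t)) 0 r z.
Proof.
move=> Hf r1 zr; have r0 : 0 < r by apply: le_lt_trans zr; exact: normc_ge0.
by rewrite /cauchy_int cauchy_formula ?subr0//; exact: hol_disk.
Qed.

Lemma ccont_hol_circle f r : hol f -> 0 < r < rad -> ccont (fun t => f (circle 0 r t)).
Proof. by move=> Hf /andP[r0 r1]; apply: ccont_disk => //; exact: hol_disk. Qed.

Lemma hol_dcE f r z : hol f -> 0 < r < rad -> normc z < r ->
  dc f z = cauchy_int' (fun t => f (circle 0 r t)) 0 r z.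
Proof.
move=> Hf /andP[r0 r1] zr.
have cf : ccont (fun t => f (circle 0 r t)) by apply: ccont_hol_circle; rewrite ?r0.
have [B _ HB] := cont_circle_bounded cf.
apply: dcE; apply: (cderiv_ext (r := (r - normc z) / 2)) (cauchy_int_cderiv cf HB zr).
  by lra.
by move=> h hh; rewrite -hol_cauchy_int//; have := le_normcD z h; lra.
Qed.

(* The constant only depends on a bound for [f] on a larger circle. *)
Lemma hol_taylor f s r B : hol f -> s < r -> 0 < r < rad ->
  (forall t, normc (f (circle 0 r t)) <= B) ->
  forall z h, normc z <= s -> normc (z + h) <= s ->
  normc (f (z + h) - f z - dc f z * h) <= 2 * (B * (r / (r - s) ^+ 3)) * normc h ^+ 2.
Proof.
move=> Hf sr r01 HB z h zs zhs; have /andP[r0 r1] := r01.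
rewrite (hol_dcE Hf r01); last lra.
rewrite (hol_cauchy_int (z := z) Hf r1); last lra.
rewrite (hol_cauchy_int (z := z + h) Hf r1); last lra.
have d0 : 0 < r - s by lra.
have zr : normc (z - 0) <= r - (r - s) by rewrite subr0 subKr.
have zhr : normc (z + h - 0) <= r - (r - s) by rewrite subr0 subKr.
have := cauchy_int_taylor d0 (ccont_hol_circle Hf r01) HB zr zhr.
by rewrite gtr0_norm.
Qed.

Lemma normc_kernel r s z t : 0 < r -> s < r -> normc z <= s ->
  normc (cauchy_kernel 0 r z t) <= r / (r - s).
Proof.
move=> r0 sr zs; have zr : normc (z - 0) < r by rewrite subr0; lra.
rewrite /cauchy_kernel normcM normcV normcM normc_real normc_expi mulr1 gtr0_norm//.
rewrite ler_pM2l// lef_pV2 ?posrE ?normc_gt0 ?circle_neq ?subr_gt0//.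
by have := le_normcBD (circle 0 r t - 0) (z - 0); rewrite circle_sub// !subr0; lra.
Qed.

Lemma hol_bound f s r B : hol f -> s < r -> 0 < r < rad ->
  (forall t, normc (f (circle 0 r t)) <= B) ->
  forall z, normc z <= s -> normc (f z) <= 2 * (B * (r / (r - s))).
Proof.
move=> Hf sr r01 HB z zs; have /andP[r0 r1] := r01.
rewrite (hol_cauchy_int Hf r1); last lra.
have zr : normc (z - 0) < r by rewrite subr0; lra.
apply: normc_cavg_cst.
  by apply: ccontM; [exact: ccont_hol_circle|exact: ccont_kernel].
by move=> t; rewrite normcM; apply: ler_pM; rewrite ?normc_ge0//; exact: normc_kernel.
Qed.

Lemma hol_bounded f s : hol f -> s < rad -> exists2 B, 0 < B & forall z, normc z <= s ->
  [/\ normc (f z) <= B, normc (dc f z) <= B & forall h, normc (z + h) <= s ->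
   normc (f (z + h) - f z - dc f z * h) <= B * normc h ^+ 2].
Proof.
(* The maximum with 0 keeps r positive when s is negative. *)
move=> Hf s1; pose m := Num.max 0 s; pose r := (rad + m) / 2.
have m1 : 0 <= m < rad by rewrite le_max lexx gt_max rad_gt0 s1.
have sm : s <= m by rewrite le_max lexx orbT.
have r01 : 0 < r < rad by rewrite /r; lra.
have sr : s < r by rewrite /r; lra.
have [B B0 HB] := cont_circle_bounded (ccont_hol_circle Hf r01).
(* Cauchy estimates with n powers of the distance to the circle: n = 1 for the function, 2 for its
   derivative, 3 for the Taylor remainder. *)
pose K n := 2 * (B * (r / (r - s) ^+ n)).
have r0 : 0 < r by lra.
have r0' : 0 <= r by lra.
have rs0 : 0 <= r - s by lra.
have K0 n : 0 <= K n.
  apply: mulr_ge0 => //; apply: mulr_ge0; first exact: ltW.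
  by apply: divr_ge0 => //; exact: exprn_ge0.
exists (K 1%N + K 2%N + K 3%N + 1); first by have := K0 1%N; have := K0 2%N; have := K0 3%N; lra.
have k1 := K0 1%N; have k2 := K0 2%N; have k3 := K0 3%N.
move=> z zs; split.
- by have := hol_bound Hf sr r01 HB zs; rewrite -[r - s]expr1 -/(K 1%N); lra.
- rewrite (hol_dcE Hf r01); last lra.
  have zr : normc (z - 0) < r by rewrite subr0; lra.
  have nz t := circle_neq t zr.
  apply: (@le_trans _ _ (K 2%N)); last lra.
  apply: normc_cavg_cst.
    apply: ccontM; first exact: ccont_hol_circle.
    apply: ccontM; first exact: ccont_kernel.
    apply: ccontV => // ; apply: ccontB; [exact: ccont_circle|exact: ccont_cst].
  move=> t; rewrite normcM; apply: ler_pM; rewrite ?normc_ge0//.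
  rewrite normcM normcV expr2 invfM mulrA.
  apply: ler_pM; rewrite ?normc_ge0 ?invr_ge0 ?normc_ge0//; first exact: normc_kernel.
  rewrite lef_pV2 ?posrE ?normc_gt0 ?subr_gt0//.
  by have := le_normcBD (circle 0 r t - 0) (z - 0); rewrite circle_sub// !subr0; lra.
- move=> h zh; apply: le_trans (hol_taylor Hf sr r01 HB zs zh) _.
  by rewrite ler_wpM2r ?exprn_ge0 ?normc_ge0// -/(K 3%N); lra.
Qed.

Lemma hol_cst c : hol (fun=> c).
Proof. by move=> z _; exists 0; exact: cderiv_cst. Qed.

Lemma hol_id : hol id.
Proof. by move=> z _; exists 1; exact: cderiv_id. Qed.

Lemma holD f g : hol f -> hol g -> hol (fun z => f z + g z).
Proof.
by move=> Hf Hg z z1; exists (dc f z + dc g z); apply: cderivD; exact: hol_cderiv.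
Qed.

Lemma holM f g : hol f -> hol g -> hol (fun z => f z * g z).
Proof.
by move=> Hf Hg z z1; exists (dc f z * g z + f z * dc g z); apply: cderivM; exact: hol_cderiv.
Qed.

Lemma holV f : hol f -> (forall z, normc z < rad -> f z != 0) -> hol (fun z => (f z)^-1).
Proof.
move=> Hf f0 z z1; exists (- (f z) ^- 2 * dc f z).
apply: (cderiv_comp (f := fun w => w^-1)); last exact: hol_cderiv.
by apply: cderivV; exact: f0.
Qed.

Lemma dcD f g z : hol f -> hol g -> normc z < rad ->
  dc (fun z => f z + g z) z = dc f z + dc g z.
Proof. by move=> Hf Hg z1; apply: dcE; apply: cderivD; exact: hol_cderiv. Qed.

Lemma dcM f g z : hol f -> hol g -> normc z < rad ->
  dc (fun z => f z * g z) z = dc f z * g z + f z * dc g z.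
Proof. by move=> Hf Hg z1; apply: dcE; apply: cderivM; exact: hol_cderiv. Qed.

Lemma dcV f z : hol f -> f z != 0 -> normc z < rad ->
  dc (fun z => (f z)^-1) z = - (f z) ^- 2 * dc f z.
Proof.
move=> Hf f0 z1; apply: dcE.
by apply: (cderiv_comp (f := fun w => w^-1)); [exact: cderivV|exact: hol_cderiv].
Qed.

(* Removable singularity: [(f z - f a) / (z - a)] is a Cauchy type integral of
   the continuous density [f w / (w - a)]. *)
Lemma hol_divided_difference f a : hol f -> normc a < rad ->
  exists2 g, hol g & forall z, normc z < rad -> f z = f a + (z - a) * g z.
Proof.
move=> Hf a1; pose g z := if z == a then dc f a else (f z - f a) / (z - a).
exists g => [|z z1]; last first.
  rewrite /g; case: eqVneq => [->|za]; first by rewrite subrr mul0r addr0.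
  by rewrite mulrCA mulfV ?subr_eq0// mulr1 subrKC.
move=> z z1; pose m := Num.max (normc a) (normc z); pose r := (rad + m) / 2.
have m1 : m < rad by rewrite gt_max a1.
have am : normc a <= m by rewrite le_max lexx.
have zm : normc z <= m by rewrite le_max lexx orbT.
have m0 : 0 <= m by apply: le_trans am; exact: normc_ge0.
have r01 : 0 < r < rad by rewrite /r; lra.
have mr : m < r by rewrite /r; lra.
have cf := ccont_hol_circle Hf r01.
have ar : normc (a - 0) < r by rewrite subr0; lra.
pose p t := f (circle 0 r t) / (circle 0 r t - a).
have cp : ccont p.
  apply: ccontM => //; apply: ccontV => [|t]; last exact: circle_neq.
  by apply: ccontB; [exact: ccont_circle|exact: ccont_cst].
have [B B0 HB] := cont_circle_bounded cf.
have pM t : normc (p t) <= B / (r - m).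
  rewrite normcM normcV; apply: ler_pM; rewrite ?invr_ge0 ?normc_ge0//.
  rewrite lef_pV2 ?posrE ?normc_gt0 ?circle_neq ?subr_gt0//; have /andP[r0 _] := r01.
  by have := le_normcBD (circle 0 r t - 0) (a - 0); rewrite circle_sub// !subr0; lra.
have zr : normc z < r by lra.
eexists; apply: (cderiv_ext (r := (r - normc z) / 2) (f := cauchy_int p 0 r)); last first.
- exact: (cauchy_int_cderiv cp pM zr).
- move=> h hr; set w := z + h.
  have wr : normc w < r by have := le_normcD z h; rewrite -/w; lra.
  have wr0 : normc (w - 0) < r by rewrite subr0.
  rewrite /g; case: eqVneq => [->|wa].
    rewrite (hol_dcE Hf r01); last lra.
    by apply: eq_cavg => t; rewrite /p mulrAC mulrA.
  have wa0 : w - a != 0 by rewrite subr_eq0.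
  apply: (mulfI wa0); rewrite mulrCA mulfV// mulr1.
  have cK u : normc (u - 0) < r -> ccont (fun t => f (circle 0 r t) * cauchy_kernel 0 r u t).
    by move=> ur; apply: ccontM => //; exact: ccont_kernel.
  have /andP[_ r1] := r01.
  (* Cauchy's formula at w and at a; the two kernels differ by (w - a) times the kernel at w divided
     by zeta - a. *)
  have -> : f w - f a = cavg (fun t => f (circle 0 r t) * cauchy_kernel 0 r w t -
      f (circle 0 r t) * cauchy_kernel 0 r a t).
    rewrite cavgB//; [|exact: cK|exact: cK].
    by rewrite (hol_cauchy_int Hf r1 wr) (hol_cauchy_int (z := a) Hf r1)//; lra.
  rewrite /cauchy_int -cavgZ; last by apply: ccontM => //; exact: ccont_kernel.
  apply: eq_cavg => t; rewrite /p /cauchy_kernel; field.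
  by rewrite !circle_neq.
- by lra.
Qed.
End Radius.
End DiskHol.

(** * Poisson integrals *)

Section Poisson.
Variable R : realType.
Local Notation C := R[i].
Implicit Types (z w c : C) (r s : R) (phi : R -> R).

(** On the circle zeta = r exp(it), 2 zeta / (zeta - z) - 1 = (zeta + z) / (zeta - z), so this is
    the Poisson kernel; [poissonE] has the usual quotient. *)
Definition poisson r z t : R := Re (2 * cauchy_kernel 0 r z t - 1).

(** The Herglotz integral: for continuous phi, the holomorphic function that is real at 0 and whose
    real part is the Poisson integral of phi. *)
Definition herglotz phi r z : C :=
  2 * cauchy_int (fun t => (phi t)%:C) 0 r z - (avg phi)%:C.

Lemma poissonE r z t : 0 < r -> normc z < r ->
  poisson r z t = (r ^+ 2 - normc z ^+ 2) / normc (circle 0 r t - z) ^+ 2.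
Proof.
move=> r0 zr; have zr' : normc (z - 0) < r by rewrite subr0.
have nz := circle_neq t zr'; set ze := circle 0 r t in nz *.
have nze : normc ze = r by rewrite -(circle_sub 0 t r0) subr0.
have -> : poisson r z t = Re ((ze + z) * (ze - z)^*%C / (normc (ze - z) ^+ 2)%:C).
  rewrite /poisson; congr Re; rewrite -mulJc /cauchy_kernel -/ze.
  have -> : r%:C * expi t = ze by rewrite /ze /circle add0r.
  have nzJ : (ze - z)^*%C != 0 by rewrite conjc_eq0.
  move: (_^*%C) nzJ => u u0; field.
  by rewrite u0 nz.
rewrite -fmorphV mulrC Re_mulrC mulrC; congr (_ / _).
rewrite -nze !normc_sqr conjcB; case: (ze) (z) => a b [a' b'] /=; ring.
Qed.

Lemma poisson_ge0 r z t : 0 < r -> normc z < r -> 0 <= poisson r z t.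
Proof.
move=> r0 zr; rewrite poissonE// divr_ge0 ?sqr_ge0//.
by have := normc_ge0 z; nra.
Qed.

(** The kernel is at least (r - |z|) / (r + |z|), which is at least 1/3 for |z| <= r/2. *)
Lemma poisson_harnack r z t : 0 < r -> normc z <= r / 2 -> 1 / 3 <= poisson r z t.
Proof.
move=> r0 zr; have zr1 : normc z < r by lra.
have zr' : normc (z - 0) < r by rewrite subr0.
rewrite poissonE// ler_pdivlMr ?exprn_gt0 ?normc_gt0 ?circle_neq//.
have nz : normc (circle 0 r t - z) <= r + normc z.
  apply: le_trans (le_normcB _ _) _.
  by rewrite -{1}(subr0 (circle 0 r t)) circle_sub.
have := normc_ge0 (circle 0 r t - z); have := normc_ge0 z; nra.
Qed.

Lemma poisson_cont r z : normc z < r -> continuous (poisson r z).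
Proof.
move=> zr; have zr' : normc (z - 0) < r by rewrite subr0.
apply: ccont_Re; apply: ccontB; last exact: ccont_cst.
by apply: ccontM; [exact: ccont_cst|exact: ccont_kernel].
Qed.

Lemma cont_mul (f g : R -> R) : continuous f -> continuous g -> continuous (fun t => f t * g t).
Proof. by move=> cf cg t; apply: cvgM; [exact: cf|exact: cg]. Qed.

Lemma cont_add (f g : R -> R) : continuous f -> continuous g -> continuous (fun t => f t + g t).
Proof. by move=> cf cg t; apply: cvgD; [exact: cf|exact: cg]. Qed.

Lemma cont_sub (f g : R -> R) : continuous f -> continuous g -> continuous (fun t => f t - g t).
Proof. by move=> cf cg t; apply: cvgB; [exact: cf|exact: cg]. Qed.

Lemma cont_cst (k : R) : continuous (fun _ : R => k).
Proof. by move=> t; exact: cvg_cst. Qed.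

Lemma Re_herglotz phi r z : continuous phi -> normc z < r ->
  Re (herglotz phi r z) = avg (fun t => phi t * poisson r z t).
Proof.
move=> cphi zr; have zr' : normc (z - 0) < r by rewrite subr0.
have cp := ccont_real cphi; have ck := ccont_kernel zr'.
have cpk : ccont (fun t => (phi t)%:C * cauchy_kernel 0 r z t) by exact: ccontM.
have cR := ccont_Re cpk.
rewrite /herglotz /cauchy_int cReD cReN -(rmorph_nat (real_complex R)) Re_mulrC/= -avgZ//.
rewrite -avgB//; last by apply: cont_mul => //; exact: cont_cst.
apply: eq_avg => t; rewrite Re_mulrC /poisson cReD cReN.
by rewrite -(rmorph_nat (real_complex R)) Re_mulrC/=; ring.
Qed.

Lemma herglotz_hol phi r : continuous phi -> (exists M, forall t, `|phi t| <= M) ->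
  hol r (herglotz phi r).
Proof.
move=> cphi [M HM] z zr; eexists; apply: cderivD; last exact: cderiv_cst.
apply: cderivZ; apply: (cauchy_int_cderiv (M := M)) => //; first exact: ccont_real.
by move=> t; rewrite normc_real.
Qed.

Lemma herglotz0 phi r : 0 < r -> continuous phi -> herglotz phi r 0 = (avg phi)%:C.
Proof.
move=> r0 cphi; rewrite /herglotz /cauchy_int.
have -> : cavg (fun t => (phi t)%:C * cauchy_kernel 0 r 0 t) = (avg phi)%:C.
  transitivity (cavg (fun t => (phi t)%:C)).
    apply: eq_cavg => t; rewrite /cauchy_kernel /circle add0r subr0 mulfV ?mulr1//.
    by rewrite -normc_eq0 normcM normc_real normc_expi mulr1 normr_eq0 gt_eqF.
  by rewrite /cavg; apply: complex_ext => //=; exact: avg_cst.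
by ring.
Qed.

(** The conjugate kernel is the trace of a holomorphic function with value 1 at 0. The mean value
    property of its product with f shows that the conjugate of f integrates against the kernel to
    the conjugate of f(0); adding Cauchy's formula leaves 2 Re f. *)
Lemma schwarz_formula rad f r z : hol rad f -> 0 < r < rad -> normc z < r ->
  f z + (f 0)^*%C =
  2 * cavg (fun t => (Re (f (circle 0 r t)))%:C * cauchy_kernel 0 r z t).
Proof.
move=> Hf r01 zr; have /andP[r0 r1] := r01; have zr' : normc (z - 0) < r by rewrite subr0.
have cf := ccont_hol_circle Hf r01; have ck := ccont_kernel zr'.
have H1 : f z = cavg (fun t => f (circle 0 r t) * cauchy_kernel 0 r z t).
  by rewrite cauchy_formula//; exact: (hol_disk Hf r1).
have H2 : (f 0)^*%C = cavg (fun t => (f (circle 0 r t))^*%C * cauchy_kernel 0 r z t).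
  pose g w := f w * (1 - (z - 0)^*%C / (r ^+ 2)%:C * (w - 0))^-1.
  have Hg : cdiff_on_disk g 0 r.
    move=> w wr; have [d1 h1] := hol_disk Hf r1 wr.
    by have [d2 h2] := reflected_kernel_diff r0 zr' wr; eexists; exact: cderivM h1 h2.
  have g0 : g 0 = f 0 by rewrite /g subrr mulr0 [1 - 0]subr0 invr1 mulr1.
  rewrite -g0 -(mean_value r0 Hg) /g.
  rewrite -cavgJ; last first.
    by have := ccont_disk Hg r0; exact.
  by apply: eq_cavg => t; rewrite conjcM -kernelJ// conjcK.
rewrite {1}H1 H2 -cavgD; [|exact: ccontM|apply: ccontM => //; exact: ccontJ].
rewrite -cavgZ; last by apply: ccontM => //; apply: ccont_real; exact: ccont_Re.
by apply: eq_cavg => t; rewrite -mulrDl addcJ mulrA.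
Qed.

Lemma poisson_formula rad f r z : hol rad f -> 0 < r < rad -> normc z < r ->
  Re (f z) = avg (fun t => Re (f (circle 0 r t)) * poisson r z t).
Proof.
move=> Hf r01 zr; have cf := ccont_Re (ccont_hol_circle Hf r01).
have /andP[r0 r1] := r01.
rewrite -Re_herglotz// /herglotz /cauchy_int -(schwarz_formula Hf r01 zr).
have -> : avg (fun t => Re (f (circle 0 r t))) = Re (f 0).
  by rewrite -(mean_value r0 (hol_disk Hf r1)).
by rewrite cReD cReN cReD /=; case: (f 0) => a b /=; rewrite addrK.
Qed.

Lemma avg_poisson r z : 0 < r -> normc z < r -> avg (poisson r z) = 1.
Proof.
move=> r0 zr; have r01 : 0 < r < r + 1 by lra.
have Hc : hol (r + 1) (fun=> (1 : C)) by exact: hol_cst.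
by have := poisson_formula Hc r01 zr; rewrite /= => ->; apply: eq_avg => t; rewrite mul1r.
Qed.

(** Where Re f is nonnegative on the circle, its mean Re f(0) controls its absolute integral.
    Convergence at the single point 0 thereby becomes locally uniform. *)
Lemma schwarz_bound rad f r s z : hol rad f -> 0 < r < rad -> s < r -> normc z <= s ->
  (forall t, 0 <= Re (f (circle 0 r t))) ->
  normc (f z + (f 0)^*%C) <= 4 * (r / (r - s)) * Re (f 0).
Proof.
move=> Hf r01 sr zs pos; have /andP[r0 r1] := r01.
have zr : normc z < r by lra.
have zr' : normc (z - 0) < r by rewrite subr0.
have cf := ccont_Re (ccont_hol_circle Hf r01); have ck := ccont_kernel zr'.
rewrite (schwarz_formula Hf r01 zr) normcM.
have -> : normc (2 : C) = 2 by rewrite -(rmorph_nat (real_complex R)) normc_real ger0_norm.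
rewrite -(mean_value r0 (hol_disk Hf r1)) /=.
have -> : 4 * (r / (r - s)) * avg (fun t => Re (f (circle 0 r t))) =
  2 * (2 * avg (fun t => r / (r - s) * Re (f (circle 0 r t)))) by rewrite avgZ//; ring.
rewrite ler_pM2l//; apply: normc_cavg.
- by apply: ccontM => //; exact: ccont_real.
- by apply: cont_mul => //; exact: cont_cst.
move=> t; rewrite normcM normc_real ger0_norm// mulrC ler_wpM2r//.
exact: normc_kernel.
Qed.

(* [avg (|zeta - zeta_0|^2 P_z)] is computed exactly, because
   [|zeta - zeta_0|^2] is the real part of an affine function of [zeta] on the
   circle; it is [2 r (r - |z|)] when [z] is on the ray through [zeta_0]. *)
Lemma poisson_boundary phi r x t0 e k : 0 <= x < r -> continuous phi ->
  (forall t, `|phi t - phi t0| <= e + k * normc (circle 0 r t - circle 0 r t0) ^+ 2) ->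
  `|avg (fun t => phi t * poisson r (x%:C * expi t0) t) - phi t0| <= e + k * (2 * r * (r - x)).
Proof.
move=> /andP[x0 xr] cphi H; have r0 : 0 < r by lra.
set z := x%:C * expi t0.
have zx : normc z = x by rewrite normcM normc_real normc_expi mulr1 ger0_norm.
have zr : normc z < r by rewrite zx.
have cP := poisson_cont zr.
pose g w : C := (- 2 * (circle 0 r t0)^*%C) * w + (2 * r ^+ 2)%:C.
have gE t : Re (g (circle 0 r t)) = normc (circle 0 r t - circle 0 r t0) ^+ 2.
  rewrite /g /circle !add0r normc_sqr /expi.
  have := cos2Dsin2 t; have := cos2Dsin2 t0.
  move: (cos t) (sin t) (cos t0) (sin t0) => a b c d; rewrite /= => h1 h2.
  have -> : 2 * r ^+ 2 = r ^+ 2 * (a ^+ 2 + b ^+ 2) + r ^+ 2 * (c ^+ 2 + d ^+ 2).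
    by rewrite h1 h2; ring.
  by ring.
have gz : Re (g z) = 2 * r * (r - x).
  rewrite /g /z /circle !add0r /expi; have := cos2Dsin2 t0.
  move: (cos t0) (sin t0) => c d; rewrite /= => h1.
  transitivity (2 * r ^+ 2 - 2 * r * x * (c ^+ 2 + d ^+ 2)); first by ring.
  by rewrite h1; ring.
have cg : continuous (fun t => Re (g (circle 0 r t))).
  apply: ccont_Re; apply: ccontD; last exact: ccont_cst.
  by apply: ccontM; [exact: ccont_cst|exact: ccont_circle].
have r01 : 0 < r < r + 1 by lra.
have Hg : hol (r + 1) g by move=> w _; eexists; exact: cderiv_affine.
have -> : e + k * (2 * r * (r - x)) =
    avg (fun t => (e + k * Re (g (circle 0 r t))) * poisson r z t).
  rewrite -gz (poisson_formula Hg r01 zr).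
  rewrite -{1}[e]mulr1 -(avg_poisson r0 zr) -!avgZ//; last exact: cont_mul.
  rewrite -avgD.
  - by apply: eq_avg => t; ring.
  - by apply: cont_mul => //; exact: cont_cst.
  - by apply: cont_mul; [exact: cont_cst|exact: cont_mul].
have -> : avg (fun t => phi t * poisson r z t) - phi t0 =
    avg (fun t => (phi t - phi t0) * poisson r z t).
  rewrite -{1}[phi t0]mulr1 -(avg_poisson r0 zr) -!avgZ// -avgB.
  - by apply: eq_avg => t; ring.
  - exact: cont_mul.
  - by apply: cont_mul => //; exact: cont_cst.
apply: avg_norm.
- by apply: cont_mul => //; apply: cont_sub => //; exact: cont_cst.
- apply: cont_mul => //; apply: cont_add; first exact: cont_cst.
  by apply: cont_mul => //; exact: cont_cst.
move=> t; rewrite normrM [`|poisson _ _ _|]ger0_norm ?poisson_ge0//.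
by rewrite ler_wpM2r ?poisson_ge0// gE.
Qed.

Lemma circleN_norm r t : 0 <= r -> normc (- (r%:C * expi t)) = r.
Proof. by move=> r0; rewrite normcN normcM normc_real normc_expi mulr1 ger0_norm. Qed.

(** The minus sign matches [int2_emean_swap], which puts a mean of radius [- r] on the test
    function. *)
Lemma mean_valueN rad f r z : hol rad f -> 0 < r -> normc z + r < rad ->
  cavg (fun t => f (z - r%:C * expi t)) = f z.
Proof.
move=> Hf r0 zr; have H : cdiff_on_disk (fun w => f (- w)) (- z) r.
  move=> w; rewrite opprK => wr.
  have [|d Hd] := Hf (- w).
    by rewrite normcN; have := le_normcBD w (- z); rewrite opprK normcN; lra.
  eexists; apply: (cderiv_comp (g := fun w => - w)) Hd _.
  apply: (cderiv_ext (f := fun w => (-1) * w + 0) (r := 1)) => //.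
    by move=> h _; rewrite mulN1r addr0.
  exact: cderiv_affine.
have := mean_value r0 H; rewrite opprK => <-.
by apply: eq_cavg => t; rewrite /circle opprD opprK.
Qed.

(* Superharmonicity is tested against circular means; for [u = Re f] the mean of
   [u^2] exceeds [u^2] by [r^2 |f'|^2 / 2] up to third order. *)
Lemma mean_sqr_Re rad f s : hol rad f -> s < rad -> exists2 K, 0 < K &
  forall z r, 0 < r <= 1 -> normc z + r <= s ->
  `|avg (fun t => Re (f (z - r%:C * expi t)) ^+ 2) - Re (f z) ^+ 2 -
    r ^+ 2 * normc (dc f z) ^+ 2 / 2| <= K * r ^+ 3.
Proof.
move=> Hf sr; have [rad0|rad0] := leP rad 0.
  exists 1 => // z r r01 zr; have := normc_ge0 z; lra.
have [B B0 HB] := hol_bounded rad0 Hf sr.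
exists (3 * B ^+ 2); first by rewrite mulr_gt0// exprn_gt0.
move=> z r /andP[r0 r1] zr; have zs : normc z <= s by lra.
have [_ dB tB] := HB z zs; set u := Re (f z); set D := dc f z in dB tB *.
pose h t : C := - (r%:C * expi t).
have hr t : normc (h t) = r by apply: circleN_norm; exact: ltW.
have ch : ccont h by apply: ccontN; apply: ccontM; [exact: ccont_cst|exact: ccont_expi].
have zh t : normc (z + h t) <= s by have := le_normcD z (h t); rewrite hr; lra.
have cf : ccont (fun t => f (z + h t)).
  apply: (ccont_hol Hf) => [|t]; last by have := zh t; lra.
  by apply: ccontD => //; exact: ccont_cst.
have cu := ccont_Re cf.
have cD : ccont (fun t => D * h t) by apply: ccontM => //; exact: ccont_cst.
have mv : avg (fun t => Re (f (z + h t))) = u.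
  by have := mean_valueN Hf r0 (le_lt_trans zr sr) => /(congr1 (@complex.Re R)).
(* The mean of Re f is u, so this difference is a variance. *)
have -> : avg (fun t => Re (f (z - r%:C * expi t)) ^+ 2) - u ^+ 2 =
    avg (fun t => (Re (f (z + h t)) - u) ^+ 2).
  have -> : (fun t => (Re (f (z + h t)) - u) ^+ 2) = (fun t =>
      (Re (f (z + h t)) ^+ 2 - 2 * u * Re (f (z + h t))) + u ^+ 2).
    by apply/funext => t; ring.
  have c2 : continuous (fun t => Re (f (z + h t)) ^+ 2).
    by under eq_fun do rewrite expr2; exact: cont_mul.
  have cuu : continuous (fun t => 2 * u * Re (f (z + h t))).
    by apply: cont_mul => //; exact: cont_cst.
  rewrite avgD; [|exact: cont_sub|exact: cont_cst].
  by rewrite avgB// avgZ// mv avg_cst; ring.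
(* For v = D h, (Re v)^2 = (Re(v^2) + |v|^2) / 2, and v^2 has mean 0. *)
have -> : r ^+ 2 * normc D ^+ 2 / 2 = avg (fun t => Re (D * h t) ^+ 2).
  have -> : (fun t => Re (D * h t) ^+ 2) =
      (fun t => 2^-1 * Re (D ^+ 2 * h t ^+ 2) + r ^+ 2 * normc D ^+ 2 / 2).
    apply/funext => t; rewrite -exprMn -[in RHS](hr t) -exprMn (mulrC (normc _)) -normcM.
    by rewrite normc_sqr; case: (D * h t) => a b /=; field.
  have cDh : ccont (fun t => D ^+ 2 * h t ^+ 2).
    apply: ccontM; first exact: ccont_cst.
    by under eq_fun do rewrite expr2; exact: ccontM.
  have m0 : avg (fun t => Re (D ^+ 2 * h t ^+ 2)) = 0.
    have Hg : hol (r + 1) (fun w => D ^+ 2 * (w * w)).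
      by apply: holM; [exact: hol_cst|apply: holM; exact: hol_id].
    have r0' : normc (0 : C) + r < r + 1 by rewrite normc0; lra.
    have := mean_valueN Hg r0 r0' => /(congr1 (@complex.Re R)); rewrite mulr0 mulr0 /= => <-.
    by apply: eq_avg => t; rewrite sub0r -/(h t) expr2.
  have cRe := ccont_Re cDh.
  rewrite avgD; [|by apply: cont_mul => //; exact: cont_cst|exact: cont_cst].
  by rewrite avg_cst avgZ// m0 mulr0 add0r.
have cuu : continuous (fun t => (Re (f (z + h t)) - u) ^+ 2).
  under eq_fun do rewrite expr2.
  by apply: cont_mul; apply: cont_sub => //; exact: cont_cst.
have cDD : continuous (fun t => Re (D * h t) ^+ 2).
  by under eq_fun do rewrite expr2; apply: cont_mul; exact: ccont_Re.
rewrite -avgB// -[leRHS]avg_cst; apply: avg_norm; [exact: cont_sub|exact: cont_cst|].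
move=> t; have := tB (h t) (zh t); rewrite hr.
set E := f (z + h t) - f z - D * h t => hE.
have -> : Re (f (z + h t)) - u = Re E + Re (D * h t).
  by rewrite /E /u !cReD !cReN; ring.
have h1 : `|Re E| <= B * r ^+ 2 by apply: le_trans (normr_Re _) hE.
have h2 : `|Re (D * h t)| <= B * r.
  by apply: le_trans (normr_Re _) _; rewrite normcM hr; apply: ler_wpM2r => //; exact: ltW.
(* The factors are at most B r^2 and 3 B r; this is the origin of the constant 3 B^2. *)
have -> : (Re E + Re (D * h t)) ^+ 2 - Re (D * h t) ^+ 2 =
  Re E * (Re E + 2 * Re (D * h t)) by ring.
rewrite normrM.
have h3 : `|Re E + 2 * Re (D * h t)| <= 3 * (B * r).
  have h4 : B * r ^+ 2 <= B * r by rewrite ler_pM2l// expr2 ler_piMl// ltW.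
  move: h1 h2; rewrite !ler_norml; lra.
have := ler_pM (normr_ge0 _) (normr_ge0 _) h1 h3; move/le_trans; apply.
by rewrite le_eqVlt; apply/orP; left; apply/eqP; ring.
Qed.
End Poisson.

(** * Area integrals and circular means *)

Section PlaneMeasure.
Variable R : realType.
Local Notation mu := (@lebesgue_measure R).
Local Notation mu2 := (mu \x mu)%E.

Lemma lebesgue_measure_shift (a : R) (A : set R) : measurable A ->
  pushforward mu ((fun x : R => x + a) : _ -> measurableTypeR R) A = mu A.
Proof.
move=> mA; have mf : measurable_fun [set: R] (fun x : R => x + a).
  by apply: measurable_funD; [exact: measurable_id|exact: measurable_cst].
apply/esym/lebesgue_measure_unique => //= _ [[c d]] _ <-.
rewrite /pushforward/=.
have -> : (fun x => x + a) @^-1` `]c, d]%classic = `]c - a, d - a]%classic.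
  by apply/seteqP; split=> x /=; rewrite !in_itv/= ltrBlDr lerBrDr.
by rewrite !lebesgue_measure_itv/= !lte_fin ltrD2r; case: ifP => // _;
  rewrite -!EFinD; congr EFin; ring.
Qed.

Lemma integral_shift (a : R) (f : R -> \bar R) : measurable_fun [set: R] f ->
  (forall x, 0 <= f x)%E ->
  (\int[mu]_x f (x + a)%R = \int[mu]_x f x)%E.
Proof.
move=> mf f0; have mg : measurable_fun [set: R] (fun x : R => x + a).
  by apply: measurable_funD; [exact: measurable_id|exact: measurable_cst].
transitivity (\int[pushforward mu ((fun x : R => x + a)%R : _ -> measurableTypeR R)]_x f x)%E.
  by rewrite ge0_integral_pushforward.
by apply: eq_measure_integral => //= A mA _; exact: lebesgue_measure_shift.
Qed.

Lemma integral_shear1 (g : R -> R) (F : R * R -> \bar R) : measurable_fun setT F ->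
  (forall p, 0 <= F p)%E -> measurable_fun setT g ->
  (\int[mu2]_p F (p.1, p.2 + g p.1)%R = \int[mu2]_p F p)%E.
Proof.
move=> mF F0 mg.
have mT : measurable_fun setT (fun p : R * R => (p.1, p.2 + g p.1)).
  apply: measurable_fun_pair; first exact: measurable_fst.
  apply: measurable_funD; first exact: measurable_snd.
  exact: measurableT_comp mg measurable_fst.
rewrite !fubini_tonelli1//; last exact: measurableT_comp mF mT.
apply: eq_integral => x _; rewrite /fubini_F/=.
apply: (@integral_shift (g x) (fun y => F (x, y))) => //.
exact: measurableT_comp mF (pair1_measurable x).
Qed.

Lemma integral_shear2 (g : R -> R) (F : R * R -> \bar R) : measurable_fun setT F ->
  (forall p, 0 <= F p)%E -> measurable_fun setT g ->
  (\int[mu2]_p F (p.1 + g p.2, p.2)%R = \int[mu2]_p F p)%E.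
Proof.
move=> mF F0 mg.
have mT : measurable_fun setT (fun p : R * R => (p.1 + g p.2, p.2)).
  apply: measurable_fun_pair; last exact: measurable_snd.
  apply: measurable_funD; first exact: measurable_fst.
  exact: measurableT_comp mg measurable_snd.
rewrite !fubini_tonelli2//; last exact: measurableT_comp mF mT.
apply: eq_integral => x _; rewrite /fubini_G/=.
apply: (@integral_shift (g x) (fun y => F (y, x))) => //.
exact: measurableT_comp mF (pair2_measurable x).
Qed.

Lemma integral2_shift (a b : R) (F : R * R -> \bar R) : measurable_fun setT F ->
  (forall p, 0 <= F p)%E ->
  (\int[mu2]_p F (p.1 + a, p.2 + b)%R = \int[mu2]_p F p)%E.
Proof.
move=> mF F0; rewrite -(@integral_shear1 (fun=> b) F mF F0)//.
apply: (@integral_shear2 (fun=> a) (fun p => F (p.1, p.2 + b))) => //.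
apply: measurableT_comp => //; apply: measurable_fun_pair; first exact: measurable_fst.
by apply: measurable_funD; [exact: measurable_snd|exact: measurable_cst].
Qed.

Lemma measurable_linear (c d : R) :
  measurable_fun setT (fun p : R * R => c * p.1 + d * p.2).
Proof.
apply: measurable_funD; apply: measurable_funM; try exact: measurable_cst.
  exact: measurable_fst.
exact: measurable_snd.
Qed.

(* A rotation of angle different from [pi] is a product of three shears. *)
Lemma integral2_rotation (c s : R) (F : R * R -> \bar R) : c ^+ 2 + s ^+ 2 = 1 ->
  measurable_fun setT F -> (forall p, 0 <= F p)%E ->
  (\int[mu2]_p F (c * p.1 - s * p.2, s * p.1 + c * p.2)%R = \int[mu2]_p F p)%E.
Proof.
move=> cs mF F0.
have rot (c' s' : R) (G : R * R -> \bar R) : c' ^+ 2 + s' ^+ 2 = 1 -> 1 + c' != 0 ->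
  measurable_fun setT G -> (forall p, 0 <= G p)%E ->
  (\int[mu2]_p G (c' * p.1 - s' * p.2, s' * p.1 + c' * p.2)%R = \int[mu2]_p G p)%E.
  (* [t] is minus the tangent of half the angle. *)
  move=> cs' c'1 mG G0; pose t := - s' / (1 + c').
  have s2 : s' ^+ 2 = 1 - c' ^+ 2 by lra.
  have ml (k : R) : measurable_fun setT (fun x : R => k * x).
    by apply: measurable_funM; [exact: measurable_cst|exact: measurable_id].
  have mS2 k : measurable_fun setT (fun p : R * R => (p.1 + k * p.2, p.2)).
    apply: measurable_fun_pair; last exact: measurable_snd.
    by have := measurable_linear 1 k; under eq_fun do rewrite mul1r.
  have mS1 k : measurable_fun setT (fun p : R * R => (p.1, p.2 + k * p.1)).
    apply: measurable_fun_pair; first exact: measurable_fst.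
    by have := measurable_linear k 1; under eq_fun do rewrite mul1r addrC.
  rewrite -(integral_shear2 mG G0 (ml t)).
  have mG1 := measurableT_comp mG (mS2 t).
  rewrite -(integral_shear1 mG1 (fun p => G0 _) (ml s')).
  have mG2 := measurableT_comp mG1 (mS1 s').
  rewrite -(integral_shear2 mG2 (fun p => G0 _) (ml t)).
  apply: eq_integral => -[x y] _ /=; congr (G (_, _)).
    by rewrite /t; field: s2.
  by rewrite /t; field: s2.
(* The half turn, where this tangent is infinite, is the square of a quarter turn. *)
have [c1|c1] := eqVneq (1 + c) 0; last exact: rot.
have cN : c = -1 by lra.
have s0 : s = 0 by apply/eqP; rewrite -sqrf_eq0; apply/eqP; rewrite cN in cs; lra.
have q1 : (0 : R) ^+ 2 + 1 ^+ 2 = 1 by rewrite expr0n expr1n add0r.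
have q2 : 1 + (0 : R) != 0 by rewrite addr0 oner_eq0.
rewrite -(rot 0 1 F q1 q2 mF F0).
have mG : measurable_fun setT (fun p : R * R => F (0 * p.1 - 1 * p.2, 1 * p.1 + 0 * p.2)).
  apply: measurableT_comp => //; apply: measurable_fun_pair; last exact: measurable_linear.
  by have := measurable_linear 0 (-1); under eq_fun do rewrite mulNr.
rewrite -(rot 0 1 _ q1 q2 mG)//.
by apply: eq_integral => -[x y] _ /=; congr (F (_, _)); rewrite cN s0; ring.
Qed.

(** The plane carries the product sigma-algebra, so an open set is exhibited as a countable union of
    rectangles: squares with rational centre and half side 1/(n+1). *)
Lemma open2_measurable (A : set (R * R)) :
  (forall p, A p -> exists2 e, 0 < e & forall q, `|q.1 - p.1| < e -> `|q.2 - p.2| < e -> A q) ->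
  measurable A.
Proof.
move=> Aopen.
pose sq (i : rat * rat * nat) : set (R * R) :=
  `]ratr i.1.1 - i.2.+1%:R^-1, ratr i.1.1 + i.2.+1%:R^-1[%classic `*`
  `]ratr i.1.2 - i.2.+1%:R^-1, ratr i.1.2 + i.2.+1%:R^-1[%classic.
pose F i := [set p | sq i `<=` A /\ sq i p].
have -> : A = \bigcup_i F i.
  apply/seteqP; split=> [p Ap|p [i _]]; last first.
    by case=> iA; exact: iA.
  have [e e0 He] := Aopen p Ap.
  have [n Hn] : exists n, n.+1%:R^-1 < e / 2 :> R.
    have [n _ /(_ n (leqnn n))] := near_infty_natSinv_lt (PosNum (divr_gt0 e0 (ltr0n R 2))).
    by exists n.
  have [d dE] : exists d : R, d = n.+1%:R^-1 by exists n.+1%:R^-1.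
  have d0 : 0 < d by rewrite dE invr_gt0.
  rewrite -dE in Hn.
  have rat_near (x : R) : exists q : rat, x - d < ratr q < x + d.
    have [|q] := @rat_in_itvoo R (x - d) (x + d); first by lra.
    by rewrite in_itv/=; exists q.
  have [q1 /andP[h1 h2]] := rat_near p.1; have [q2 /andP[h3 h4]] := rat_near p.2.
  exists (q1, q2, n) => //; split.
    move=> q [/=]; rewrite !in_itv/= -dE => /andP[h5 h6] /andP[h7 h8].
    by apply: He; rewrite ltr_norml; lra.
  by split; rewrite /= in_itv/= -dE; lra.
apply: countable_bigcupT_measurable => [|i]; first exact: countableP.
have [sA|sA] := pselect (sq i `<=` A).
  rewrite (_ : F i = sq i); first by apply: measurableX; exact: measurable_itv.
  by apply/seteqP; split=> p; [case|].
rewrite (_ : F i = set0); first exact: measurable0.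
by apply/seteqP; split=> p // [].
Qed.

Definition toC (p : R * R) : R[i] := p.1 +i* p.2.

Lemma copen_measurable (A : set R[i]) :
  (forall z, A z -> exists2 e, 0 < e & forall w, normc (w - z) < e -> A w) ->
  measurable (toC @^-1` A).
Proof.
move=> H; apply: open2_measurable => p /= /H[e e0 {}H].
exists (e / 2); first by lra.
move=> q h1 h2; apply: H; apply: le_lt_trans (normc_le _) _.
by rewrite /toC /=; lra.
Qed.

Definition cdisk r : set (R * R) := [set p | normc (toC p) < r].

Lemma measurable_cdisk r : measurable (cdisk r).
Proof.
apply: (@copen_measurable [set z | normc z < r]) => z /= zr.
exists (r - normc z); first by lra.
by move=> w; have := le_normcBD w z; lra.
Qed.

Lemma measurable_lsc (r : R) (w : R[i] -> \bar R) :
  (forall z a, normc z < r -> (a%:E < w z)%E ->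
     exists2 e, 0 < e & forall y, normc (y - z) < e -> (a%:E < w y)%E) ->
  measurable_fun (cdisk r) (fun p => w (toC p)).
Proof.
move=> H; apply: (measurability _ (ErealGenOInfty.measurableE R)).
move=> /= _ [_ [a ->]] <-; rewrite preimage_itvoy.
apply: (@copen_measurable [set z | normc z < r /\ (a%:E < w z)%E]) => z [zr az].
have [e e0 {}H] := H z a zr az.
exists (Num.min e (r - normc z)); first by rewrite lt_min e0/=; lra.
move=> y; rewrite lt_min => /andP[ye yr]; split; last exact: H.
by have := le_normcBD y z; lra.
Qed.

Lemma measurable_ccont (r : R) (g : R[i] -> R) :
  (forall z, normc z < r -> forall e, 0 < e ->
     exists2 d, 0 < d & forall h, normc h <= d -> `|g (z + h) - g z| < e) ->
  measurable_fun (cdisk r) (fun p => g (toC p)).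
Proof.
move=> H; apply/measurable_EFinP.
apply: (@measurable_lsc r (fun z => (g z)%:E)) => z a zr; rewrite lte_fin => az.
have [|d d0 {}H] := H z zr (g z - a); first by lra.
exists d => // y yd; rewrite lte_fin.
by have := H (y - z) (ltW yd); rewrite subrKC ltr_norml; lra.
Qed.

Lemma measurable_hol r (f : R[i] -> R[i]) : hol r f ->
  measurable_fun (cdisk r) (fun p => Re (f (toC p))) /\
  measurable_fun (cdisk r) (fun p => Im (f (toC p))).
Proof.
move=> Hf; split; apply: (measurable_ccont (g := fun z => _ (f z))) => z zr e e0;
  have [d /cderiv_cont/(_ e e0)[s s0 H]] := Hf z zr; exists s => // h /H; apply: le_lt_trans.
  by rewrite -cReN -cReD normr_Re.
by rewrite -cImN -cImD normr_Im.
Qed.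

End PlaneMeasure.

(** * Circular means under the area integral *)

Section AreaIntegral.
Variable R : realType.
Local Notation C := R[i].
Local Notation mu := (@lebesgue_measure R).
Local Notation mu2 := (mu \x mu)%E.
Implicit Types (W : C -> \bar R) (z : C).

Lemma sigma_finite_plane : sigma_finite setT mu2.
Proof.
pose J n : set R := `]- n%:R, n%:R[%classic.
exists (fun n => J n `*` J n) => [|n]; last first.
  split; first by apply: measurableX; exact: measurable_itv.
  rewrite product_measure1E; try exact: measurable_itv.
  rewrite /= lebesgue_measure_itv/=; case: ifP => _; last by rewrite mule0.
  by rewrite -EFinM ltry.
apply/seteqP; split=> // -[x y] _.
exists (Num.bound (Num.max `|x| `|y|)) => //.
have : Num.max `|x| `|y| < (Num.bound (Num.max `|x| `|y|))%:R.
  by apply: archi_boundP; rewrite le_max normr_ge0.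
by rewrite gt_max !ltr_norml => /andP[hx hy]; split; rewrite /J /= in_itv.
Qed.

(* The instance that the library attaches to [\x] only covers probabilities. *)
Definition plane_measure :
    {sigma_finite_measure set (measurableTypeR R * measurableTypeR R)%type -> \bar R} :=
  HB.pack mu2 (@Measure_isSigmaFinite.Build _ _ _ mu2 sigma_finite_plane).

Definition pmeas W := measurable_fun setT (fun p => W (toC p)).

(** Integration is over the whole plane, so that translations and rotations leave the domain fixed;
    weights and densities vanish off a disk. *)
Definition int2 W : \bar R := (\int[mu2]_p W (toC p))%E.

Definition emean (W : C -> \bar R) (z : C) (r : R) : \bar R :=
  ((2 * pi)^-1%:E * \int[mu]_(t in `[0%R, (2 * pi)%R]) W (z + r%:C * expi t)%R)%E.

Let I : set R := `[0, 2 * pi]%classic.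

Let mI : measurable I. Proof. exact: measurable_itv. Qed.

Lemma measurable_circle (r : R) :
  measurable_fun setT (fun x : (R * R) * R => (x.1.1 + r * cos x.2, x.1.2 + r * sin x.2)).
Proof.
have m1 : measurable_fun setT (fun x : (R * R) * R => x.1.1).
  exact: measurableT_comp measurable_fst measurable_fst.
have m2 : measurable_fun setT (fun x : (R * R) * R => x.1.2).
  exact: measurableT_comp measurable_snd measurable_fst.
have mc : measurable_fun setT (fun x : (R * R) * R => cos x.2).
  apply: measurableT_comp measurable_snd; apply: continuous_measurable_fun.
  exact: continuous_cos.
have ms : measurable_fun setT (fun x : (R * R) * R => sin x.2).
  apply: measurableT_comp measurable_snd; apply: continuous_measurable_fun.
  exact: continuous_sin.
by apply: measurable_fun_pair; apply: measurable_funD => //; apply: measurable_funM => //;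
  exact: measurable_cst.
Qed.

Lemma toC_circle (r t : R) (p : R * R) :
  toC (p.1 + r * cos t, p.2 + r * sin t) = toC p + r%:C * expi t.
Proof. by apply: complex_ext => /=; ring. Qed.

Lemma pmeas_circle W r : pmeas W ->
  measurable_fun setT (fun x : (R * R) * R => W (toC x.1 + r%:C * expi x.2)).
Proof.
move=> mW; have := measurableT_comp mW (measurable_circle r).
by apply: eq_measurable_fun => x _ /=; rewrite toC_circle.
Qed.

Lemma pmeas_ball W r z : pmeas W -> measurable_fun setT (fun t : R => W (z + r%:C * expi t)).
Proof.
move=> mW; have := measurableT_comp (pmeas_circle r mW) (pair1_measurable (Re z, Im z)).
by apply: eq_measurable_fun => x _ /=; case: z.
Qed.

Lemma int2_shift W z : pmeas W -> (forall y, 0 <= W y)%E ->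
  int2 (fun y => W (y + z)) = int2 W.
Proof.
move=> mW W0; rewrite /int2 -(integral2_shift (Re z) (Im z) mW (fun p => W0 _)).
by apply: eq_integral => p _; congr W; case: z.
Qed.

Lemma emean_ge0 W z r : (forall y, 0 <= W y)%E -> (0 <= emean W z r)%E.
Proof.
move=> W0; apply: mule_ge0; last exact: integral_ge0.
by rewrite lee_fin invr_ge0 ltW// pi2_gt0.
Qed.

(* Tonelli and translation invariance move the circular mean from [Q] to [W]. *)
Lemma int2_emean_swap W Q (r : R) : pmeas W -> pmeas Q ->
  (forall y, 0 <= W y)%E -> (forall y, 0 <= Q y)%E ->
  int2 (fun z => W z * emean Q z (- r)%R)%E = int2 (fun z => Q z * emean W z r)%E.
Proof.
move=> mW mQ W0 Q0.
have c0 : (0 <= ((2 * pi)^-1)%:E :> \bar R)%E by rewrite lee_fin invr_ge0 ltW// pi2_gt0.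
pose ind (t : R) : \bar R := (\1_I t)%:E.
have ind0 t : (0 <= ind t)%E by rewrite lee_fin indicE; case: (t \in I).
have mind : measurable_fun setT ind by apply/measurable_EFinP; exact: measurable_indic.
have swap V P s : pmeas V -> pmeas P -> (forall y, 0 <= V y)%E -> (forall y, 0 <= P y)%E ->
    int2 (fun z => V z * emean P z s)%E =
    (((2 * pi)^-1)%:E * \int[mu]_t (ind t * int2 (fun z => V z * P (z + s%:C * expi t)%R)))%E.
  move=> mV mP V0 P0.
  pose F (x : (R * R) * R) := (V (toC x.1) * (P (toC x.1 + s%:C * expi x.2)%R * ind x.2))%E.
  have F0 x : (0 <= F x)%E by rewrite /F !mule_ge0.
  have mF : measurable_fun setT F.
    apply: emeasurable_funM.
      exact: (measurableT_comp mV measurable_fst).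
    apply: emeasurable_funM; first exact: pmeas_circle.
    exact: measurableT_comp mind measurable_snd.
  transitivity (\int[mu2]_p (((2 * pi)^-1)%:E * \int[mu]_t F (p, t)))%E.
    apply: eq_integral => p _; rewrite /emean muleCA; congr (_ * _)%E.
    rewrite integral_mkcond -ge0_integralZl//.
    - apply: eq_integral => t _; rewrite /F/= /ind patchE indicE.
      by case: ifPn => _; rewrite ?mule1 ?mule0.
    - by apply/(measurable_restrictT _ _).1 => //; apply: measurable_funTS; exact: pmeas_ball.
    - by move=> t _; rewrite patchE; case: ifPn.
  rewrite ge0_integralZl//; last 2 first.
  - exact: measurable_fun_fubini_tonelli_F.
  - by move=> p _; exact: integral_ge0.
  congr (_ * _)%E; transitivity (\int[mu]_t \int[mu2]_p F (p, t))%E.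
    exact: (@fubini_tonelli _ _ _ _ R plane_measure mu F mF F0).
  apply: eq_integral => t _; rewrite /int2 -ge0_integralZl//.
  - by apply: eq_integral => p _; rewrite /F/= muleA muleC.
  - apply: emeasurable_funM => //.
    exact: measurableT_comp (pmeas_circle s mP) (pair2_measurable t).
  - by move=> p _; exact: mule_ge0.
rewrite (swap W Q _ mW mQ W0 Q0) (swap Q W _ mQ mW Q0 W0).
congr (_ * _)%E; apply: eq_integral => t _; congr (_ * _)%E.
rewrite -(int2_shift (W := fun z => W z * Q (z + (- r)%:C * expi t)%R)%E (r%:C * expi t))//.
- rewrite /int2; apply: eq_integral => p _; rewrite muleC; congr (_ * _)%E.
  by congr Q; rewrite rmorphN/= mulNr addrK.
- apply: emeasurable_funM => //.
  exact: measurableT_comp (pmeas_circle _ mQ) (pair2_measurable t).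
- by move=> y; exact: mule_ge0.
Qed.

End AreaIntegral.

(** * Superharmonicity tested against functions *)

Section TestLemma.
Variable R : realType.
Local Notation C := R[i].
Local Notation mu := (@lebesgue_measure R).
Local Notation mu2 := (mu \x mu)%E.
Implicit Types (W : C -> \bar R) (z : C) (g : R -> R) (Q G H : C -> R).

Lemma pmeas_emean W r : pmeas W -> (forall y, 0 <= W y)%E -> pmeas (fun z => emean W z r).
Proof.
move=> mW W0; apply: emeasurable_funM; first exact: measurable_cst.
pose F (x : (R * R) * R) := ((W (toC x.1 + r%:C * expi x.2)%R * (\1_(`[0%R, 2 * pi]%classic : set R) x.2)%:E))%E.
have F0 x : (0 <= F x)%E by rewrite mule_ge0// lee_fin indicE; case: (_ \in _).
have mF : measurable_fun setT F.
  apply: emeasurable_funM; first exact: pmeas_circle.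
  apply/measurable_EFinP; apply: (measurableT_comp _ measurable_snd).
  by apply: measurable_indic; exact: measurable_itv.
have := @measurable_fun_fubini_tonelli_F _ _ _ _ R mu F mF F0.
apply: eq_measurable_fun => p _; rewrite /fubini_F [RHS]integral_mkcond.
apply: eq_integral => t _; rewrite /F/= patchE indicE.
by case: ifPn => _; rewrite ?mule1 ?mule0.
Qed.

Lemma int2D W V : pmeas W -> pmeas V -> (forall y, 0 <= W y)%E -> (forall y, 0 <= V y)%E ->
  int2 (fun z => W z + V z)%E = (int2 W + int2 V)%E.
Proof. by move=> mW mV W0 V0; rewrite /int2 ge0_integralD. Qed.

Lemma le_int2 W V : pmeas W -> pmeas V -> (forall y, 0 <= W y)%E ->
  (forall y, W y <= V y)%E -> (int2 W <= int2 V)%E.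
Proof. by move=> mW mV W0 WV; apply: ge0_le_integral. Qed.

Lemma int2Z k W : pmeas W -> (forall y, 0 <= W y)%E -> (0 <= k)%E ->
  int2 (fun z => k * W z)%E = (k * int2 W)%E.
Proof. by move=> mW W0 k0; rewrite /int2 ge0_integralZl. Qed.

Lemma int2_ge0 W : (forall y, 0 <= W y)%E -> (0 <= int2 W)%E.
Proof. by move=> W0; exact: integral_ge0. Qed.

Lemma fatou_bound (F : nat -> C -> \bar R) W (M : \bar R) : (forall n, pmeas (F n)) ->
  (forall n y, 0 <= F n y)%E -> (forall n, int2 (F n) <= M)%E ->
  (forall z, (fun n => F n z) @ \oo --> W z) -> (int2 W <= M)%E.
Proof.
move=> mF F0 FM cF.
have -> : int2 W = (\int[mu2]_p limn_einf (fun n => F n (toC p)))%E.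
  apply: eq_integral => p _; apply/esym.
  by rewrite (is_cvg_limn_einfE (cvgP _ (cF _))); exact: cvg_lim.
have := @fatou _ _ _ mu2 setT measurableT (fun n p => F n (toC p)).
move/(_ mF (fun n p _ => F0 n _)); move/le_trans; apply.
rewrite limn_einf_lim; apply: lime_le; first exact: is_cvg_einfs.
near=> n; apply: le_trans (FM n).
by apply: ereal_inf_lbound; exists n => //=.
Unshelve. all: by end_near. Qed.

Lemma pmeasM W V : pmeas W -> pmeas V -> pmeas (fun z => W z * V z)%E.
Proof. by move=> mW mV; exact: emeasurable_funM. Qed.

Lemma pmeasD W V : pmeas W -> pmeas V -> pmeas (fun z => W z + V z)%E.
Proof. by move=> mW mV; exact: emeasurable_funD. Qed.

Definition rmeas Q := pmeas (fun z => (Q z)%:E).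

(* A superharmonic weight against a compactly supported test function [Q]:
   [int W (A_r Q - Q) = int Q (A_r W - W) <= - k int Q]. *)
Lemma test_lemma W Q G H (r k : R) : pmeas W -> (forall y, 0 <= W y)%E ->
  rmeas Q -> rmeas G -> rmeas H ->
  (forall y, 0 <= Q y) -> (forall y, 0 <= G y) -> (forall y, 0 <= H y) -> 0 <= k ->
  (forall z, Q z != 0%R -> emean W z r + k%:E <= W z)%E ->
  (forall z, W z != 0%E -> (Q z + H z)%:E <= emean (EFin \o Q) z (- r)%R + (G z)%:E)%E ->
  (int2 (fun z => W z * (Q z)%:E) < +oo)%E ->
  (k%:E * int2 (EFin \o Q) + int2 (fun z => W z * (H z)%:E) <= int2 (fun z => W z * (G z)%:E))%E.
Proof.
move=> mW W0 mQ mG mH Q0 G0 H0 k0 Wsup Qsub fin.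
have Q0' y : (0 <= (Q y)%:E)%E by rewrite lee_fin.
have G0' y : (0 <= (G y)%:E)%E by rewrite lee_fin.
have H0' y : (0 <= (H y)%:E)%E by rewrite lee_fin.
have k0' : (0 <= k%:E)%E by rewrite lee_fin.
have e0 z s : (0 <= emean (EFin \o Q) z s)%E by exact: emean_ge0.
have eW0 z s : (0 <= emean W z s)%E by exact: emean_ge0.
set a := int2 (fun z => W z * (Q z)%:E)%E in fin *.
set h := int2 (fun z => W z * (H z)%:E)%E; set g := int2 (fun z => W z * (G z)%:E)%E.
pose b := int2 (fun z => W z * emean (EFin \o Q) z (- r)%R)%E.
have mQ' : pmeas (EFin \o Q) by [].
have mWQ : pmeas (fun z => W z * (Q z)%:E)%E by exact: pmeasM.
have mWG : pmeas (fun z => W z * (G z)%:E)%E by exact: pmeasM.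
have mWH : pmeas (fun z => W z * (H z)%:E)%E by exact: pmeasM.
have mWe : pmeas (fun z => W z * emean (EFin \o Q) z (- r)%R)%E.
  by apply: pmeasM => //; exact: pmeas_emean.
have mQe : pmeas (fun z => (EFin \o Q) z * emean W z r)%E.
  by apply: pmeasM => //; exact: pmeas_emean.
have mkQ : pmeas (fun z => k%:E * (EFin \o Q) z)%E.
  by apply: pmeasM => //; exact: measurable_cst.
have WQ0 y : (0 <= W y * (Q y)%:E)%E by exact: mule_ge0.
have WG0 y : (0 <= W y * (G y)%:E)%E by exact: mule_ge0.
have WH0 y : (0 <= W y * (H y)%:E)%E by exact: mule_ge0.
have We0 y : (0 <= W y * emean (EFin \o Q) y (- r)%R)%E by exact: mule_ge0.
have Qe0 y : (0 <= (EFin \o Q) y * emean W y r)%E by apply: mule_ge0; [exact: Q0'|].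
have kQ0 y : (0 <= k%:E * (EFin \o Q) y)%E by apply: mule_ge0 => //; exact: Q0'.
have le1 : (a + h <= b + g)%E.
  rewrite /a /h /b /g -!int2D//; apply: le_int2 => [||y|y].
  - exact: pmeasD.
  - exact: pmeasD.
  - exact: adde_ge0.
  rewrite -!ge0_muleDr//.
  have [->|Wy] := eqVneq (W y) 0%E; first by rewrite !mul0e.
  by rewrite -EFinD lee_wpmul2l//; exact: Qsub.
have le2 : (b + k%:E * int2 (EFin \o Q) <= a)%E.
  rewrite /b int2_emean_swap// -int2Z// -int2D//; apply: le_int2 => [||y|y].
  - exact: pmeasD.
  - exact: mWQ.
  - exact: adde_ge0.
  rewrite [X in (_ + X)%E]muleC -ge0_muleDr// [leRHS]muleC.
  have [Qy|Qy] := eqVneq (Q y) 0%R; first by rewrite /= Qy !(mule0, mul0e).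
  by apply: lee_wpmul2l; [exact: Q0'|exact: Wsup].
have a0 : (0 <= a)%E by apply: int2_ge0 => y; exact: mule_ge0.
(* [a] stands on both sides of the combined inequality and is cancelled because it is finite. *)
have afin : a \is a fin_num by rewrite ge0_fin_numE.
rewrite -(leeD2lE _ _ afin) addeA (addeAC a) (le_trans (leeD le1 (le_refl _)))//.
by rewrite addeAC leeD2r.
Qed.

(* [g] may take negative values, so the left-hand integral is split into its
   positive and negative parts. *)
Lemma avg_le_emean W z r g : pmeas W -> (forall y, 0 <= W y)%E -> continuous g ->
  (forall t, (g t)%:E <= W (z + r%:C * expi t)%R)%E -> ((avg g)%:E <= emean W z r)%E.
Proof.
move=> mW W0 cg gW; rewrite /avg /emean EFinM.
apply: lee_wpmul2l; first by rewrite lee_fin invr_ge0 ltW// pi2_gt0.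
have ig := itg_integrable 0 (2 * pi) cg.
rewrite /itg /Rintegral fineK; last exact: integrable_fin_num.
rewrite integralE; apply: (@le_trans _ _ (\int[mu]_(t in `[0%R, (2 * pi)%R]) (EFin \o g)^\+ t)%E).
  by apply: geeDl; rewrite leeNl oppe0; exact: integral_ge0.
have mW' := pmeas_ball r z mW.
apply: ge0_le_integral => //.
- apply: measurable_funepos; exact: measurable_int ig.
- exact: measurable_funTS.
- move=> t _; rewrite funeposE ge_max W0 andbT; exact: gW.
Qed.
End TestLemma.

(** * Integrability and boundary decay of superharmonic weights *)

Section Superharmonic.
Variable R : realType.
Local Notation C := R[i].
Local Notation mu := (@lebesgue_measure R).
Local Notation mu2 := (mu \x mu)%E.
Implicit Types (W w : C -> \bar R) (z : C).

(** The hypotheses on the weight after extension by 0 to the plane. [sw_out] turns plane integrals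
    of w into integrals over the disk. *)
Record sup_weight w : Prop := {
  sw_ge0 : forall z, (0 <= w z)%E;
  sw_gt0 : forall z, normc z < 1 -> (0 < w z)%E;
  sw_lsc : forall z a, normc z < 1 -> (a%:E < w z)%E ->
    exists2 e, 0 < e & forall y, normc (y - z) < e -> (a%:E < w y)%E;
  sw_mean : forall z r, 0 < r -> normc z + r < 1 -> (emean w z r <= w z)%E;
  sw_fin : exists2 z, normc z < 1 & (w z < +oo)%E;
  sw_out : forall z, 1 <= normc z -> w z = 0%E }.

Lemma rmeas_open (P : C -> bool) :
  (forall z, P z -> exists2 e, 0 < e & forall y, normc (y - z) < e -> P y) ->
  rmeas (fun z => (P z)%:R).
Proof.
move=> HP; have mA := @copen_measurable R [set z | P z] HP.
apply/measurable_EFinP.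
have : measurable_fun setT (\1_(@toC R @^-1` [set z | P z]) : R * R -> R).
  exact: measurable_indic.
apply: eq_measurable_fun => p _; rewrite indicE (_ : (p \in _) = P (toC p))//.
by apply/idP/idP; rewrite inE.
Qed.

Lemma rmeas_ball z (r : R) : rmeas (fun y => (normc (y - z) < r)%R%:R).
Proof.
apply: rmeas_open => y yr; exists (r - normc (y - z)); first by lra.
move=> u ur; have := le_normcBD (u - z) (y - z).
by rewrite opprB addrA subrK; lra.
Qed.

Lemma rmeas_disk (r : R) : rmeas (fun y => (normc y < r)%R%:R).
Proof. by have := rmeas_ball 0 r; under eq_fun do rewrite subr0. Qed.

Lemma pmeas_disk W r : measurable_fun (cdisk r) (fun p => W (toC p)) ->
  (forall z, r <= normc z -> W z = 0%E) -> pmeas W.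
Proof.
move=> mW W0; have mD := measurable_cdisk r.
have := (measurable_restrictT _ mD).1 mW; apply: eq_measurable_fun => p _.
rewrite patchE; case: ifPn => //; rewrite notin_setE => pr.
by rewrite W0// leNgt; apply/negP.
Qed.

Lemma sw_pmeas w : sup_weight w -> pmeas w.
Proof.
move=> sw; apply: (@pmeas_disk w 1); last by move=> z; exact: sw_out.
by apply: measurable_lsc => z a z1 az; exact: sw_lsc az.
Qed.

Lemma int2_square_lty (r : R) : (int2 (fun z => ((normc z < r)%R%:R)%:E : \bar R) < +oo)%E.
Proof.
pose J : set R := `]- r, r[%classic.
have mJ : measurable (J `*` J) by apply: measurableX; exact: measurable_itv.
apply: (@le_lt_trans _ _ (\int[mu2]_p (\1_(J `*` J) p)%:E)%E).
  apply: ge0_le_integral => //.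
  - exact: rmeas_disk.
  - by apply/measurable_EFinP; exact: measurable_indic.
  - move=> p _; rewrite lee_fin indicE; case: ltP => [pr|] //=.
    rewrite mem_set//; split; rewrite /J /= in_itv/= -ltr_norml;
      apply: le_lt_trans pr; [exact: (normr_Re (toC p))|exact: (normr_Im (toC p))].
have E : (mu2 (J `*` J) < +oo)%E.
  rewrite product_measure1E; try exact: measurable_itv.
  rewrite /= lebesgue_measure_itv/=; case: ifP => _; last by rewrite mule0.
  by rewrite -EFinM ltry.
by rewrite integral_indic// setIT.
Qed.

Lemma int2_square_gt0 z (r : R) : 0 < r ->
  (0 < int2 (fun y => ((normc (y - z) < r)%R%:R)%:E : \bar R))%E.
Proof.
move=> r0; pose J (x : R) : set R := `]x - r / 2, x + r / 2[%classic.
have mJ : measurable (J (Re z) `*` J (Im z)) by apply: measurableX; exact: measurable_itv.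
apply: (@lt_le_trans _ _ (\int[mu2]_p (\1_(J (Re z) `*` J (Im z)) p)%:E)%E); last first.
  apply: ge0_le_integral => //.
  - by apply/measurable_EFinP; exact: measurable_indic.
  - exact: rmeas_ball.
  - move=> p _; rewrite lee_fin indicE; case: (boolP (p \in _)) => //.
    rewrite inE => -[]; rewrite /J /= !in_itv/= => /andP[h1 h2] /andP[h3 h4].
    rewrite (le_lt_trans (normc_le _))//= cReD cReN cImD cImN /=.
    have h5 : `|p.1 - Re z| < r / 2 by rewrite ltr_norml; lra.
    have h6 : `|p.2 - Im z| < r / 2 by rewrite ltr_norml; lra.
    lra.
have E : (0 < mu2 (J (Re z) `*` J (Im z)))%E.
  rewrite product_measure1E; try exact: measurable_itv.
  rewrite /= !lebesgue_measure_itv/= !lte_fin.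
  have lt (x : R) : x - r / 2 < x + r / 2 by lra.
  by rewrite !lt -!EFinD -EFinM lte_fin; apply: mulr_gt0; lra.
by rewrite integral_indic// setIT.
Qed.

Lemma int2_rot W t : pmeas W -> (forall y, 0 <= W y)%E ->
  int2 (fun z => W (expi t * z)) = int2 W.
Proof.
move=> mW W0; rewrite /int2 -(integral2_rotation (cos2Dsin2 t) mW (fun p => W0 _)).
by apply: eq_integral => p _; congr W; apply: complex_ext => /=; ring.
Qed.

Let I : set R := `[0, 2 * pi]%classic.

Lemma expiD a b : expi (a + b) = expi a * expi b :> C.
Proof. by apply: complex_ext; rewrite /= ?cosD ?sinD; ring. Qed.

Lemma polar z : exists2 a, 0 <= a <= 2 * pi & z = (normc z)%:C * expi a.
Proof.
have pi0 := pi_gt0 R.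
have [->|z0] := eqVneq z 0.
  by exists 0; [rewrite lexx mulr_ge0// ltW|rewrite normc0 mul0r].
have nz : 0 < normc z by rewrite normc_gt0.
pose x := Re z / normc z; pose y := Im z / normc z.
have xy : x ^+ 2 + y ^+ 2 = 1.
  by rewrite /x /y !expr_div_n -mulrDl -normc_sqr mulfV// gt_eqF// exprn_gt0.
have x1 : -1 <= x <= 1.
  by rewrite -ler_norml -(ler_pXn2r (n := 2))// ?nnegrE// expr1n real_normK ?num_real//;
    have := sqr_ge0 y; lra.
have [/andP[a0 api] ca] := acos_def x1.
have sa : sin (acos x) = `|y|.
  rewrite sin_acos// (_ : 1 - x ^+ 2 = y ^+ 2) ?sqrtr_sqr//; lra.
have zE a : cos a = x -> sin a = y -> z = (normc z)%:C * expi a.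
  move=> cx sy; apply: complex_ext; rewrite ?Re_mulrC ?Im_mulrC /= ?cx ?sy /x /y mulrC divfK//;
    by rewrite gt_eqF.
have [y0|y0] := leP 0 y.
  by exists (acos x); [lra|apply: zE; rewrite // sa ger0_norm].
exists (2 * pi - acos x); first by lra.
have e : 2 * pi - acos x = pi *+ 2 - acos x :> R by rewrite mulr_natl.
by apply: zE; rewrite e addrC ?cosD2pi ?sinD2pi ?cosN ?sinN// sa ltr0_norm// opprK.
Qed.

(** [a, a + 2 pi] is covered by [0, 2 pi] and its translate by 2 pi. The resulting factor 2 is
    harmless where only finiteness is sought. *)
Lemma periodic_shift (g : R -> \bar R) a : 0 <= a <= 2 * pi -> measurable_fun setT g ->
  (forall t, 0 <= g t)%E -> (forall t, g (t + 2 * pi) = g t) ->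
  (\int[mu]_(t in I) g (t + a)%R <= 2%:E * \int[mu]_(t in I) g t)%E.
Proof.
move=> /andP[a0 a2] mg g0 per; have p0 := pi2_gt0 R.
have mI : measurable I by exact: measurable_itv.
have indg (f : R -> \bar R) : (\int[mu]_(t in I) f t = \int[mu]_t (f t * (\1_I t)%:E))%E.
  rewrite integral_mkcond; apply: eq_integral => t _; rewrite patchE indicE.
  by case: ifPn; rewrite ?mule1 ?mule0.
have i0 t : (0 <= (\1_I t)%:E :> \bar R)%E by rewrite lee_fin indicE.
have mi b : measurable_fun setT (fun t : R => (\1_I (t + b))%:E : \bar R).
  apply/measurable_EFinP; apply: measurableT_comp; first exact: measurable_indic.
  by apply: measurable_funD; [exact: measurable_id|exact: measurable_cst].
have mgb b : measurable_fun setT (fun t : R => g (t + b)).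
  apply: measurableT_comp => //.
  by apply: measurable_funD; [exact: measurable_id|exact: measurable_cst].
have mg1 b : measurable_fun setT (fun t : R => g t * (\1_I (t + b))%:E)%E.
  exact: emeasurable_funM.
have e1 : (\int[mu]_(t in I) g (t + a)%R = \int[mu]_t (g t * (\1_I (t - a)%R)%:E))%E.
  rewrite indg -(integral_shift a (mg1 (- a)))//; last by move=> t; exact: mule_ge0.
  by apply: eq_integral => t _; rewrite addrK.
have e2 : (\int[mu]_(t in I) g t = \int[mu]_t (g t * (\1_I (t - 2 * pi)%R)%:E))%E.
  rewrite indg -(integral_shift (2 * pi) (mg1 (- (2 * pi))))//; last by move=> t; exact: mule_ge0.
  by apply: eq_integral => t _; rewrite addrK per.
have mg10 : measurable_fun setT (fun t : R => g t * (\1_I t)%:E)%E.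
  by apply: emeasurable_funM => //; apply/measurable_EFinP; exact: measurable_indic.
have two (x : \bar R) : (2%:E * x = x + x)%E by rewrite mule_natl mule2n.
rewrite e1 two.
rewrite {2}e2 indg -ge0_integralD//; try by move=> t _; exact: mule_ge0.
  2: exact: (mg1 (- (2 * pi))).
apply: ge0_le_integral => //; try by move=> t _; rewrite ?adde_ge0// mule_ge0.
- exact: mg1.
- by apply: emeasurable_funD => //; exact: mg1.
move=> t _; rewrite -ge0_muleDr// lee_wpmul2l// -EFinD lee_fin !indicE.
have [h|] := boolP ((t - a)%R \in I); last by rewrite addr_ge0.
rewrite inE /I /= in_itv/= in h.
have [h1|h1] := leP t (2 * pi).
  have tI : t \in I by rewrite inE /I /= in_itv/=; lra.
  by rewrite tI lerDl.
have tI : t - 2 * pi \in I by rewrite inE /I /= in_itv/=; lra.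
by rewrite tI lerDr.
Qed.

End Superharmonic.

(** * Integrability of the weight on balls *)

Section BallIntegrability.
Variable R : realType.
Local Notation C := R[i].
Local Notation mu := (@lebesgue_measure R).
Local Notation mu2 := (mu \x mu)%E.
Implicit Types (W w V : C -> \bar R) (z : C).

Let I : set R := `[0, 2 * pi]%classic.

Let muI : mu I = (2 * pi)%:E.
Proof. by rewrite /I lebesgue_measure_itv/= lte_fin pi2_gt0 -EFinD subr0. Qed.

Let F V (x : (R * R) * R) := (V (expi x.2 * toC x.1)%R * (\1_I x.2)%:E)%E.

Let F_ge0 V x : (forall y, 0 <= V y)%E -> (0 <= F V x)%E.
Proof. by move=> V0; rewrite mule_ge0// lee_fin indicE. Qed.

Let F_measurable V : pmeas V -> measurable_fun setT (F V).
Proof.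
move=> mV; have mI : measurable I by exact: measurable_itv.
have mi : measurable_fun setT (fun t : R => (\1_I t)%:E : \bar R).
  by apply/measurable_EFinP; exact: measurable_indic.
apply: emeasurable_funM; last exact: (measurableT_comp mi measurable_snd).
have m1 : measurable_fun setT (fun x : (R * R) * R => x.1.1).
  exact: measurableT_comp measurable_fst measurable_fst.
have m2 : measurable_fun setT (fun x : (R * R) * R => x.1.2).
  exact: measurableT_comp measurable_snd measurable_fst.
have mc : measurable_fun setT (fun x : (R * R) * R => cos x.2).
  apply: measurableT_comp measurable_snd; apply: continuous_measurable_fun.
  exact: continuous_cos.
have ms : measurable_fun setT (fun x : (R * R) * R => sin x.2).
  apply: measurableT_comp measurable_snd; apply: continuous_measurable_fun.
  exact: continuous_sin.
have mT : measurable_fun setT (fun x : (R * R) * R =>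
    (cos x.2 * x.1.1 - sin x.2 * x.1.2, cos x.2 * x.1.2 + sin x.2 * x.1.1)).
  by apply: measurable_fun_pair; [apply: measurable_funB|apply: measurable_funD];
    apply: measurable_funM.
exact: measurableT_comp mV mT.
Qed.

Let F_integral V p : (\int[mu]_t F V (p, t) = \int[mu]_(t in I) V (expi t * toC p)%R)%E.
Proof.
rewrite [RHS]integral_mkcond; apply: eq_integral => t _.
by rewrite /F/= patchE indicE; case: ifP => _; rewrite ?mule1 ?mule0.
Qed.

Lemma pmeas_rot_avg V : pmeas V -> (forall y, 0 <= V y)%E ->
  pmeas (fun z => \int[mu]_(t in I) V (expi t * z)%R)%E.
Proof.
move=> mV V0; have := @measurable_fun_fubini_tonelli_F _ _ _ _ R mu (F V)
  (F_measurable mV) (fun x => F_ge0 x V0).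
by apply: eq_measurable_fun => p _; exact: F_integral.
Qed.

(** A substitute for polar coordinates: rotations preserve the area integral, and Tonelli exchanges
    it with the integral over the angle. *)
Lemma int2_rot_avg V : pmeas V -> (forall y, 0 <= V y)%E ->
  ((2 * pi)%:E * int2 V = int2 (fun z => \int[mu]_(t in I) V (expi t * z)%R))%E.
Proof.
move=> mV V0; have mI : measurable I by exact: measurable_itv.
have i0 t : (0 <= (\1_I t)%:E :> \bar R)%E by rewrite lee_fin indicE.
have mi : measurable_fun setT (fun t : R => (\1_I t)%:E : \bar R).
  by apply/measurable_EFinP; exact: measurable_indic.
have mF := F_measurable mV.
have Ft t : (\int[mu2]_p F V (p, t) = int2 V * (\1_I t)%:E)%E.
  rewrite /F/= ge0_integralZr//.
  - by congr (_ * _)%E; exact: int2_rot.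
  - have := measurableT_comp mF (pair2_measurable t); rewrite /F/=.
    have mT : measurable_fun setT (fun p : R * R =>
      (cos t * p.1 + (- sin t) * p.2, sin t * p.1 + cos t * p.2)).
      by apply: measurable_fun_pair; exact: measurable_linear.
    move=> _; have := measurableT_comp mV mT; apply: eq_measurable_fun => p _.
    by congr V; apply: complex_ext => /=; ring.
have e1 : (\int[mu]_t \int[mu2]_p F V (p, t) = (2 * pi)%:E * int2 V)%E.
  under eq_integral do rewrite Ft.
  rewrite ge0_integralZl//; last exact: int2_ge0.
  rewrite integral_indic// setIT muleC; congr (_ * _)%E.
  exact: muI.
rewrite -e1 -(@fubini_tonelli _ _ _ _ R (plane_measure R) mu (F V) mF (fun x => F_ge0 x V0)).
by apply: eq_integral => p _; rewrite F_integral.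
Qed.

(** After averaging over rotations about z0, the integrand at each point is a circular integral of w
    about z0. The mean inequality bounds it by a multiple of w(z0), the 2 coming from
    [periodic_shift]. *)
Lemma sw_ball_lty w z0 (r : R) : sup_weight w -> 0 < r -> normc z0 + r < 1 -> (w z0 < +oo)%E ->
  (int2 (fun y => w y * ((normc (y - z0) < r)%R%:R)%:E) < +oo)%E.
Proof.
move=> sw r0 zr wz; set W := (fun y => _).
have mI : measurable I by exact: measurable_itv.
have w0 := sw_ge0 sw; have mw := sw_pmeas sw.
have b0 b : (0 <= (b%:R)%:E :> \bar R)%E by rewrite lee_fin.
have W0 y : (0 <= W y)%E by exact: mule_ge0.
have mW : pmeas W by apply: pmeasM => //; exact: rmeas_ball.
pose V y := W (y + z0).
have mV : pmeas V.
  have mT : measurable_fun setT (fun p : R * R => (p.1 + Re z0, p.2 + Im z0)).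
    by apply: measurable_fun_pair; apply: measurable_funD.
  have := measurableT_comp mW mT; apply: eq_measurable_fun => p _ /=.
  by congr W; apply: complex_ext; rewrite ?cReD ?cImD.
rewrite -(int2_shift z0 mW W0) -/V.
have V0 y : (0 <= V y)%E by exact: W0.
have p0 := pi2_gt0 R.
suff : ((2 * pi)%:E * int2 V < +oo)%E.
  have := int2_ge0 V0; case: (int2 V) => [a _ _|_|//]; first exact: ltry.
  by rewrite gt0_muley ?lte_fin.
rewrite int2_rot_avg//.
have pt z : (\int[mu]_(t in I) V (expi t * z)%R <=
    (2%:E * ((2 * pi)%:E * w z0)) * ((normc z < r)%R%:R)%:E)%E.
  have [zr1|zr1] /= := ltP (normc z) r; last first.
    rewrite mule0 integral0_eq// => t _; rewrite /V /W addrK normcM normc_expi mul1r.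
    by rewrite ltNge zr1 mule0.
  rewrite mule1; have [a a2 za] := polar z.
  set n := normc z in zr1 za.
  pose g t := w (z0 + n%:C * expi t).
  have -> : (\int[mu]_(t in I) V (expi t * z)%R = \int[mu]_(t in I) g (t + a)%R)%E.
    apply: eq_integral => t _; rewrite /V /W addrK normcM normc_expi mul1r -/n zr1 mule1.
    by rewrite /g expiD; congr w; rewrite {1}za; ring.
  have mg : measurable_fun setT g by exact: pmeas_ball.
  have per t : g (t + 2 * pi) = g t.
    by rewrite /g /expi mulr_natl cosD2pi sinD2pi.
  apply: le_trans (periodic_shift a2 mg (fun t => w0 _) per) _.
  rewrite lee_pmul2l//.
  have n0 : 0 <= n by exact: normc_ge0.
  have [n0'|n0'] := eqVneq n 0.
    rewrite /g n0'; under eq_integral do rewrite mul0r addr0.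
    rewrite integral_cst// muleC; apply: lee_wpmul2r; first exact: w0.
    by rewrite [X in (X <= _)%E]muI.
  have := sw_mean sw (z := z0) (r := n); rewrite lt_neqAle eq_sym n0' n0 => /(_ isT).
  have h : normc z0 + n < 1 by lra.
  move=> /(_ h); rewrite /emean -(@lee_pmul2l _ (2 * pi)%:E) ?lte_fin//.
  by rewrite muleA -EFinM mulfV ?mul1e// gt_eqF.
apply: (@le_lt_trans _ _ (int2 (fun z => (2%:E * ((2 * pi)%:E * w z0)) * ((normc z < r)%R%:R)%:E)%E)).
  apply: le_int2 => [||y|y].
  - exact: pmeas_rot_avg.
  - by apply: emeasurable_funM; [exact: measurable_cst|exact: rmeas_disk].
  - exact: integral_ge0.
  - exact: pt.
rewrite /int2 ge0_integralZl//; last 2 first.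
- exact: rmeas_disk.
- by rewrite mule_ge0// mule_ge0// lee_fin ltW.
apply: lte_mul_pinfty.
- by rewrite mule_ge0// mule_ge0// lee_fin ltW.
- rewrite ge0_fin_numE; last by rewrite mule_ge0// mule_ge0// lee_fin ltW.
  apply: lte_mul_pinfty => //.
  by apply: lte_mul_pinfty => //; rewrite lee_fin ltW.
exact: int2_square_lty.
Qed.
End BallIntegrability.

(** * Local integrability and explicit circular means *)

Section LocalIntegrability.
Variable R : realType.
Local Notation C := R[i].
Local Notation mu := (@lebesgue_measure R).
Local Notation mu2 := (mu \x mu)%E.
Implicit Types (W w V : C -> \bar R) (z : C).

(** A ball inside the unit disk contains a given smaller disk about 0 only if its centre is near 0,
    so a finite value is needed there. Let S > 0 be the infimum of |z| over the points with w(z)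
    finite. A ball of integrability about such a point with |z| close to S would overlap |y| < S,
    where w is infinite, in an open set. *)
Lemma sw_near0 w (e : R) : sup_weight w -> 0 < e ->
  exists z, [/\ normc z < e, normc z < 1 & (w z < +oo)%E].
Proof.
move=> sw e0; apply: contrapT => none.
have far z : normc z < 1 -> (w z < +oo)%E -> e <= normc z.
  by move=> z1 wz; rewrite leNgt; apply/negP => ze; apply: none; exists z.
pose A : set R := [set x | exists z, [/\ normc z < 1, (w z < +oo)%E & x = normc z]].
have Ae x : A x -> e <= x by move=> [z [z1 wz ->]]; exact: far.
have [zf zf1 wzf] := sw_fin sw.
have A0 : A !=set0 by exists (normc zf), zf.
have Alb : has_inf A by split => //; exists e.
pose S := inf A.
have eS : e <= S by apply: lb_le_inf.
have SA x : A x -> S <= x by move=> Ax; apply: ge_inf => //; exists e.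
have S1 : S < 1 by apply: (le_lt_trans _ zf1); apply: SA; exists zf.
(* With this margin, moving z0 by at most rho/2 towards 0 enters |y| < S with eta to spare. *)
have d0 : 0 < (1 - S) / 8 by lra.
have [_ [z0 [z01 wz0 ->]] z0S] := inf_adherent d0 Alb.
rewrite -/S in z0S; set n := normc z0 in z01 z0S.
have Sn : S <= n by apply: SA; exists z0.
pose rho := (1 - n) / 2.
have rho0 : 0 < rho by rewrite /rho; lra.
have zr : normc z0 + rho < 1 by rewrite -/n /rho; lra.
have := sw_ball_lty sw rho0 zr wz0.
pose c := Num.max 0 (1 - rho / (2 * n)).
pose eta := Num.min (rho / 8) (S / 2).
have eta0 : 0 < eta by rewrite /eta lt_min; apply/andP; split; lra.
have n0 : 0 < n by lra.
have rn : rho / (2 * n) * n = rho / 2 by field; lra.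
have c01 : 0 <= c <= 1.
  by rewrite /c le_max lexx ge_max ler01/= gerBl divr_ge0//; lra.
have c1 : (1 - c) * n <= rho / 2.
  rewrite -rn; apply: ler_wpM2r; first exact: ltW.
  by rewrite lerBlDr addrC -lerBlDr /c le_max lexx orbT.
have cn : c * n + eta < S.
  have e1 : eta <= rho / 8 by rewrite /eta ge_min lexx.
  have e2 : eta <= S / 2 by rewrite /eta ge_min lexx orbT.
  rewrite /c; case: (leP 0 (1 - rho / (2 * n))) => _.
    by rewrite mulrBl mul1r rn; move: e1 z0S; rewrite /rho; lra.
  by rewrite mul0r; lra.
set z1 := c%:C * z0.
have inf_w y : normc (y - z1) < eta -> w y = +oo%E.
  move=> yz; have yS : normc y < S.
    have := le_normcBD y z1; rewrite normcM normc_real ger0_norm; last by case/andP: c01.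
    by rewrite -/n; lra.
  apply: contrapT => wy; have := SA (normc y); rewrite leNgt yS => /(_ _)/negP; apply => //.
  by exists y; split; [lra|rewrite ltey; apply/eqP|].
apply/negP; rewrite -leNgt.
apply: (@le_trans _ _ (int2 (fun y => +oo * ((normc (y - z1) < eta)%R%:R)%:E)%E)).
  rewrite int2Z//; [|exact: rmeas_ball].
  by rewrite gt0_mulye// int2_square_gt0.
apply: le_int2 => [||y|y].
- by apply: pmeasM; [exact: measurable_cst|exact: rmeas_ball].
- by apply: pmeasM; [exact: sw_pmeas|exact: rmeas_ball].
- exact: mule_ge0.
have [yz|yz] /= := ltP (normc (y - z1)) eta; last first.
  by rewrite mule0; apply: mule_ge0; [exact: sw_ge0|rewrite lee_fin].
rewrite inf_w// (_ : normc (y - z0) < rho) //.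
have -> : y - z0 = (y - z1) - (1 - c)%:C * z0 by rewrite /z1 rmorphB rmorph1/=; ring.
apply: le_lt_trans (le_normcB _ _) _; rewrite normcM normc_real -/n.
have e1 : eta <= rho / 8 by rewrite /eta ge_min lexx.
by rewrite ger0_norm; lra.
Qed.

Lemma sw_loc w (s : R) : sup_weight w -> s < 1 ->
  (int2 (fun y => w y * ((normc y < s)%R%:R)%:E) < +oo)%E.
Proof.
move=> sw s1; pose s' := Num.max s (1 / 2).
have ss' : s <= s' by rewrite /s' le_max lexx.
have s'1 : 1 / 2 <= s' < 1 by rewrite /s' le_max lexx orbT gt_max s1; lra.
have [|z [ze z1 wz]] := sw_near0 (e := (1 - s') / 4) sw; first by lra.
have r0 : 0 < s' + (1 - s') / 4 by lra.
have zr : normc z + (s' + (1 - s') / 4) < 1 by lra.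
apply: le_lt_trans (sw_ball_lty sw r0 zr wz).
have b0 (b : bool) : (0 <= (b%:R)%:E :> \bar R)%E by rewrite lee_fin.
apply: le_int2 => [||y|y].
- by apply: pmeasM; [exact: sw_pmeas|exact: rmeas_disk].
- by apply: pmeasM; [exact: sw_pmeas|exact: rmeas_ball].
- by apply: mule_ge0 => //; exact: sw_ge0.
have [ys|ys] /= := ltP (normc y) s; last first.
  by rewrite mule0; apply: mule_ge0; [exact: sw_ge0|exact: b0].
rewrite (_ : normc (y - z) < s' + (1 - s') / 4) //.
by have := le_normcB y z; lra.
Qed.

Lemma avg_Re_expi (c : C) : avg (fun t => Re (c * expi t)) = 0.
Proof.
have Hf : hol 2 (fun w : C => c * w) by apply: holM; [exact: hol_cst|exact: hol_id].
have h : normc (0 : C) + 1 < 2 by rewrite normc0; lra.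
have := mean_valueN Hf ltr01 h => /(congr1 (@complex.Re R)); rewrite mulr0 /=.
have cc : ccont (fun t => c * expi t) by apply: ccontM; [exact: ccont_cst|exact: ccont_expi].
have -> : avg (fun t => Re (c * (0 - 1%:C * expi t))) = avg (fun t => -1 * Re (c * expi t)).
  by apply: eq_avg => t; rewrite mul1r sub0r mulrN cReN mulN1r.
by rewrite avgZ; [lra|exact: ccont_Re].
Qed.

Lemma avg_Re_expi_sqr (c : C) : avg (fun t => Re (c * expi t) ^+ 2) = normc c ^+ 2 / 2.
Proof.
have cc : ccont (fun t => c * expi t) by apply: ccontM; [exact: ccont_cst|exact: ccont_expi].
have cc2 : ccont (fun t => (c * expi t) ^+ 2).
  by under eq_fun do rewrite expr2; exact: ccontM.
have e2 : avg (fun t => Re ((c * expi t) ^+ 2)) = 0.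
  have Hf : hol 2 (fun w : C => c * w) by apply: holM; [exact: hol_cst|exact: hol_id].
  have h : normc (0 : C) + 1 < 2 by rewrite normc0; lra.
  have := mean_valueN (holM Hf Hf) ltr01 h => /(congr1 (@complex.Re R)).
  rewrite mulr0 mulr0 /= => <-; apply: eq_avg => t.
  by congr Re; ring.
have -> : (fun t => Re (c * expi t) ^+ 2) =
    (fun t => 2^-1 * Re ((c * expi t) ^+ 2) + normc c ^+ 2 / 2).
  apply/funext => t.
  have -> : normc c = normc (c * expi t) by rewrite normcM normc_expi mulr1.
  rewrite normc_sqr.
  by case: (c * expi t) => a b /=; field.
have cR := ccont_Re cc2.
rewrite avgD; [|by apply: cont_mul => //; exact: cont_cst|exact: cont_cst].
by rewrite avg_cst avgZ// e2 mulr0 add0r.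
Qed.

Lemma sqr_circle z (r t : R) : normc (z - r%:C * expi t) ^+ 2 =
  normc z ^+ 2 + r ^+ 2 - 2 * r * Re (z^*%C * expi t).
Proof.
rewrite !normc_sqr; have := cos2Dsin2 t; case: z => a b /=.
move: (cos t) (sin t) => x y h.
transitivity (a ^+ 2 + b ^+ 2 + r ^+ 2 * (x ^+ 2 + y ^+ 2) - 2 * r * (a * x + b * y)).
  by ring.
by rewrite h; ring.
Qed.

Lemma cont_Re_expi (c : C) : continuous (fun t => Re (c * expi t)).
Proof. by apply: ccont_Re; apply: ccontM; [exact: ccont_cst|exact: ccont_expi]. Qed.

Lemma cont_sqr_circle z (r : R) : continuous (fun t => normc (z - r%:C * expi t) ^+ 2).
Proof.
under eq_fun do rewrite sqr_circle.
by apply: cont_sub; [exact: cont_cst|apply: cont_mul; [exact: cont_cst|exact: cont_Re_expi]].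
Qed.

Lemma avg_sqr_circle z (r : R) : avg (fun t => normc (z - r%:C * expi t) ^+ 2) =
  normc z ^+ 2 + r ^+ 2.
Proof.
under eq_avg do rewrite sqr_circle.
have cR := @cont_Re_expi z^*%C.
rewrite avgB; [|exact: cont_cst|by apply: cont_mul => //; exact: cont_cst].
by rewrite avg_cst avgZ// avg_Re_expi mulr0 subr0.
Qed.

(** The excess over (1 - |z|^2)^2 is r^2 (4 |z|^2 - 2) + r^4. This computation underlies both
    [shell_bound] and the barrier of [hopf]. *)
Lemma avg_sqr_circle2 z (r : R) : avg (fun t => (1 - normc (z - r%:C * expi t) ^+ 2) ^+ 2) =
  (1 - normc z ^+ 2 - r ^+ 2) ^+ 2 + 2 * r ^+ 2 * normc z ^+ 2.
Proof.
set A := 1 - _ - _; have cR := @cont_Re_expi z^*%C.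
have -> : (fun t => (1 - normc (z - r%:C * expi t) ^+ 2) ^+ 2) =
    (fun t => (A ^+ 2 + 4 * A * r * Re (z^*%C * expi t)) +
      4 * r ^+ 2 * Re (z^*%C * expi t) ^+ 2).
  by apply/funext => t; rewrite sqr_circle /A; ring.
have cR2 : continuous (fun t => Re (z^*%C * expi t) ^+ 2).
  by under eq_fun do rewrite expr2; exact: cont_mul.
have c1 : continuous (fun t => 4 * A * r * Re (z^*%C * expi t)).
  by apply: cont_mul => //; exact: cont_cst.
have c2 : continuous (fun t => 4 * r ^+ 2 * Re (z^*%C * expi t) ^+ 2).
  by apply: cont_mul => //; exact: cont_cst.
rewrite avgD//; last by apply: cont_add => //; exact: cont_cst.
rewrite avgD//; last exact: cont_cst.
by rewrite avg_cst !avgZ// avg_Re_expi avg_Re_expi_sqr normcJ'; field.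
Qed.

Lemma rmeas_sqr : rmeas (fun z => normc z ^+ 2).
Proof.
under eq_fun do rewrite normc_sqr.
apply/measurable_EFinP; apply: measurable_funD; apply: measurable_funX.
  exact: measurable_fst.
exact: measurable_snd.
Qed.

Lemma rmeasM (f g : C -> R) : rmeas f -> rmeas g -> rmeas (fun z => f z * g z).
Proof.
move=> /measurable_EFinP mf /measurable_EFinP mg; apply/measurable_EFinP.
exact: measurable_funM.
Qed.

Lemma rmeasD (f g : C -> R) : rmeas f -> rmeas g -> rmeas (fun z => f z + g z).
Proof.
move=> /measurable_EFinP mf /measurable_EFinP mg; apply/measurable_EFinP.
exact: measurable_funD.
Qed.

Lemma rmeas_cst (k : R) : rmeas (fun _ : C => k).
Proof. by apply/measurable_EFinP; exact: measurable_cst. Qed.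

Lemma rmeasB (f g : C -> R) : rmeas f -> rmeas g -> rmeas (fun z => f z - g z).
Proof.
move=> /measurable_EFinP mf /measurable_EFinP mg; apply/measurable_EFinP.
exact: measurable_funB.
Qed.

End LocalIntegrability.

(** * Integrability of the weight over the disk *)

Section Integrability.
Variable R : realType.
Local Notation C := R[i].
Local Notation mu := (@lebesgue_measure R).
Local Notation mu2 := (mu \x mu)%E.
Implicit Types (W w V : C -> \bar R) (z : C).

Definition shell (e : R) z : R := (normc z ^+ 2 < 1 - e)%R%:R.

Lemma rmeas_shell (e : R) : rmeas (shell e).
Proof.
apply: rmeas_open => z zr; have n0 := normc_ge0 z.
pose d := Num.min 1 ((1 - e - normc z ^+ 2) / (2 * normc z + 2)).
exists d; first by rewrite /d lt_min ltr01 divr_gt0//; lra.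
move=> y; rewrite /d lt_min => /andP[h1]; rewrite ltr_pdivlMr; last lra.
move=> h2; have h3 := le_normcBD y z; have := normc_ge0 y; have := normc_ge0 (y - z); nra.
Qed.

(* The test function is [((1 - x)^2 - e^2)_+ 1_{x < 1 - e}], [x = |z|^2]. *)
Lemma shell_bound w (e : R) : sup_weight w -> 0 < e < 1 ->
  (int2 (fun z => w z * (shell e z)%:E) <=
   3%:E * int2 (fun z => w z * ((normc z < 9 / 10)%R%:R)%:E))%E.
Proof.
move=> sw /andP[e0 e1]; have w0 := sw_ge0 sw; have mw := sw_pmeas sw.
pose r := e / 4; have r0 : 0 < r by rewrite /r; lra.
pose S := shell e; have S01 z : S z = 0 \/ S z = 1 /\ normc z ^+ 2 < 1 - e.
  by rewrite /S /shell; case: ltP => _ /=; [right|left].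
have S0 z : 0 <= S z by rewrite /S /shell.
(* With x = |z|^2, the mean of (1 - x)^2 over a circle of radius r exceeds it by at least 4 r^2 x -
   2 r^2: [H] is the gain and [G] the loss. *)
pose Q z := S z * ((1 - normc z ^+ 2) ^+ 2 - e ^+ 2).
pose G z := 2 * r ^+ 2 * S z.
pose H z := 4 * r ^+ 2 * normc z ^+ 2 * S z.
have mS : rmeas S by exact: rmeas_shell.
have mx := @rmeas_sqr R.
have mQ : rmeas Q.
  apply: rmeasM => //; apply: rmeasB; last exact: rmeas_cst.
  have mq : rmeas (fun z => 1 - normc z ^+ 2) by apply: rmeasB => //; exact: rmeas_cst.
  exact: (rmeasM mq mq).
have mG : rmeas G by apply: rmeasM => //; exact: rmeas_cst.
have mH : rmeas H by apply: rmeasM => //; apply: rmeasM => //; exact: rmeas_cst.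
have Q0 z : 0 <= Q z.
  rewrite /Q; case: (S01 z) => [->|[-> h]]; first by rewrite mul0r.
  by rewrite mul1r; have := sqr_ge0 (normc z); nra.
have r2 : 0 < r ^+ 2 by rewrite exprn_gt0.
have G0 z : 0 <= G z by rewrite /G; have := S0 z; nra.
have H0 z : 0 <= H z.
  apply: mulr_ge0 => //; apply: mulr_ge0; last exact: sqr_ge0.
  by apply: mulr_ge0 => //; exact: ltW.
have Q1 z : Q z <= ((normc z < 1 - e / 2)%R%:R).
  rewrite /Q; case: (S01 z) => [->|[-> h]]; first by rewrite mul0r.
  have n0 := normc_ge0 z; have -> : normc z < 1 - e / 2 by nra.
  by rewrite mul1r /=; have := sqr_ge0 (normc z); nra.
have fin : (int2 (fun z => w z * (Q z)%:E) < +oo)%E.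
  have e2 : 1 - e / 2 < 1 by lra.
  apply: le_lt_trans (sw_loc sw e2); apply: le_int2 => [||y|y].
  - exact: pmeasM.
  - by apply: pmeasM => //; exact: rmeas_disk.
  - by apply: mule_ge0 => //; rewrite lee_fin.
  - by apply: lee_wpmul2l => //; rewrite lee_fin.
have sup z : (Q z != 0%R -> emean w z r + 0%:E <= w z)%E.
  move=> Qz; rewrite adde0; apply: (sw_mean sw) => //.
  case: (S01 z) => [Sz|[_ h]]; first by move: Qz; rewrite /Q Sz mul0r eqxx.
  by have := normc_ge0 z; rewrite /r; nra.
have sub z : (w z != 0%E -> (Q z + H z)%:E <= emean (EFin \o Q) z (- r)%R + (G z)%:E)%E.
  move=> _; have Q0' y : (0 <= (EFin \o Q) y)%E by rewrite lee_fin.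
  case: (S01 z) => [Sz|[Sz h]].
    by rewrite /Q /H /G Sz !mul0r !mulr0 addr0 adde0; exact: emean_ge0.
  pose g t := (1 - normc (z - r%:C * expi t) ^+ 2) ^+ 2 - e ^+ 2.
  have c1 : continuous (fun t => 1 - normc (z - r%:C * expi t) ^+ 2).
    by apply: cont_sub; [exact: cont_cst|exact: cont_sqr_circle].
  have c2 : continuous (fun t => (1 - normc (z - r%:C * expi t) ^+ 2) ^+ 2).
    by under eq_fun do rewrite expr2; exact: cont_mul.
  have cg : continuous g by apply: cont_sub => //; exact: cont_cst.
  (* The circle may leave the shell, where Q is 0. Since r = e/4, |y|^2 stays at most 1 + e, and
     then (1 - |y|^2)^2 <= e^2 makes g nonpositive there. *)
  have gQ t : ((g t)%:E <= (EFin \o Q) (z + (- r)%:C * expi t)%R)%E.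
    have -> : z + (- r)%:C * expi t = z - r%:C * expi t by rewrite rmorphN/= mulNr.
    rewrite lee_fin /g /Q; set y := z - _.
    have ny : normc y <= normc z + r.
      by apply: le_trans (le_normcB _ _) _; rewrite normcM normc_real normc_expi mulr1 gtr0_norm.
    rewrite /S /shell; case: ltP => /= hy; first by rewrite mul1r.
    rewrite mul0r; have y0 := normc_ge0 y; have n0 := normc_ge0 z.
    have n1 : normc z < 1 by nra.
    have h2 : normc y ^+ 2 <= (normc z + r) ^+ 2.
      by apply: lerXn2r => //; rewrite nnegrE; lra.
    have h3 : normc z * e <= e by nra.
    have h4 : normc y ^+ 2 <= 1 + e by move: h2; rewrite /r; nra.
    by nra.
  have := avg_le_emean (W := EFin \o Q) mQ Q0' cg gQ.
  have -> : avg g = (1 - normc z ^+ 2 - r ^+ 2) ^+ 2 + 2 * r ^+ 2 * normc z ^+ 2 - e ^+ 2.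
    by rewrite avgB ?avg_sqr_circle2 ?avg_cst//; exact: cont_cst.
  move=> h2; apply: le_trans (leeD h2 (lexx _)); rewrite -EFinD lee_fin.
  rewrite /Q /H /G Sz !mulr1 !mul1r; have := sqr_ge0 (r ^+ 2); nra.
have := @test_lemma R w Q G H r 0 mw w0 mQ mG mH Q0 G0 H0 (lexx _) sup sub fin.
rewrite mul0e add0e => HG.
pose D z : R := (normc z < 9 / 10)%R%:R.
have D0 z : 0 <= D z by rewrite /D.
have mD : rmeas D by exact: rmeas_disk.
set a := int2 (fun z => w z * (shell e z)%:E)%E; set m := int2 _.
have gE : int2 (fun z => w z * (G z)%:E)%E = ((2 * r ^+ 2)%:E * a)%E.
  rewrite /a -int2Z//; last by rewrite lee_fin mulr_ge0// ltW.
  - by congr int2; apply/funext => z; rewrite /G EFinM muleCA.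
  - exact: pmeasM.
  - by move=> y; apply: mule_ge0 => //; rewrite lee_fin; exact: S0.
have mE : int2 (fun z => w z * (3 * r ^+ 2 * D z)%:E)%E = ((3 * r ^+ 2)%:E * m)%E.
  rewrite /m -int2Z//; last by rewrite lee_fin mulr_ge0// ltW.
  - by congr int2; apply/funext => z; rewrite EFinM muleCA.
  - exact: pmeasM.
  - by move=> y; apply: mule_ge0 => //; rewrite lee_fin; exact: D0.
have aE : int2 (fun z => w z * (3 * r ^+ 2 * S z)%:E)%E = ((3 * r ^+ 2)%:E * a)%E.
  rewrite /a -int2Z//; last by rewrite lee_fin mulr_ge0// ltW.
  - by congr int2; apply/funext => z; rewrite EFinM muleCA.
  - exact: pmeasM.
  - by move=> y; apply: mule_ge0 => //; rewrite lee_fin; exact: S0.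
(* Off |z| < 9/10, |z|^2 > 3/4 and the gain H is at least 3 r^2. Thus 3 r^2 a <= 2 r^2 a + 3 r^2 m,
   which gives a <= 3 m independently of e. *)
have key : ((3 * r ^+ 2)%:E * a <= (2 * r ^+ 2)%:E * a + (3 * r ^+ 2)%:E * m)%E.
  rewrite -mE -aE -gE; apply: le_trans (leeD HG (lexx _)).
  have mHD : rmeas (fun z => 3 * r ^+ 2 * D z) by apply: rmeasM => //; exact: rmeas_cst.
  have mSr : rmeas (fun z => 3 * r ^+ 2 * S z) by apply: rmeasM => //; exact: rmeas_cst.
  have HD0 z : 0 <= 3 * r ^+ 2 * D z by rewrite mulr_ge0// mulr_ge0// ltW.
  rewrite -int2D; [|exact: pmeasM|exact: pmeasM|by move=> y; apply: mule_ge0 => //; rewrite lee_fin..].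
  apply: le_int2 => [||y|y].
  - exact: pmeasM.
  - by apply: pmeasD; exact: pmeasM.
  - by apply: mule_ge0 => //; rewrite lee_fin mulr_ge0// mulr_ge0// ltW.
  rewrite -ge0_muleDr ?lee_fin//; apply: lee_wpmul2l => //; rewrite -EFinD lee_fin.
  rewrite /H; case: (S01 y) => [->|[-> h]]; first by rewrite !mulr0 add0r.
  rewrite !mulr1 /D; case: ltP => /= hy; first by have := sqr_ge0 (normc y); nra.
  have : 3 / 4 <= normc y ^+ 2 by nra.
  by rewrite mulr0 addr0; nra.
have afin : a \is a fin_num.
  have e2 : 1 - e / 2 < 1 by lra.
  rewrite ge0_fin_numE; last first.
    by apply: int2_ge0 => y; apply: mule_ge0 => //; rewrite lee_fin; exact: S0.
  apply: le_lt_trans (sw_loc sw e2); apply: le_int2 => [||y|y].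
  - exact: pmeasM.
  - by apply: pmeasM => //; exact: rmeas_disk.
  - by apply: mule_ge0 => //; rewrite lee_fin; exact: S0.
  - apply: lee_wpmul2l => //; rewrite lee_fin.
    case: (S01 y) => [|[+ h]]; rewrite /S => ->; first exact: ler0n.
    by have -> : normc y < 1 - e / 2 by have := normc_ge0 y; nra.
have mfin : m \is a fin_num.
  have e2 : (9 / 10 : R) < 1 by lra.
  rewrite ge0_fin_numE; first exact: (sw_loc sw e2).
  by apply: int2_ge0 => y; apply: mule_ge0 => //; rewrite lee_fin; exact: D0.
move: key; rewrite -(fineK afin) -(fineK mfin) -!EFinM -EFinD !lee_fin.
clear - r2; nra.
Qed.

(** The bound of [shell_bound] is uniform in e, so Fatou's lemma applies as e tends to 0. The finite
    mass puts functions with bounded derivative in the space and absorbs the errors in [energy]. *)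
Lemma sw_int w : sup_weight w -> (int2 w < +oo)%E.
Proof.
move=> sw; have w0 := sw_ge0 sw; have mw := sw_pmeas sw.
set M := (3%:E * int2 (fun z => w z * ((normc z < 9 / 10)%R%:R)%:E))%E.
have MM : (M < +oo)%E.
  have e2 : (9 / 10 : R) < 1 by lra.
  by apply: lte_mul_pinfty => //; exact: sw_loc.
apply: le_lt_trans MM.
have en n : 0 < (n.+2%:R : R)^-1 < 1 by rewrite invr_gt0 ltr0n/= invf_lt1// ltr1n.
apply: (fatou_bound (F := fun n z => w z * (shell n.+2%:R^-1 z)%:E)%E).
- by move=> n; apply: pmeasM => //; exact: rmeas_shell.
- by move=> n y; apply: mule_ge0 => //; rewrite lee_fin.
- by move=> n; exact: shell_bound.
move=> z; have [z1|z1] := leP 1 (normc z).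
  rewrite (sw_out sw z1); under eq_fun do rewrite mul0e; exact: cvg_cst.
apply: cvg_near_cst.
have z2 : 0 < 1 - normc z ^+ 2 by have := normc_ge0 z; nra.
have := near_infty_natSinv_lt (PosNum z2); apply: filterS => n /= h.
rewrite /shell (_ : normc z ^+ 2 < 1 - n.+2%:R^-1) ?mule1//.
have : (n.+2%:R : R)^-1 <= n.+1%:R^-1 by rewrite lef_pV2 ?posrE// ler_nat.
by move=> /le_lt_trans/(_ h); rewrite !ltrBrDl addrC.
Qed.

End Integrability.

(** * Lower bound for the weight near the circle *)

Section Hopf.
Variable R : realType.
Local Notation C := R[i].
Implicit Types (w g : C -> \bar R) (z : C).

Lemma compact_disk (s : R) : compact [set p : R * R | p.1 ^+ 2 + p.2 ^+ 2 <= s ^+ 2].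
Proof.
have sub : [set p : R * R | p.1 ^+ 2 + p.2 ^+ 2 <= s ^+ 2] `<=`
    `[- `|s|, `|s|]%classic `*` `[- `|s|, `|s|]%classic.
  have le_s (x y : R) : x ^+ 2 + y ^+ 2 <= s ^+ 2 -> `|x| <= `|s|.
    move=> h; rewrite -(ler_pXn2r (n := 2))// ?nnegrE// !real_normK ?num_real//.
    by apply: le_trans h; rewrite lerDl sqr_ge0.
  move=> [x y] /= h; split; rewrite /= in_itv/= -ler_norml.
    exact: le_s h.
  by apply: (le_s y x); rewrite addrC.
apply: subclosed_compact sub; last by apply: compact_setX; exact: segment_compact.
have cq : continuous (fun p : R * R => p.1 ^+ 2 + p.2 ^+ 2).
  move=> p; apply: cvgD; rewrite expr2; apply: cvgM; try exact: cvg_fst; exact: cvg_snd.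
have := (continuous_closedP _).1 cq _ (@closed_le R (s ^+ 2)).
exact.
Qed.

Lemma ereal_between (x y : \bar R) : (x < y)%E -> exists2 a : R, (x < a%:E)%E & (a%:E < y)%E.
Proof.
case: x y => [x| |] [y| |] //.
- rewrite lte_fin => xy; exists ((x + y) / 2); rewrite lte_fin; lra.
- by move=> _; exists (x + 1); rewrite ?ltry// lte_fin ltrDl.
- by move=> _; exists (y - 1); rewrite ?ltNyr// lte_fin; lra.
- by move=> _; exists 0; rewrite ?ltNyr ?ltry.
Qed.

(* A cluster point of the filter generated by the sets [{g < a}], [a > inf g]. *)
Lemma lsc_min g (s : R) : 0 <= s ->
  (forall z a, normc z <= s -> (a%:E < g z)%E ->
     exists2 e, 0 < e & forall y, normc (y - z) < e -> (a%:E < g y)%E) ->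
  exists2 z0, normc z0 <= s & forall y, normc y <= s -> (g z0 <= g y)%E.
Proof.
move=> s0 lsc; pose K := [set p : R * R | p.1 ^+ 2 + p.2 ^+ 2 <= s ^+ 2].
have KE p : K p <-> normc (toC p) <= s.
  have -> : K p = (p.1 ^+ 2 + p.2 ^+ 2 <= s ^+ 2) by [].
  have -> : p.1 ^+ 2 + p.2 ^+ 2 = normc (toC p) ^+ 2 by rewrite normc_sqr.
  by rewrite ler_pXn2r// nnegrE ?normc_ge0.
pose m := ereal_inf [set g z | z in [set z | normc z <= s]].
have mg y : normc y <= s -> (m <= g y)%E.
  by move=> ys; apply: ereal_inf_lbound; exists y.
have [my|my] := eqVneq m +oo%E.
  exists 0; first by rewrite normc0.
  by move=> y /mg; rewrite my leye_eq => /eqP ->; exact: leey.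
pose B (a : \bar R) := [set p | K p /\ (g (toC p) < a)%E].
have Bne a : (m < a)%E -> B a !=set0.
  move=> /ereal_inf_lt[_ [z zs <-] ga]; exists (Re z, Im z).
  have zE : toC (Re z, Im z) = z by case: (z).
  by split; rewrite ?KE zE.
pose F := filter_from [set a : \bar R | (m < a)%E] B.
have FF : ProperFilter F.
  apply: filter_from_proper => //.
  apply: filter_from_filter.
    by exists +oo%E; rewrite /= ltey.
  move=> a b /= ma mb; exists (Order.min a b); first by rewrite /= lt_min ma.
  by move=> p [Kp]; rewrite lt_min => /andP[h1 h2]; split; split.
have FK : F K by exists +oo%E; [rewrite /= ltey|move=> p []].
have [p [Kp cp]] := @compact_disk s F FF FK.
exists (toC p); first by apply/KE.
move=> y /mg; apply: le_trans; rewrite leNgt; apply/negP => mp.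
have [a ma ap] := ereal_between mp.
have [e e0 He] := lsc _ _ ((KE p).1 Kp) ap.
have nb : nbhs p [set q | normc (toC q - toC p) < e].
  have e2 : 0 < e / 2 by rewrite divr_gt0.
  exists (ball p.1 (e / 2), ball p.2 (e / 2)); first by split; exact: nbhsx_ballx.
  move=> [x y'] [/= b1 b2].
  change (normc (toC (x, y') - toC p) < e).
  apply: (le_lt_trans (normc_le _)); rewrite cReD cImD cReN cImN.
  move: b1 b2; rewrite /ball /= distrC => b1; rewrite distrC => b2.
  by rewrite (splitr e); exact: ltrD.
have FB : F (B a%:E) by exists a%:E.
have [q [[_ qa] /He aq]] := cp _ _ FB nb.
by move: (lt_trans aq qa); rewrite ltxx.
Qed.

Lemma near_sqr z e : 0 < e -> exists2 d, 0 < d &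
  forall y, normc (y - z) < d -> `|normc y ^+ 2 - normc z ^+ 2| < e.
Proof.
move=> e0; have n0 := normc_ge0 z.
have d0 : 0 < e / (2 * normc z + 1 + e) by rewrite divr_gt0//; lra.
exists (e / (2 * normc z + 1 + e)) => // y yd.
have k1 := le_normcBD y z; have k2 := le_normcBD z y; rewrite normcBC in k2.
set d := normc (y - z) in yd k1 k2; have dn : 0 <= d by exact: normc_ge0.
have dd : d * (2 * normc z + 1 + e) < e by rewrite -ltr_pdivlMr//; lra.
have dl : d < 1 by nra.
have y0 := normc_ge0 y.
by rewrite ltr_norml; apply/andP; split; nra.
Qed.

(* The circular means of the barrier exceed it as soon as [|z|^2 > 3/4]. *)
Definition barrier z : R := (1 - normc z ^+ 2) ^+ 2 + (1 - normc z ^+ 2).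

Lemma near_barrier z e : 0 < e -> exists2 d, 0 < d &
  forall y, normc (y - z) < d -> `|barrier y - barrier z| < e.
Proof.
move=> e0; set x := normc z ^+ 2; have x0 : 0 <= x by exact: sqr_ge0.
pose k := 2 * x + 3 + e; have k0 : 0 < k by rewrite /k; lra.
have ek : 0 < e / k by rewrite divr_gt0.
have [d d0 H] := near_sqr z ek; exists d => // y /H.
rewrite -/x /barrier -/x; set v := normc y ^+ 2 => vx.
have [v0 vk] : 0 <= v /\ `|v - x| * k < e by split; [exact: sqr_ge0|rewrite -ltr_pdivlMr].
have n0 := normr_ge0 (v - x); have n1 : `|v - x| < 1 by rewrite /k in vk; nra.
have -> : (1 - v) ^+ 2 + (1 - v) - ((1 - x) ^+ 2 + (1 - x)) = (v - x) * (v + x - 3) by ring.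
rewrite normrM; apply: le_lt_trans vk; apply: ler_wpM2l => //.
move: n1; rewrite ltr_norml => /andP[h1 h2]; rewrite /k ler_norml; apply/andP; split; lra.
Qed.

(** A minimum principle for w minus c times the barrier: a negative minimum cannot lie in |y| <=
    9/10 by the choice of c, nor near the unit circle, where the barrier tends to 0. In between, the
    barrier lies strictly below its means and the mean inequality for w fails. *)
Lemma hopf w : sup_weight w -> exists2 c, 0 < c &
  forall z, normc z < 1 -> ((c * (1 - normc z ^+ 2))%:E <= w z)%E.
Proof.
move=> sw; have w0 := sw_ge0 sw; have mw := sw_pmeas sw.
have [m m0 wm] : exists2 m : R, 0 < m & forall z, normc z <= 9 / 10 -> (m%:E <= w z)%E.
  have [||z0 z09 H] := @lsc_min w (9 / 10); first by lra.
    by move=> z a z9; apply: (sw_lsc sw); lra.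
  have /ereal_between[m m0 mz] : (0 < w z0)%E by apply: (sw_gt0 sw); lra.
  by exists m => [|z /H]; [rewrite -lte_fin|apply: le_trans; exact: ltW].
(* The barrier is at most 2 on the disk, so c times it is at most m <= w on |z| <= 9/10. *)
pose c := m / 2; have c0 : 0 < c by rewrite /c; lra.
suff key z : normc z < 1 -> ((c * barrier z)%:E <= w z)%E.
  exists c => // z z1; apply: le_trans (key _ z1); rewrite lee_fin /barrier.
  by have := sqr_ge0 (1 - normc z ^+ 2); nra.
move=> z1; rewrite leNgt; apply/negP => wz.
have wf : w z \is a fin_num.
  by rewrite ge0_fin_numE//; apply: lt_trans wz (ltry _).
pose d := c * barrier z - fine (w z).
have d0 : 0 < d by rewrite /d subr_gt0 -lte_fin fineK.
(* Where |y| >= 1 - d/(8c), c times the barrier is at most 4 c (1 - |y|) <= d/2, so a defect of d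
   forces |y0| < s. *)
pose s := Num.max (normc z) (1 - d / (8 * c)).
have c8 : 0 < 8 * c by lra.
have dc0 : 0 < d / (8 * c) by rewrite divr_gt0.
have zs : normc z <= s by rewrite /s le_max lexx.
have s1 : s < 1 by rewrite /s gt_max z1/=; lra.
have s0 : 0 <= s by apply: le_trans zs; exact: normc_ge0.
pose g y := (w y + (c * (2 - barrier y))%:E)%E.
have [|y0 y0s Hy] := @lsc_min g s s0.
  move=> y a ys; rewrite /g -lteBlDr// -EFinB => /ereal_between[a' aa ay].
  have y1 : normc y < 1 by lra.
  have [e1 e10 H1] := sw_lsc sw y1 ay.
  have ec : 0 < (a' - (a - c * (2 - barrier y))) / c.
    by apply: divr_gt0 => //; move: aa; rewrite lte_fin; lra.
  have [e2 e20 H2] := near_barrier y ec.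
  exists (Num.min e1 e2); first by rewrite lt_min e10.
  move=> u; rewrite lt_min => /andP[/H1 u1 /H2 u2].
  rewrite -lteBlDr// -EFinB; apply: le_lt_trans u1; rewrite lee_fin.
  have : `|barrier u - barrier y| * c < a' - (a - c * (2 - barrier y)) by rewrite -ltr_pdivlMr.
  by have := ler_norm (barrier u - barrier y); nra.
have gz := Hy z zs.
have gzE : g z = (fine (w z) + c * (2 - barrier z))%:E by rewrite /g EFinD fineK.
have wy : w y0 \is a fin_num.
  rewrite ge0_fin_numE// ltey; apply/eqP => wE.
  by move: gz; rewrite {1}/g wE gzE addye// leye_eq.
have gle : fine (w y0) - c * barrier y0 <= - d.
  by move: gz; rewrite gzE /g -(fineK wy) -EFinD lee_fin /d; lra.
have wy0 : 0 <= fine (w y0) by rewrite -lee_fin fineK.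
have nx := normc_ge0 y0.
have y1 : normc y0 <= 1 by lra.
have b1 : barrier y0 <= 4 * (1 - normc y0).
  rewrite /barrier; set x := normc y0 in nx y1 *.
  have x2 : 0 <= x ^+ 2 by exact: sqr_ge0.
  have h : 1 - x ^+ 2 <= 2 * (1 - x) by nra.
  have h2 : 0 <= 1 - x ^+ 2 by nra.
  by set t := x ^+ 2 in x2 h h2 *; nra.
have ys : normc y0 < s.
  rewrite /s lt_max; apply/orP; right.
  have h : 4 * (d / (8 * c)) * c = d / 2 by field; rewrite gt_eqF.
  nra.
have y9 : 9 / 10 < normc y0.
  rewrite ltNge; apply/negP => /wm; rewrite -(fineK wy) lee_fin => mw'.
  have b2 : barrier y0 <= 2.
    rewrite /barrier; have t0 : 0 <= normc y0 ^+ 2 by exact: sqr_ge0.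
    have t1 : normc y0 ^+ 2 <= 1 by nra.
    by set t := normc y0 ^+ 2 in t0 t1 *; nra.
  by have : c * barrier y0 <= c * 2 by [exact: ler_wpM2l (ltW c0) _ _ b2]; rewrite /c in gle *; nra.
(* The circle stays in |y| <= s, where y0 is the minimum. *)
pose r := s - normc y0; have r0 : 0 < r by rewrite /r; lra.
have yr : normc y0 + r < 1 by rewrite /r; lra.
have circE t : y0 + r%:C * expi t = y0 - (- r)%:C * expi t by rewrite rmorphN/= mulNr opprK.
pose f t := fine (w y0) + c * (((1 - normc (y0 - (- r)%:C * expi t) ^+ 2) ^+ 2 +
   (1 - normc (y0 - (- r)%:C * expi t) ^+ 2)) - barrier y0).
have c1 : continuous (fun t => 1 - normc (y0 - (- r)%:C * expi t) ^+ 2).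
  by apply: cont_sub; [exact: cont_cst|exact: cont_sqr_circle].
have c2 : continuous (fun t => (1 - normc (y0 - (- r)%:C * expi t) ^+ 2) ^+ 2).
  by under eq_fun do rewrite expr2; exact: cont_mul.
have c3 := cont_add c2 c1.
have c4 := cont_sub c3 (@cont_cst _ (barrier y0)).
have cf : continuous f.
  by apply: cont_add; [exact: cont_cst|apply: cont_mul => //; exact: cont_cst].
have fw t : ((f t)%:E <= w (y0 + r%:C * expi t)%R)%E.
  have us : normc (y0 + r%:C * expi t) <= s.
    apply: le_trans (le_normcD _ _) _.
    by rewrite normcM normc_real normc_expi mulr1 gtr0_norm// /r; lra.
  move: (Hy _ us); rewrite /g -(fineK wy) -EFinD -leeBlDr// -EFinB.
  apply: le_trans; rewrite lee_fin /f -circE -/(barrier _); lra.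
have := le_trans (avg_le_emean mw w0 cf fw) (sw_mean sw r0 yr).
rewrite -(fineK wy) lee_fin; apply/negP; rewrite -ltNge /f.
rewrite avgD; [|exact: cont_cst|by apply: cont_mul => //; exact: cont_cst].
rewrite avg_cst avgZ// avgB//; last exact: cont_cst.
rewrite avg_cst avgD// avg_sqr_circle2 avgB; [|exact: cont_cst|exact: cont_sqr_circle].
rewrite avg_cst avg_sqr_circle /barrier sqrrN ltrDl; apply: mulr_gt0 => //.
have r2 : 0 < r ^+ 2 by rewrite exprn_gt0.
have x9 : 3 / 4 < normc y0 ^+ 2 by nra.
have := mulr_gt0 r2 r2; nra.
Qed.
End Hopf.

(** * Harmonic majorants of finite energy *)

Section Majorant.
Variable R : realType.
Local Notation C := R[i].
Local Notation mu := (@lebesgue_measure R).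
Implicit Types (W w V : C -> \bar R) (z : C) (f : C -> C).

Lemma emean_avg W z r (g : R -> R) : continuous g ->
  (forall t, W (z + r%:C * expi t) = (g t)%:E) -> emean W z r = (avg g)%:E.
Proof.
move=> cg Wg; rewrite /emean /avg EFinM; congr (_ * _)%E.
have ig := itg_integrable 0 (2 * pi) cg.
rewrite /itg /Rintegral fineK; last exact: integrable_fin_num.
by apply: eq_integral => t _; rewrite Wg.
Qed.

Lemma hol_sub rad r f : r <= rad -> hol rad f -> hol r f.
Proof. by move=> rr Hf z zr; apply: Hf; exact: lt_le_trans rr. Qed.

Lemma ler_dist_normc (a b : C) : `|normc a - normc b| <= normc (a - b).
Proof.
have k1 := le_normcBD a b; have k2 := le_normcBD b a; rewrite normcBC in k2.
by rewrite ler_norml; apply/andP; split; lra.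
Qed.

(** Adding the Taylor expansions from z to z + h and back isolates (f'(z + h) - f'(z)) h, of size
    |h|^2. *)
Lemma dc_lip rad f s : 0 < rad -> hol rad f -> s < rad -> exists2 B, 0 < B &
  forall z h, normc z <= s -> normc (z + h) <= s ->
  normc (dc f (z + h) - dc f z) <= B * normc h.
Proof.
move=> rad0 Hf /(hol_bounded rad0 Hf)[B B0 H]; exists (2 * B); first by lra.
move=> z h zs zhs; have [->|h0] := eqVneq h 0.
  by rewrite addr0 subrr normc0 mulr0.
have [_ _ /(_ _ zhs) T1] := H _ zs; have [_ _ T2] := H _ zhs.
have {}T2 := T2 (- h); rewrite addrK normcN in T2; have {}T2 := T2 zs.
rewrite -(ler_pM2r (x := normc h)) ?normc_gt0// -normcM.
move: (dc f (z + h)) (dc f z) (f (z + h)) (f z) T1 T2 => a b u v T1 T2.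
have -> : (a - b) * h = (u - v - b * h) + (v - u - a * - h) by ring.
by apply: le_trans (le_normcD _ _) _; rewrite -[leRHS](mulrA (2 * B)) -expr2; lra.
Qed.

Lemma measurable_dc rad f : hol rad f ->
  measurable_fun (cdisk rad) (fun p => normc (dc f (toC p)) ^+ 2).
Proof.
move=> Hf; have m : measurable_fun (cdisk rad) (fun p => normc (dc f (toC p))).
  apply: (@measurable_ccont R rad (fun z => normc (dc f z))) => z zr e e0.
  pose s := (normc z + rad) / 2; have [sr zs] : s < rad /\ normc z < s by rewrite /s; split; lra.
  have rad0 : 0 < rad by exact: le_lt_trans (normc_ge0 _) zr.
  have [B B0 HB] := dc_lip rad0 Hf sr.
  have d0 : 0 < Num.min (s - normc z) (e / (2 * B)).
    by rewrite lt_min subr_gt0 zs divr_gt0// mulr_gt0.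
  exists (Num.min (s - normc z) (e / (2 * B))) => // h; rewrite le_min => /andP[h1 h2].
  have zh : normc (z + h) <= s by apply: le_trans (le_normcD _ _) _; lra.
  have hB : normc h * (2 * B) <= e by rewrite -ler_pdivlMr// mulr_gt0.
  have := HB z h (ltW zs) zh; have n0 := normc_ge0 h => L.
  by apply: le_lt_trans (ler_dist_normc _ _) _; apply: le_lt_trans L _; nra.
by under eq_fun do rewrite expr2; exact: measurable_funM.
Qed.

Lemma rmeas_cut r (g : C -> R) : measurable_fun (cdisk r) (fun p => g (toC p)) ->
  rmeas (fun z => (normc z < r)%R%:R * g z).
Proof.
move=> mg; apply: (@pmeas_disk R _ r); last by move=> z; rewrite ltNge => ->; rewrite mul0r.
apply/measurable_EFinP; apply: measurable_funM => //.
have /measurable_EFinP := @rmeas_disk R r; exact: measurable_funTS.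
Qed.

Lemma measurable_cut r (g : C -> R) : measurable_fun (cdisk r) (fun p => g (toC p)) ->
  measurable_fun (cdisk r) (fun p => (0 < g (toC p))%R%:R : R).
Proof.
move=> mg; have -> : (fun p => (0 < g (toC p))%R%:R : R) =
    \1_[set p | 0 < g (toC p)].
  apply/funext => p; rewrite indicE; congr ((nat_of_bool _)%:R).
  by apply/idP/idP; rewrite inE.
have mD := measurable_cdisk r.
have mA : measurable (cdisk r `&` [set p | 0 < g (toC p)]).
  have -> : [set p | 0 < g (toC p)] = (fun p => g (toC p)) @^-1` `]0, +oo[%classic.
    by apply/seteqP; split=> p /=; rewrite in_itv/= andbT.
  exact: mg.
have : measurable_fun (cdisk r) (\1_(cdisk r `&` [set p | 0 < g (toC p)]) : R * R -> R).
  exact: measurable_indic.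
apply: eq_measurable_fun => p.
by rewrite inE => Dp; rewrite !indicE in_setI; rewrite (mem_set Dp).
Qed.

Definition trace f (r t : R) : R := `|Re (f (circle 0 r t))|.

(* Poisson integral of the trace of [|Re f|] on the circle of radius [r],
   completed by its harmonic conjugate. *)
Definition majorant f r : C -> C := herglotz (trace f r) r.

Lemma trace_cont f r : hol 1 f -> 0 < r < 1 -> continuous (trace f r).
Proof.
move=> Hf r01 t; apply: cvg_norm; apply: ccont_Re.
exact: ccont_hol_circle r01.
Qed.

Lemma circle0_norm (r t : R) : 0 < r -> normc (circle 0 r t) = r.
Proof. by move=> r0; have := @circle_sub R 0 r t r0; rewrite subr0. Qed.

Lemma trace_bounded f r : hol 1 f -> 0 < r < 1 -> exists M, forall t, `|trace f r t| <= M.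
Proof.
move=> Hf /andP[r0 r1]; have [B _ H] := hol_bounded ltr01 Hf r1; exists B => t.
rewrite normr_id; apply: le_trans (normr_Re _) _.
by have [] := H (circle 0 r t); rewrite ?circle0_norm.
Qed.

Lemma majorant_hol f r : hol 1 f -> 0 < r < 1 -> hol r (majorant f r).
Proof. by move=> Hf r01; apply: herglotz_hol; [exact: trace_cont|exact: trace_bounded]. Qed.

Lemma majorantE f r z : hol 1 f -> 0 < r < 1 -> normc z < r ->
  Re (majorant f r z) = avg (fun t => trace f r t * poisson r z t).
Proof. by move=> Hf r01 zr; rewrite /majorant Re_herglotz//; exact: trace_cont. Qed.

Lemma le_majorant f r z : hol 1 f -> 0 < r < 1 -> normc z < r ->
  `|Re (f z)| <= Re (majorant f r z).
Proof.
move=> Hf r01 zr; rewrite majorantE// (poisson_formula Hf r01 zr).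
have [r0 r1] := andP r01.
have cp := poisson_cont zr.
apply: avg_norm => [||t].
- by apply: cont_mul => //; apply: ccont_Re; exact: ccont_hol_circle r01.
- by apply: cont_mul => //; exact: trace_cont.
- by rewrite normrM (ger0_norm (poisson_ge0 _ r0 zr)).
Qed.

Lemma majorant_le f r z B : hol 1 f -> 0 < r < 1 -> normc z < r ->
  (forall t, trace f r t <= B) -> Re (majorant f r z) <= B.
Proof.
move=> Hf r01 zr HB; rewrite majorantE//; have [r0 r1] := andP r01.
have cp := poisson_cont zr.
rewrite -[leRHS]mulr1 -(avg_poisson r0 zr) -avgZ//.
apply: le_avg => [||t].
- by apply: cont_mul => //; exact: trace_cont.
- by apply: cont_mul => //; exact: cont_cst.
- by apply: ler_wpM2r (HB t); exact: poisson_ge0.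
Qed.

(* Lipschitz traces satisfy the hypothesis of [poisson_boundary] by AM-GM. *)
Lemma majorant_boundary f r e : hol 1 f -> 0 < r < 1 -> 0 < e ->
  exists2 s, 0 <= s < r & forall z, s <= normc z -> normc z < r ->
    Re (majorant f r z) ^+ 2 - Re (f z) ^+ 2 <= e.
Proof.
move=> Hf r01 e0; have [r0 r1] := andP r01.
have [B B0 HB] := hol_bounded ltr01 Hf r1.
(* |f'| <= B, and the remainder B |h|^2 is at most 2 B |h| since |h| <= 2 in the disk. *)
pose K := 3 * B; have K0 : 0 < K by rewrite /K; lra.
have lip z h : normc z <= r -> normc (z + h) <= r -> normc (f (z + h) - f z) <= K * normc h.
  move=> zr zhr; have [_ D1 T] := HB z zr; have {}T := T h zhr.
  rewrite -[_ - f z](subrK (dc f z * h)).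
  apply: le_trans (le_normcD _ _) _; rewrite normcM.
  have h2 : normc h <= 2.
    have -> : h = (z + h) - z by ring.
    by apply: le_trans (le_normcB _ _) _; lra.
  have n0 := normc_ge0 h.
  have b1 : B * normc h ^+ 2 <= B * (2 * normc h).
    by apply: ler_wpM2l; [exact: ltW|rewrite expr2; exact: ler_wpM2r].
  have b2 : normc (dc f z) * normc h <= B * normc h by exact: ler_wpM2r.
  apply: le_trans (lerD T b2) _; rewrite /K; lra.
have trB t : trace f r t <= B.
  by apply: le_trans (normr_Re _) _; have [] := HB (circle 0 r t); rewrite ?circle0_norm.
(* The goal is U - |u| <= 4 a, because U + |u| <= 2 B and 8 a B = e. The constant k gives K d <= a +
   k d^2 by AM-GM, and b makes the terms proportional to r - |z| sum to at most a. *)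
pose a := e / (8 * B); have a0 : 0 < a by rewrite divr_gt0// mulr_gt0.
pose k := K ^+ 2 / (4 * a).
have k0 : 0 < k by rewrite divr_gt0 ?exprn_gt0// mulr_gt0.
pose b := a / (2 * k + K).
have kK : 0 < 2 * k + K by lra.
have b0 : 0 < b by rewrite divr_gt0.
have aB : a * (8 * B) = e by rewrite /a divfK// gt_eqF// mulr_gt0.
have bk : b * (2 * k + K) = a by rewrite /b divfK// gt_eqF.
have ks : 4 * a * k = K ^+ 2 by rewrite /k mulrC divfK// gt_eqF// mulr_gt0.
pose s := Num.max 0 (r - b).
have s0 : 0 <= s by rewrite le_max lexx.
have sr : s < r by rewrite gt_max r0 ltrBlDr ltrDl.
exists s; first by rewrite s0.
move=> z sz zr; have := polar z; set x := normc z in sz zr *; move=> [t0 _ zE].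
have x0 : 0 <= x by exact: normc_ge0.
have xb : r - x <= b.
  have : r - b <= s by rewrite le_max lexx orbT.
  by lra.
have tl t y : normc y <= r -> `|trace f r t - `|Re (f y)| | <= K * normc (circle 0 r t - y).
  move=> yr; apply: le_trans (ler_dist_dist _ _) _.
  rewrite -cReN -cReD; apply: le_trans (normr_Re _) _.
  have := lip y (circle 0 r t - y) yr; rewrite subrKC circle0_norm//; exact.
have ph t : `|trace f r t - trace f r t0| <= a + k * normc (circle 0 r t - circle 0 r t0) ^+ 2.
  have := tl t (circle 0 r t0); rewrite circle0_norm// => /(_ (lexx _)).
  set d := normc (_ - _) => /le_trans; apply.
  have h : (4 * a) * (K * d) <= (4 * a) * (a + k * d ^+ 2).
    have -> : (4 * a) * (a + k * d ^+ 2) = 4 * a ^+ 2 + (4 * a * k) * d ^+ 2 by ring.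
    by rewrite ks; have := sqr_ge0 (2 * a - K * d); nra.
  by move: h; rewrite ler_pM2l// mulr_gt0.
have x0r : 0 <= x < r by rewrite x0.
have := poisson_boundary x0r (trace_cont Hf r01) ph.
rewrite -zE -majorantE//; set U := Re _ => PB.
have := tl t0 z (ltW zr).
have -> : normc (circle 0 r t0 - z) = r - x.
  rewrite {1}zE /circle add0r -mulrBl -(rmorphB (real_complex R)) normcM normc_real normc_expi mulr1.
  by rewrite ger0_norm// subr_ge0 ltW.
set T := trace f r t0 in PB *; set u := Re (f z) => tz.
have U0 : 0 <= U by apply: le_trans (le_majorant Hf r01 zr).
have UB : U <= B by exact: majorant_le.
have uB : `|u| <= B.
  by apply: le_trans (normr_Re _) _; have [] := HB z (ltW zr).
have uu : `|u| <= U by exact: le_majorant.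
have u0 := normr_ge0 u.
have Uu : U - `|u| <= 4 * a.
  have : k * (2 * r * (r - x)) + K * (r - x) <= a.
    rewrite -bk; have h1 : (r - x) * (2 * k + K) <= b * (2 * k + K) by apply: ler_wpM2r => //; exact: ltW.
    have h2 : 0 <= (1 - r) * (k * (r - x)).
      apply: mulr_ge0; first by rewrite subr_ge0 ltW.
      by apply: mulr_ge0; [exact: ltW|rewrite subr_ge0 ltW].
    by clear - h1 h2; nra.
  move: PB tz; rewrite !ler_norml => /andP[p1 p2] /andP[p3 p4].
  by clear - p1 p2 p3 p4 a0; lra.
rewrite -(real_normK (num_real u)) subr_sqr.
have : (U - `|u|) * (U + `|u|) <= 4 * a * (2 * B).
  apply: ler_pM => //; [by rewrite subr_ge0|exact: addr_ge0|].
  by rewrite mulr_natl mulr2n; exact: lerD.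
by clear - aB; nra.
Qed.
End Majorant.

(** * The energy estimate *)

Section Energy.
Variable R : realType.
Local Notation C := R[i].
Local Notation mu := (@lebesgue_measure R).
Implicit Types (W w V : C -> \bar R) (z : C) (f F : C -> C).

Definition density r f z : R := (normc z < r)%R%:R * normc (dc f z) ^+ 2.

Lemma density_ge0 r f z : 0 <= density r f z.
Proof. by rewrite mulr_ge0// sqr_ge0. Qed.

Lemma rmeas_density r f : hol r f -> rmeas (density r f).
Proof. by move=> Hf; apply: (rmeas_cut (g := fun z => normc (dc f z) ^+ 2)); exact: measurable_dc. Qed.

Lemma int2_scale_le w (Q : C -> R) (k M : R) : pmeas w -> (forall z, 0 <= w z)%E -> rmeas Q ->
  (forall z, 0 <= Q z) -> 0 < k -> (int2 (fun z => w z * (k * Q z)%:E) <= (k * M)%:E)%E ->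
  (int2 (fun z => w z * (Q z)%:E) <= M%:E)%E.
Proof.
move=> mw w0 mQ Q0 k0 H; rewrite -(@lee_pmul2l R k%:E) ?lte_fin//.
have mwQ : pmeas (fun z => w z * (Q z)%:E)%E by exact: pmeasM.
have wQ0 z : (0 <= w z * (Q z)%:E)%E by rewrite mule_ge0// lee_fin.
rewrite -EFinM; apply: le_trans H; rewrite -int2Z// ?lee_fin ?(ltW k0)//.
rewrite le_eqVlt; apply/orP; left; apply/eqP; congr int2; apply/funext => z.
by rewrite EFinM muleCA.
Qed.

(** The pointwise inequality that feeds [test_lemma] in [energy]. UF, uf are the squares of the real
    parts, AF, Af their circular means, dF, df the squared derivatives, n2 = |z|^2. *)
Lemma mean_sqr_gap (x e eta K1 K2 r2 n2 UF uf dF df AF Af : R) :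
  `|AF - UF - x ^+ 2 * dF / 2| <= K1 * x ^+ 3 -> `|Af - uf - x ^+ 2 * df / 2| <= K2 * x ^+ 3 ->
  UF - uf + eta * (r2 - n2) - 2 * e + x ^+ 2 / 2 * dF <=
  AF - Af + eta * (r2 - (n2 + x ^+ 2)) - 2 * e + (x ^+ 2 / 2 * df + (eta * x ^+ 2 + (K1 + K2) * x ^+ 3)).
Proof. by rewrite !ler_norml => /andP[h1 _] /andP[_ h2]; lra. Qed.

(* The test function is [(U^2 - u^2 + eta (r^2 - |z|^2) - 2 e)_+], [U = Re F] and
   [u = Re f], which is compactly supported in [|z| < r] by the boundary
   estimate. Tested against [w] it bounds the energy of [F]; tested against
   [c (1 - |z|^2) <= w], whose means drop by exactly [c x^2], it bounds [U]. *)
Lemma energy w c f F (M B r s : R) : sup_weight w -> 0 < c ->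
  (forall z, normc z < 1 -> ((c * (1 - normc z ^+ 2))%:E <= w z)%E) ->
  hol 1 f -> (int2 (fun z => w z * (density 1 f z)%:E) <= M%:E)%E -> 0 < s < r -> r < 1 ->
  hol r F -> (forall z, normc z < r -> `|Re (f z)| <= Re (F z) <= B) ->
  (forall e, 0 < e -> exists2 s, 0 <= s < r & forall z, s <= normc z -> normc z < r ->
    Re (F z) ^+ 2 - Re (f z) ^+ 2 <= e) ->
  (int2 (fun z => w z * (density s F z)%:E) <= (M + 1)%:E)%E /\
  (c%:E * int2 (fun z => ((normc z < s)%R%:R *
     (Re (F z) ^+ 2 - Re (f z) ^+ 2))%:E) <= ((M + 1) / 2)%:E)%E.
Proof.
move=> sw c0 Hw Hf HM /andP[s0 sr] r1 HF FB Hbd.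
have w0 := sw_ge0 sw; have mw := sw_pmeas sw.
have r0 : 0 < r by lra.
have r01 : 0 < r < 1 by rewrite r0.
have fw : int2 w \is a fin_num by rewrite ge0_fin_numE ?int2_ge0//; exact: sw_int.
pose I := fine (int2 w); have I0 : 0 <= I by rewrite fine_ge0// int2_ge0.
have IE : int2 w = I%:E by rewrite fineK.
(* Keeps the contribution of the term eta (r^2 - |z|^2) below 1/8 once multiplied by the total mass
   I. *)
pose eta := (8 * (I + 1))^-1.
have eta0 : 0 < eta by rewrite invr_gt0; lra.
have etaI : eta * I <= 1 / 8.
  have h : eta * (8 * (I + 1)) = 1 by rewrite mulVf// gt_eqF//; lra.
  by nra.
(* On |z| < s the term eta (r^2 - |z|^2) is at least 8 e, so the test function is positive there
   despite the - 2 e. *)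
pose e := eta * (r ^+ 2 - s ^+ 2) / 8.
have rs2 : 0 < r ^+ 2 - s ^+ 2 by nra.
have e0 : 0 < e by rewrite divr_gt0// mulr_gt0.
have [s1 /andP[s10 s1r] Hb] := Hbd _ e0.
(* For s2 <= |z| < r, eta (r^2 - |z|^2) <= e; together with U^2 - u^2 <= e from the boundary
   estimate this makes q nonpositive. *)
pose s2 := r - (r ^+ 2 - s ^+ 2) / 16.
have s2r : s2 < r by rewrite /s2; lra.
pose g := Num.max s (Num.max s1 s2).
have [sg s1g s2g] : [/\ s <= g, s1 <= g & s2 <= g] by rewrite /g !le_max !lexx !orbT.
have gr : g < r by rewrite /g !gt_max sr s1r.
pose tau := (g + r) / 2.
have [gt tr] : g < tau /\ tau < r by rewrite /tau; split; lra.
have t1 : tau < 1 by lra.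
have [K1 K10 HK1] := mean_sqr_Re HF tr.
have [K2 K20 HK2] := mean_sqr_Re Hf t1.
pose K := K1 + K2; have K0 : 0 < K by rewrite /K; lra.
(* The second bound keeps the circles about |z| < g inside |y| <= tau < r; the third makes the cubic
   error, x K I relative to x^2, at most 1/8. *)
pose x := Num.min 1 (Num.min (tau - g) (8 * (K * (I + 1)))^-1).
have KI : 0 < 8 * (K * (I + 1)) by rewrite mulr_gt0// mulr_gt0//; lra.
have x0 : 0 < x by rewrite /x !lt_min ltr01 subr_gt0 gt invr_gt0 KI.
have [x1 xt xK] : [/\ x <= 1, x <= tau - g & x <= (8 * (K * (I + 1)))^-1].
  by rewrite /x !ge_min !lexx !orbT.
have xKI : x * K * I <= 1 / 8.
  have : x * (8 * (K * (I + 1))) <= 1 by rewrite -ler_pdivlMr// div1r.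
  by have := mulr_gt0 x0 K0; clear; nra.
have x2 : 0 < x ^+ 2 by rewrite exprn_gt0.
have x3 : 0 < x ^+ 3 by rewrite exprn_gt0.
pose q z := Re (F z) ^+ 2 - Re (f z) ^+ 2 + eta * (r ^+ 2 - normc z ^+ 2) - 2 * e.
pose S z : R := (normc z < g)%R%:R * (0 < q z)%R%:R.
have S01 z : S z = 0 \/ [/\ S z = 1, normc z < g & 0 < q z].
  rewrite /S; case: ltP => [h|_]; last by left; rewrite mul0r.
  case: ltP => [h'|_]; last by left; rewrite mulr0.
  by right; split; rewrite ?mulr1.
have S0 z : 0 <= S z by rewrite mulr_ge0.
have HU z : normc z < r -> 0 <= Re (F z) ^+ 2 - Re (f z) ^+ 2.
  move=> zr; rewrite subr_ge0 -(real_normK (num_real (Re (f z)))).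
  by apply: lerXn2r; rewrite ?nnegrE//; have /andP[h _] := FB _ zr => //;
    exact: le_trans h.
have eE : 8 * e = eta * (r ^+ 2 - s ^+ 2) by rewrite /e mulrC divfK.
have qs z : normc z < s -> Re (F z) ^+ 2 - Re (f z) ^+ 2 <= q z /\ 0 < q z.
  move=> zs; have n0 := normc_ge0 z; have zr := lt_trans zs sr.
  have h : 8 * e <= eta * (r ^+ 2 - normc z ^+ 2).
    by rewrite eE; apply: ler_wpM2l; [exact: ltW|clear - zs n0; nra].
  by have := HU _ zr; rewrite /q; clear - h e0; split; lra.
have qg z : g <= normc z -> normc z < r -> q z <= 0.
  move=> gz zr; have n0 := normc_ge0 z.
  have h1 := Hb z (le_trans s1g gz) zr.
  have h2 : eta * (r ^+ 2 - normc z ^+ 2) <= e.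
    rewrite /e -mulrA; apply: ler_wpM2l; first exact: ltW.
    have : r - normc z <= (r ^+ 2 - s ^+ 2) / 16 by move: s2g; rewrite /s2; clear - gz; lra.
    by clear - n0 zr r0 r1; nra.
  by rewrite /q; clear - h1 h2 e0; lra.
pose Q z := S z * q z.
pose G z := S z * (x ^+ 2 / 2 * density 1 f z + (eta * x ^+ 2 + K * x ^+ 3)).
pose H z := x ^+ 2 / 2 * (S z * density r F z).
have mq : measurable_fun (cdisk g) (fun p => q (toC p)).
  have sub1 : cdisk g `<=` (cdisk r : set (R * R)) by move=> p h; exact: lt_trans h gr.
  have sub2 : cdisk g `<=` (cdisk 1 : set (R * R)).
    by move=> p h; exact: lt_trans h (lt_trans gr r1).
  have [mF _] := measurable_hol HF; have [mf _] := measurable_hol Hf.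
  have {}mF := measurable_funS (measurable_cdisk r) sub1 mF.
  have {}mf := measurable_funS (measurable_cdisk 1) sub2 mf.
  have mn : measurable_fun (cdisk g) (fun p : R * R => normc (toC p) ^+ 2).
    by have /measurable_EFinP := @rmeas_sqr R; exact: measurable_funTS.
  apply: measurable_funB => //; apply: measurable_funD.
    by apply: measurable_funB; under eq_fun do rewrite expr2; exact: measurable_funM.
  by apply: measurable_funM => //; exact: measurable_funB.
have mS : rmeas S.
  by apply: (rmeas_cut (g := fun z => (0 < q z)%R%:R)); exact: (measurable_cut mq).
have mQ : rmeas Q.
  have := rmeasM mS (rmeas_cut mq); congr rmeas; apply/funext => z.
  by rewrite /Q; case: (S01 z) => [->|[-> -> _]]; rewrite ?mul0r//= !mul1r.
have mDF := rmeas_density HF; have mDf := rmeas_density Hf.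
have mG : rmeas G.
  apply: rmeasM => //; apply: rmeasD; last exact: rmeas_cst.
  by apply: rmeasM => //; exact: rmeas_cst.
have mH : rmeas H by apply: rmeasM; [exact: rmeas_cst|exact: rmeasM].
have Q0 z : 0 <= Q z.
  by rewrite /Q; case: (S01 z) => [->|[-> _ /ltW h]]; rewrite ?mul0r ?mul1r.
have k0 : 0 <= eta * x ^+ 2 + K * x ^+ 3 by apply: addr_ge0; apply: mulr_ge0; exact: ltW.
have D0 z : 0 <= x ^+ 2 / 2 * density 1 f z.
  by apply: mulr_ge0; [by rewrite divr_ge0// ltW|exact: density_ge0].
have G0 z : 0 <= G z by apply: mulr_ge0 => //; exact: addr_ge0.
have H0 z : 0 <= H z.
  by apply: mulr_ge0; [rewrite divr_ge0// ltW|apply: mulr_ge0 => //; exact: density_ge0].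
have QB z : Q z <= B ^+ 2 + eta.
  rewrite /Q; case: (S01 z) => [->|[-> zg _]].
    by rewrite mul0r; apply: addr_ge0; [exact: sqr_ge0|exact: ltW].
  rewrite mul1r /q; have zr := lt_trans zg gr.
  have /andP[U0 UB] := FB _ zr; have {}U0 := le_trans (normr_ge0 _) U0.
  have U2 : Re (F z) ^+ 2 <= B ^+ 2 by apply: lerXn2r; rewrite ?nnegrE//; exact: le_trans UB.
  have u2 := sqr_ge0 (Re (f z)); have n2 := sqr_ge0 (normc z).
  have h : eta * (r ^+ 2 - normc z ^+ 2) <= eta * 1 by apply: ler_wpM2l; [exact: ltW|clear - r0 r1 n2; nra].
  by clear - U2 u2 h e0; lra.
have mwQ : pmeas (fun z => w z * (Q z)%:E)%E by exact: pmeasM.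
have fin : (int2 (fun z => w z * (Q z)%:E) < +oo)%E.
  apply: (@le_lt_trans _ _ ((B ^+ 2 + eta)%:E * int2 w)%E); last by rewrite IE -EFinM ltry.
  rewrite -int2Z// ?lee_fin; last by apply: addr_ge0; [exact: sqr_ge0|exact: ltW].
  apply: le_int2 => [//||y|y].
  - by apply: pmeasM => //; exact: rmeas_cst.
  - by apply: mule_ge0 => //; rewrite lee_fin.
  - by rewrite muleC; apply: lee_wpmul2r => //; rewrite lee_fin.
have SQ z : (Q z != 0%R -> normc z + x < 1).
  rewrite /Q; case: (S01 z) => [->|[_ h _] _]; first by rewrite mul0r eqxx.
  by clear - h xt t1; lra.
have sub z : ((Q z + H z)%:E <= emean (EFin \o Q) z (- x)%R + (G z)%:E)%E.
  have Q0' y : (0 <= (EFin \o Q) y)%E by rewrite lee_fin.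
  case: (S01 z) => [Sz|[Sz zg qz]].
    by rewrite /Q /H /G Sz !mul0r mulr0 addr0 adde0; exact: emean_ge0.
  have n0 := normc_ge0 z; have zr := lt_trans zg gr.
  have yt t : normc (z - x%:C * expi t) <= tau.
    apply: le_trans (le_normcB _ _) _.
    by rewrite normcM normc_real normc_expi mulr1 gtr0_norm//; clear - zg xt; lra.
  have cc : ccont (fun t => z - x%:C * expi t).
    by apply: ccontB; [exact: ccont_cst|apply: ccontM; [exact: ccont_cst|exact: ccont_expi]].
  have c1 : continuous (fun t => Re (F (z - x%:C * expi t)) ^+ 2).
    under eq_fun do rewrite expr2; apply: cont_mul; apply: ccont_Re;
    by apply: (ccont_hol HF cc) => t; exact: le_lt_trans (yt t) tr.
  have c2 : continuous (fun t => Re (f (z - x%:C * expi t)) ^+ 2).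
    under eq_fun do rewrite expr2; apply: cont_mul; apply: ccont_Re;
    by apply: (ccont_hol Hf cc) => t; exact: le_lt_trans (yt t) t1.
  have c3 := @cont_sqr_circle R z x.
  have c4 := cont_sub (@cont_cst _ (r ^+ 2)) c3.
  have c5 := cont_mul (@cont_cst _ eta) c4.
  have c6 := cont_sub c1 c2.
  have c7 := cont_add c6 c5.
  have c8 := cont_sub c7 (@cont_cst _ (2 * e)).
  (* For |y| < g, Q is the positive part of q; for g <= |y| < r, q is nonpositive and Q vanishes. *)
  have gQ t : ((q (z - x%:C * expi t))%:E <= (EFin \o Q) (z + (- x)%:C * expi t)%R)%E.
    rewrite rmorphN/= mulNr lee_fin /Q; set y := z - _; have yt' := yt t; rewrite -/y in yt'.
    have yr := le_lt_trans yt' tr.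
    rewrite /S; case: (ltP (normc y) g) => [yg|/qg/(_ yr) qy]; last by rewrite mul0r mul0r.
    by case: ltP => qy; rewrite ?mul1r ?mulr1 ?mulr0 ?mul0r.
  have := avg_le_emean (W := EFin \o Q) mQ Q0' c8 gQ.
  set a := avg _; move=> ha; apply: le_trans (leeD ha (lexx _)); rewrite -EFinD lee_fin.
  have zx : normc z + x <= tau by clear - zg xt; lra.
  have x01 : 0 < x <= 1 by rewrite x0.
  have := HK1 z x x01 zx; have := HK2 z x x01 zx.
  have -> : a = avg (fun t => Re (F (z - x%:C * expi t)) ^+ 2) -
      avg (fun t => Re (f (z - x%:C * expi t)) ^+ 2) +
      eta * (r ^+ 2 - (normc z ^+ 2 + x ^+ 2)) - 2 * e.
    rewrite /a (avgB c7 (@cont_cst _ (2 * e))) (avgD c6 c5) (avgB c1 c2) (avgZ eta c4).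
    by rewrite (avgB (@cont_cst _ (r ^+ 2)) c3) (avg_cst (2 * e)) (avg_cst (r ^+ 2)) (avg_sqr_circle z x).
  have z1 := lt_trans zr r1.
  have QE : Q z = q z by rewrite /Q Sz mul1r.
  have HE : H z = x ^+ 2 / 2 * normc (dc F z) ^+ 2.
    by rewrite /H Sz mul1r /density zr mul1r.
  have GE : G z = x ^+ 2 / 2 * normc (dc f z) ^+ 2 + (eta * x ^+ 2 + K * x ^+ 3).
    by rewrite /G Sz mul1r /density z1 mul1r.
  rewrite QE HE GE.
  rewrite {1}/q.
  move=> h2 h1.
  exact: (mean_sqr_gap _ _ _ _ h1 h2).
have GE : (int2 (fun z => w z * (G z)%:E) <= (x ^+ 2 / 2 * (M + 1))%:E)%E.
  have m1 : pmeas (fun z => (x ^+ 2 / 2)%:E * (w z * (density 1 f z)%:E))%E.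
    by apply: pmeasM; [exact: rmeas_cst|exact: pmeasM].
  have m2 : pmeas (fun z => (eta * x ^+ 2 + K * x ^+ 3)%:E * w z)%E.
    by apply: pmeasM; first exact: rmeas_cst.
  have xx : 0 <= x ^+ 2 / 2 by rewrite divr_ge0// ltW.
  apply: (@le_trans _ _ (int2 (fun z => (x ^+ 2 / 2)%:E * (w z * (density 1 f z)%:E) +
      (eta * x ^+ 2 + K * x ^+ 3)%:E * w z)%E)).
    apply: le_int2 => [||y|y].
    - exact: pmeasM.
    - exact: pmeasD.
    - by apply: mule_ge0 => //; rewrite lee_fin.
    rewrite muleCA -EFinM [X in (_ + X)%E]muleC -ge0_muleDr ?lee_fin//.
    apply: lee_wpmul2l => //; rewrite -EFinD lee_fin /G.
    have := D0 y; case: (S01 y) => [->|[-> _ _]]; last by rewrite mul1r.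
    by rewrite mul0r => h; exact: addr_ge0.
  rewrite int2D//; last 2 first.
  - by move=> y; rewrite !mule_ge0// ?lee_fin//; exact: density_ge0.
  - by move=> y; rewrite mule_ge0// lee_fin.
  rewrite int2Z//; last 2 first.
  - exact: pmeasM.
  - by move=> y; rewrite mule_ge0// lee_fin density_ge0.
  rewrite int2Z// IE; apply: le_trans (leeD (lee_wpmul2l _ HM) (lexx _)) _; first by rewrite lee_fin.
  rewrite -!EFinM -EFinD lee_fin.
  have -> : x ^+ 3 = x ^+ 2 * x by rewrite exprSr.
  (* The errors use at most x^2/4 of the x^2/2 that the + 1 in M + 1 provides. *)
  have : 0 <= x ^+ 2 * (1 / 2 - eta * I - x * K * I) by apply: mulr_ge0; clear - x2 etaI xKI; lra.
  by clear; nra.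
split.
  have wsup z : (Q z != 0%R -> emean w z x + 0%:E <= w z)%E.
    by move=> /SQ h; rewrite adde0; exact: (sw_mean sw).
  have := @test_lemma R w Q G H x 0 mw w0 mQ mG mH Q0 G0 H0 (lexx _) wsup (fun z _ => sub z) fin.
  rewrite mul0e add0e => HG.
  have xx : 0 < x ^+ 2 / 2 by rewrite divr_gt0.
  have mds : rmeas (density s F) by apply: rmeas_density; apply: hol_sub HF; exact: ltW.
  have mk : rmeas (fun z => x ^+ 2 / 2 * density s F z) by apply: rmeasM => //; exact: rmeas_cst.
  have d0 z : 0 <= density s F z by exact: density_ge0.
  apply: (@int2_scale_le w (density s F) (x ^+ 2 / 2) (M + 1) mw w0 mds d0 xx).
  apply: le_trans (le_trans HG GE); apply: le_int2 => [||y|y].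
  - exact: pmeasM.
  - exact: pmeasM.
  - by apply: mule_ge0 => //; rewrite lee_fin; apply: mulr_ge0 (d0 y); exact: ltW.
  apply: lee_wpmul2l => //; rewrite lee_fin /H; apply: ler_wpM2l; first exact: ltW.
  rewrite {1}/density; case: ltP => ys; last first.
    by rewrite mul0r; apply: mulr_ge0 => //; exact: density_ge0.
  have [_ qy] := qs _ ys.
  by rewrite /S /density qy (lt_le_trans ys sg) (lt_trans ys sr) !mul1r.
pose w' z := ((normc z < 1)%R%:R * (c * (1 - normc z ^+ 2)))%:E.
have w'0 z : (0 <= w' z)%E.
  rewrite lee_fin; case: ltP => z1; last by rewrite mul0r.
  by rewrite mul1r; apply: mulr_ge0; [exact: ltW|have := normc_ge0 z; clear - z1; nra].
have mw' : pmeas w'.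
  have m1 : rmeas (fun z : C => c * (1 - normc z ^+ 2)).
    by apply: rmeasM; [exact: rmeas_cst|apply: rmeasB; [exact: rmeas_cst|exact: rmeas_sqr]].
  exact: (rmeasM (@rmeas_disk R 1) m1).
have w'w z : (w' z <= w z)%E.
  rewrite /w'; case: ltP => z1; last by rewrite mul0r.
  by rewrite mul1r; exact: Hw.
have fin' : (int2 (fun z => w' z * (Q z)%:E) < +oo)%E.
  apply: le_lt_trans fin; apply: le_int2 => [|//|y|y].
  - exact: pmeasM.
  - by apply: mule_ge0 => //; rewrite lee_fin.
  - by apply: lee_wpmul2r => //; rewrite lee_fin.
have cx : 0 <= c * x ^+ 2 by rewrite mulr_ge0// ltW.
have wsup z : (Q z != 0%R -> emean w' z x + (c * x ^+ 2)%:E <= w' z)%E.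
  move=> /SQ zx; have z1 : normc z < 1 by apply: le_lt_trans zx; rewrite lerDl ltW.
  have c4 := cont_sub (@cont_cst _ 1) (@cont_sqr_circle R z (- x)).
  have c5 := cont_mul (@cont_cst _ c) c4.
  rewrite (emean_avg c5); last first.
    move=> t; have -> : z + x%:C * expi t = z - (- x)%:C * expi t by rewrite rmorphN/= mulNr opprK.
    rewrite /w' (_ : normc _ < 1) ?mul1r//.
    apply: le_lt_trans (le_normcB _ _) _.
    by rewrite normcM normc_real normc_expi mulr1 normrN gtr0_norm.
  rewrite avgZ// avgB//; [|exact: cont_cst|exact: cont_sqr_circle].
  by rewrite avg_cst avg_sqr_circle /w' z1 mul1r -EFinD lee_fin sqrrN; clear; lra.
have T := @test_lemma R w' Q G H x _ mw' w'0 mQ mG mH Q0 G0 H0 cx wsup (fun z _ => sub z) fin'.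
have T2 : ((c * x ^+ 2)%:E * int2 (EFin \o Q) <= (x ^+ 2 / 2 * (M + 1))%:E)%E.
  apply: le_trans GE; apply: (@le_trans _ _ (int2 (fun z => w' z * (G z)%:E)%E)); last first.
    apply: le_int2 => [||y|y]; [exact: pmeasM|exact: pmeasM| |].
      by apply: mule_ge0 => //; rewrite lee_fin.
    by apply: lee_wpmul2r => //; rewrite lee_fin.
  apply: le_trans T; apply: leeDl; apply: int2_ge0 => y.
  by apply: mule_ge0 => //; rewrite lee_fin.
rewrite -(@lee_pmul2l R (x ^+ 2)%:E) ?lte_fin//.
rewrite muleA -EFinM -EFinM (mulrC (x ^+ 2) c).
have -> : x ^+ 2 * ((M + 1) / 2) = x ^+ 2 / 2 * (M + 1) by field.
apply: le_trans T2; apply: lee_wpmul2l; first by rewrite lee_fin.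
have mUu : measurable_fun (cdisk s) (fun p => Re (F (toC p)) ^+ 2 - Re (f (toC p)) ^+ 2).
  have [mF _] := measurable_hol (hol_sub (ltW sr) HF).
  have [mf _] := measurable_hol (hol_sub (ltW (lt_trans sr r1)) Hf).
  by apply: measurable_funB; under eq_fun do rewrite expr2; exact: measurable_funM.
apply: le_int2 => [|//|y|y].
- exact: (rmeas_cut (g := fun z => Re (F z) ^+ 2 - Re (f z) ^+ 2)).
- rewrite lee_fin; case: ltP => ys; last by rewrite mul0r.
  by rewrite mul1r; exact: HU (lt_trans ys sr).
rewrite lee_fin; case: ltP => ys; last by rewrite mul0r.
have [qy1 qy2] := qs _ ys.
by rewrite mul1r /Q /S qy2 (lt_le_trans ys sg) !mul1r.
Qed.
End Energy.

(** * Limits of holomorphic functions *)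

Section Limits.
Variable R : realType.
Local Notation C := R[i].
Implicit Types (z : C) (f F : C -> C) (x y : nat -> C).

Definition ccvg x (l : C) := forall e, 0 < e ->
  exists N, forall n, (N <= n)%N -> normc (x n - l) <= e.

(* [u + K a] is nondecreasing. *)
Lemma real_dominated_cvg (u a : nat -> R) (K A : R) N : 0 <= K ->
  (forall n m, (n <= m)%N -> a n <= a m) -> (forall n, a n <= A) ->
  (forall n m, (N <= n <= m)%N -> `|u m - u n| <= K * (a m - a n)) ->
  exists l, forall e, 0 < e -> exists N, forall n, (N <= n)%N -> `|u n - l| <= e.
Proof.
move=> K0 am aA H.
have toeps (v : nat -> R) : cvgn v -> exists l, forall e, 0 < e ->
    exists N, forall n, (N <= n)%N -> `|v n - l| <= e.
  move=> cv; exists (limn v) => e e0.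
  have /cvgrPdist_le/(_ e e0)[N' _ HN'] : v @ \oo --> limn v by exact: cv.
  by exists N' => n /HN'; rewrite distrC.
have [k Hk] : exists l, forall e, 0 < e -> exists N, forall n, (N <= n)%N -> `|a n - l| <= e.
  apply: toeps; apply: nondecreasing_is_cvgn; first by move=> n m; exact: am.
  by exists A => _ [n _ <-].
pose v n := u n + K * a n.
have [l Hl] : exists l, forall e, 0 < e -> exists N, forall n, (N <= n)%N -> `|v n - l| <= e.
  apply: toeps; apply: (@near_nondecreasing_is_cvgn R v (u N + K * (A - a N) + K * A)).
    exists N => // n /= Nn m nm; have := H n m; rewrite Nn nm => /(_ isT).
    by rewrite ler_norml /v => /andP[h _]; lra.
  exists N => // n /= Nn; have := H N n; rewrite leqnn Nn => /(_ isT).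
  have := ler_wpM2l K0 (aA n); rewrite /v ler_norml => h /andP[_ h2]; nra.
have K1 : 0 < K + 1 by lra.
exists (l - K * k) => e e0.
have [|N1 H1] := Hl (e / 2); first by lra.
have [|N2 H2] := Hk (e / 2 / (K + 1)); first by apply: divr_gt0 => //; lra.
exists (maxn N1 N2) => n; rewrite geq_max => /andP[/H1 h1 /H2 h2].
have h3 : `|a n - k| * (K + 1) <= e / 2 by rewrite -ler_pdivlMr.
have -> : u n - (l - K * k) = (v n - l) - K * (a n - k) by rewrite /v; ring.
apply: le_trans (ler_normB _ _) _; rewrite normrM (ger0_norm K0).
by have := normr_ge0 (a n - k); nra.
Qed.

Lemma ccvg_dominated x (a : nat -> R) (K A : R) N : 0 <= K ->
  (forall n m, (n <= m)%N -> a n <= a m) -> (forall n, a n <= A) ->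
  (forall n m, (N <= n <= m)%N -> normc (x m - x n) <= K * (a m - a n)) ->
  exists l, ccvg x l.
Proof.
move=> K0 am aA H.
have [|p Hp] := real_dominated_cvg (u := fun n => Re (x n)) (N := N) K0 am aA.
  move=> n m /H; apply: le_trans; rewrite -cReN -cReD; exact: normr_Re.
have [|q Hq] := real_dominated_cvg (u := fun n => Im (x n)) (N := N) K0 am aA.
  move=> n m /H; apply: le_trans; rewrite -cImN -cImD; exact: normr_Im.
exists (p +i* q) => e e0; have e2 : 0 < e / 2 by lra.
have [N1 H1] := Hp _ e2; have [N2 H2] := Hq _ e2.
exists (maxn N1 N2) => n; rewrite geq_max => /andP[/H1 h1 /H2 h2].
apply: le_trans (normc_le _) _; rewrite cReD cImD cReN cImN.
by rewrite (splitr e); exact: lerD.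
Qed.

Lemma ccvgD x y l k : ccvg x l -> ccvg y k -> ccvg (fun n => x n + y n) (l + k).
Proof.
move=> Hx Hy e e0; have e2 : 0 < e / 2 by lra.
have [N1 H1] := Hx _ e2; have [N2 H2] := Hy _ e2.
exists (maxn N1 N2) => n; rewrite geq_max => /andP[/H1 h1 /H2 h2].
have -> : x n + y n - (l + k) = (x n - l) + (y n - k) by ring.
by apply: le_trans (le_normcD _ _) _; rewrite (splitr e); exact: lerD.
Qed.

Lemma ccvgZ x l c : ccvg x l -> ccvg (fun n => c * x n) (c * l).
Proof.
move=> Hx e e0; have n0 := normc_ge0 c; have c1 : 0 < normc c + 1 by lra.
have [|N H] := Hx (e / (normc c + 1)); first exact: divr_gt0.
exists N => n /H; rewrite -mulrBr normcM ler_pdivlMr// => h.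
by have := normc_ge0 (x n - l); nra.
Qed.

Lemma ccvg_le x l B N : ccvg x l -> (forall n, (N <= n)%N -> normc (x n) <= B) -> normc l <= B.
Proof.
move=> Hx HB; rewrite leNgt; apply/negP => lB.
have [|N1 H1] := Hx ((normc l - B) / 2); first by lra.
have := HB (maxn N N1) (leq_maxl _ _); have := H1 (maxn N N1) (leq_maxr _ _).
set k := x _ => h1 h2; have := le_normcBD l k; rewrite normcBC; lra.
Qed.

Lemma ccvg_Re_ge x l (b : R) N : ccvg x l -> (forall n, (N <= n)%N -> b <= Re (x n)) -> b <= Re l.
Proof.
move=> Hx HB; rewrite leNgt; apply/negP => lB.
have [|N1 H1] := Hx ((b - Re l) / 2); first by lra.
have := HB (maxn N N1) (leq_maxl _ _); have := H1 (maxn N N1) (leq_maxr _ _).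
set k := x _ => h1 h2; have := normr_Re (k - l); rewrite cReD cReN ler_norml; lra.
Qed.

Lemma holB rad f F : hol rad f -> hol rad F -> hol rad (fun z => f z - F z).
Proof.
move=> Hf HF z zr; have [a Ha] := Hf z zr; have [b Hb] := HF z zr.
exists (a + -1 * b); apply: (cderiv_ext (r := 1)) (cderivD Ha (cderivZ (-1) Hb)) => // h _.
by rewrite mulN1r.
Qed.

Lemma dcB rad f F z : hol rad f -> hol rad F -> normc z < rad ->
  dc (fun z => f z - F z) z = dc f z - dc F z.
Proof.
move=> Hf HF zr; have Ha := hol_cderiv Hf zr; have Hb := hol_cderiv HF zr.
apply: dcE; rewrite -mulN1r; apply: (cderiv_ext (r := 1)) (cderivD Ha (cderivZ (-1) Hb)) => // h _.
by rewrite mulN1r.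
Qed.

Lemma dc_bound rad f s r B : hol rad f -> s < r -> 0 < r < rad ->
  (forall t, normc (f (circle 0 r t)) <= B) ->
  forall z, normc z <= s -> normc (dc f z) <= 2 * (B * (r / (r - s) / (r - s))).
Proof.
move=> Hf sr r01 HB z zs; have /andP[r0 r1] := r01.
have zr : normc (z - 0) < r by rewrite subr0; exact: le_lt_trans zs sr.
have zr' : normc z < r by exact: le_lt_trans zs sr.
rewrite (hol_dcE Hf r01 zr') /cauchy_int'; apply: normc_cavg_cst.
  apply: ccontM; first exact: ccont_hol_circle Hf r01.
  apply: ccontM; first exact: ccont_kernel.
  apply: ccontV; last by move=> t; exact: circle_neq.
  by apply: ccontB; [exact: ccont_circle|exact: ccont_cst].
move=> t; rewrite normcM; apply: ler_pM; [exact: normc_ge0|exact: normc_ge0|exact: HB|].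
rewrite normcM normcV; apply: ler_pM; [exact: normc_ge0|by rewrite invr_ge0 normc_ge0| |].
  exact: normc_kernel.
rewrite lef_pV2 ?posrE ?normc_gt0 ?circle_neq ?subr_gt0//.
have := le_normcBD (circle 0 r t) z; rewrite circle0_norm//; clear - zs; lra.
Qed.

(** One bounded monotone sequence [a] controls the functions and, by Cauchy estimates, their
    derivatives, so both converge pointwise. Letting n tend to infinity in the Taylor bound, whose
    constant is uniform in n, differentiates the limit. *)
Theorem hol_limit (F : nat -> C -> C) (a : nat -> R) (A : R) :
  (forall n m, (n <= m)%N -> a n <= a m) -> (forall n, a n <= A) ->
  (forall s, 0 < s < 1 -> exists N K, [/\ 0 <= K, forall n, (N <= n)%N -> hol s (F n) &
     forall n m z, (N <= n <= m)%N -> normc z < s -> normc (F m z - F n z) <= K * (a m - a n)]) ->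
  exists2 G, hol 1 G & forall z, normc z < 1 ->
    ccvg (fun n => F n z) (G z) /\ ccvg (fun n => dc (F n) z) (dc G z).
Proof.
move=> am aA H.
have [G HG] : exists G : C -> C, forall z, normc z < 1 -> ccvg (fun n => F n z) (G z).
  have : forall z, exists l, normc z < 1 -> ccvg (fun n => F n z) l.
    move=> z; case: (ltP (normc z) 1) => [z1|_]; last by exists 0.
    have n0 := normc_ge0 z.
    have [|N [K [K0 _ HK]]] := H ((normc z + 1) / 2); first by apply/andP; split; lra.
    have [|l Hl] := ccvg_dominated (x := fun n => F n z) (N := N) K0 am aA.
      by move=> n m nm; apply: HK => //; lra.
    by exists l.
  by move=> /choice[p Hp]; exists p.
(* z and z + h live in the disk of radius s1, Cauchy's integral runs over the circle s2, and the
   hypothesis is used on the disk s3. *)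
have loc z : normc z < 1 -> exists s1 s2 s3, [/\ normc z < s1, s1 < s2, 0 < s2 < s3 & s3 < 1].
  move=> z1; have n0 := normc_ge0 z; exists ((3 * normc z + 1) / 4).
  exists ((normc z + 1) / 2), ((normc z + 3) / 4).
  by split; [lra|lra|apply/andP; split; lra|lra].
have [g Hg] : exists g : C -> C, forall z, normc z < 1 -> ccvg (fun n => dc (F n) z) (g z).
  have : forall z, exists l, normc z < 1 -> ccvg (fun n => dc (F n) z) l.
    move=> z; case: (ltP (normc z) 1) => [z1|_]; last by exists 0.
    have [s1 [s2 [s3 [zs1 s12 s23 s31]]]] := loc _ z1.
    have /andP[s20 s23'] := s23.
    have s30 : 0 < s3 < 1 by rewrite s31 (lt_trans s20 s23').
    have [N [K [K0 HF HK]]] := H _ s30.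
    pose k := 2 * (K * (s2 / (s2 - s1) / (s2 - s1))).
    have s210 : 0 < s2 - s1 by rewrite subr_gt0.
    have k0 : 0 <= k.
      apply: mulr_ge0 => //; apply: mulr_ge0 => //.
      by apply: divr_ge0; [apply: divr_ge0; exact: ltW|exact: ltW].
    have [|l Hl] := ccvg_dominated (x := fun n => dc (F n) z) (N := N) k0 am aA; last by exists l.
    move=> n m nm; have /andP[Nn nm'] := nm; have Nm := leq_trans Nn nm'.
    have zs3 : normc z < s3 by exact: lt_trans zs1 (lt_trans s12 s23').
    rewrite -(dcB (HF _ Nm) (HF _ Nn) zs3).
    have := dc_bound (holB (HF _ Nm) (HF _ Nn)) s12 s23 (B := K * (a m - a n)) _ (ltW zs1).
    have -> : k * (a m - a n) = 2 * (K * (a m - a n) * (s2 / (s2 - s1) / (s2 - s1))).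
      by rewrite /k; ring.
    by apply => t; apply: HK => //; rewrite circle0_norm.
  by move=> /choice[p Hp]; exists p.
have Gg z : normc z < 1 -> cderiv G z (g z).
  move=> z1.
  have [s1 [s2 [s3 [zs1 s12 s23 s31]]]] := loc _ z1.
  have /andP[s20 s23'] := s23.
  have s30 : 0 < s3 < 1 by rewrite s31 (lt_trans s20 s23').
  have [N [K [K0 HF HK]]] := H _ s30.
  have [B B0 HB] := cont_circle_bounded (ccont_hol_circle (HF _ (leqnn N)) s23).
  (* A bound for all F n, n >= N, on the circle s2: that of F N plus the total variation left in
     [a]. *)
  pose D := B + K * (A - a N).
  have FD n t : (N <= n)%N -> normc (F n (circle 0 s2 t)) <= D.
    move=> Nn; apply: le_trans (le_normcBD _ (F N (circle 0 s2 t))) _.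
    rewrite /D addrC; apply: lerD (HB t) _.
    apply: le_trans (HK N n (circle 0 s2 t) _ _) _; first by rewrite leqnn.
      by rewrite circle0_norm.
    by apply: ler_wpM2l => //; rewrite lerB// aA.
  pose k := 2 * (D * (s2 / (s2 - s1) ^+ 3)).
  have k0 : 0 <= k.
    apply: mulr_ge0 => //; apply: mulr_ge0.
      by apply: le_trans (FD N 0 (leqnn N)); exact: normc_ge0.
    by apply: divr_ge0; [exact: ltW|rewrite exprn_ge0// subr_ge0 ltW].
  move=> e e0; pose d := Num.min (s1 - normc z) (e / (k + 1)).
  have k1 : 0 < k + 1 by clear - k0; lra.
  have d0 : 0 < d by rewrite lt_min subr_gt0 zs1 divr_gt0.
  exists d => // h; rewrite le_min => /andP[h1 h2].
  have zh : normc (z + h) <= s1 by apply: le_trans (le_normcD _ _) _; clear - h1; lra.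
  have zh1 : normc (z + h) < 1.
    by apply: le_lt_trans zh _; exact: lt_trans s12 (lt_trans s23' s31).
  have L : ccvg (fun n => F n (z + h) + -1 * F n z + - h * dc (F n) z) (G (z + h) + -1 * G z + - h * g z).
    by apply: ccvgD; [apply: ccvgD; [exact: HG|apply: ccvgZ; exact: HG]|apply: ccvgZ; exact: Hg].
  have T n : (N <= n)%N -> normc (F n (z + h) + -1 * F n z + - h * dc (F n) z) <= k * normc h ^+ 2.
    move=> Nn; rewrite mulN1r mulNr (mulrC h).
    exact: hol_taylor (HF _ Nn) s12 s23 (fun t => FD n t Nn) z h (ltW zs1) zh.
  have := ccvg_le L T; rewrite mulN1r mulNr (mulrC h) => /le_trans; apply.
  rewrite expr2 mulrA; apply: ler_wpM2r; first exact: normc_ge0.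
  have : normc h * (k + 1) <= e by rewrite -ler_pdivlMr.
  by have := normc_ge0 h; clear; lra.
exists G => [z z1|z z1]; first by exists (g z); exact: Gg.
by rewrite (dcE (Gg z z1)); split; [exact: HG|exact: Hg].
Qed.
End Limits.

(** * The increasing family of majorants *)

Section MajorantFamily.
Variable R : realType.
Local Notation C := R[i].
Implicit Types (W w V : C -> \bar R) (z : C) (f F : C -> C).

(** On the circle of radius r the larger majorant dominates |Re f|, which is the boundary function
    of the smaller one. *)
Lemma le_majorantS f r r' z : hol 1 f -> 0 < r -> r < r' < 1 -> normc z < r ->
  Re (majorant f r z) <= Re (majorant f r' z).
Proof.
move=> Hf r0 /andP[rr r1] zr; have r01 : 0 < r < 1 by rewrite r0 (lt_trans rr).
have r01' : 0 < r' < 1 by rewrite r1 (lt_trans r0).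
have rr0 : 0 < r < r' by rewrite r0.
have HF := majorant_hol Hf r01'; have cp := poisson_cont zr.
rewrite majorantE// (poisson_formula HF rr0 zr); apply: le_avg => [||t].
- by apply: cont_mul => //; exact: trace_cont.
- by apply: cont_mul => //; apply: ccont_Re; exact: ccont_hol_circle rr0.
- apply: ler_wpM2r; first exact: poisson_ge0.
  by apply: le_majorant => //; rewrite circle0_norm.
Qed.

Lemma majorant0 f r : hol 1 f -> 0 < r < 1 -> majorant f r 0 = (Re (majorant f r 0))%:C.
Proof.
by move=> Hf r01; rewrite /majorant herglotz0//; [case/andP: r01|exact: trace_cont].
Qed.

Lemma majorant_harnack f r z : hol 1 f -> 0 < r < 1 -> normc z <= r / 2 ->
  Re (majorant f r 0) / 3 <= Re (majorant f r z).
Proof.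
move=> Hf r01 zr; have [r0 r1] := andP r01.
have zr' : normc z < r by apply: le_lt_trans zr _; lra.
have ct := trace_cont Hf r01; have cp := poisson_cont zr'.
rewrite (majorantE (z := z))// /majorant herglotz0// [Re _]/= mulrC -avgZ//.
apply: le_avg => [||t].
- by apply: cont_mul => //; exact: cont_cst.
- exact: cont_mul.
- rewrite mulrC; apply: ler_wpM2l; first exact: normr_ge0.
  by have := poisson_harnack t r0 zr; rewrite div1r.
Qed.

(* The difference of two majorants has nonnegative real part, so its size is
   controlled by its value at 0. *)
Lemma majorant_diff f r r' s t z : hol 1 f -> 0 < s < t -> t < r -> r < r' < 1 -> normc z < s ->
  normc (majorant f r' z - majorant f r z) <=
  (4 * (t / (t - s)) + 1) * (Re (majorant f r' 0) - Re (majorant f r 0)).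
Proof.
move=> Hf /andP[s0 st] tr rr1 zs; have [rr r1] := andP rr1.
have t0 := lt_trans s0 st; have r0 := lt_trans t0 tr.
have r01 : 0 < r < 1 by rewrite r0 (lt_trans rr).
have r01' : 0 < r' < 1 by rewrite r1 (lt_trans r0).
have t0r : 0 < t < r by rewrite t0.
have HD := holB (hol_sub (ltW rr) (majorant_hol Hf r01')) (majorant_hol Hf r01).
have D0 y : 0 <= Re (majorant f r' (circle 0 t y) - majorant f r (circle 0 t y)).
  by rewrite cReD cReN subr_ge0; apply: le_majorantS; rewrite ?circle0_norm.
have := schwarz_bound HD t0r st (ltW zs) D0.
have -> : majorant f r' 0 - majorant f r 0 = (Re (majorant f r' 0) - Re (majorant f r 0))%:C.
  by rewrite {1}majorant0// {1}(majorant0 Hf r01) -(rmorphB (real_complex R)).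
have : 0 <= Re (majorant f r' 0) - Re (majorant f r 0).
  by rewrite subr_ge0; apply: le_majorantS => //; rewrite normc0.
rewrite conjc_real; move: (_ - _ : R) => d d0 H.
rewrite -[X in normc X](addrK d%:C); apply: le_trans (le_normcB _ _) _.
by rewrite normc_real ger0_norm// mulrDl mul1r lerD2r.
Qed.

(** On |z| < 1/4 <= r/2 Harnack's inequality gives U >= U(0)/3, while |u| <= B. The bound on the
    integral of U^2 - u^2 in [energy] therefore bounds U(0)^2, uniformly in r. *)
Lemma majorant0_bound w c f (M : R) : sup_weight w -> 0 < c ->
  (forall z, normc z < 1 -> ((c * (1 - normc z ^+ 2))%:E <= w z)%E) ->
  hol 1 f -> (int2 (fun z => w z * (density 1 f z)%:E) <= M%:E)%E ->
  exists A, forall r, 1 / 2 <= r < 1 -> Re (majorant f r 0) <= A.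
Proof.
move=> sw c0 Hw Hf HM.
have q1 : 1 / 4 < 1 :> R by lra.
have [B B0 HB] := hol_bounded ltr01 Hf q1.
pose chi (z : C) : R := (normc z < 1 / 4)%R%:R.
have mchi : rmeas chi by exact: rmeas_disk.
have chi0 z : 0 <= chi z by rewrite /chi.
have chil : (int2 (fun z => (chi z)%:E : \bar R) < +oo)%E by exact: int2_square_lty.
have q0 : 0 < 1 / 4 :> R by lra.
have chig := int2_square_gt0 (0 : C) q0.
have chig' : (0 < int2 (fun z => (chi z)%:E : \bar R))%E.
  by move: chig; under eq_fun do rewrite subr0.
have chif : int2 (fun z => (chi z)%:E : \bar R) \is a fin_num by rewrite ge0_fin_numE// ltW.
pose al := fine (int2 (fun z => (chi z)%:E : \bar R)).
have alE : int2 (fun z => (chi z)%:E : \bar R) = al%:E by rewrite fineK.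
have al0 : 0 < al by rewrite -lte_fin -alE.
pose K := 9 * ((M + 1) / 2 / c / al + B ^+ 2).
(* The estimate obtained is a^2 <= K, whence a <= 1 + |K|. *)
exists (1 + `|K|) => r /andP[r12 r1]; set a := Re _.
have r01 : 0 < r < 1 by rewrite r1 andbT; lra.
have sr : 0 < (1 / 4 : R) < r by apply/andP; split=> //; lra.
have [T HT] := trace_bounded Hf r01.
have FB z : normc z < r -> `|Re (f z)| <= Re (majorant f r z) <= T.
  move=> zr; rewrite le_majorant//=; apply: majorant_le => // t.
  exact: le_trans (ler_norm _) (HT t).
have [_ E2] := energy sw c0 Hw Hf HM sr r1 (majorant_hol Hf r01) FB
  (fun e e0 => majorant_boundary Hf r01 e0).
set J := int2 _ in E2.
have J1 : (J <= ((M + 1) / 2 / c)%:E)%E.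
  by rewrite -(@lee_pmul2l R c%:E) ?lte_fin// -EFinM (mulrC c) divfK// gt_eqF.
have a0 : 0 <= a by apply: le_trans (le_majorant Hf r01 _); rewrite ?normc0//; case/andP: r01.
have gq z : (normc z < 1 / 4)%R%:R * (Re (majorant f r z) ^+ 2 - Re (f z) ^+ 2) >= 0 :> R.
  case: ltP => zr; last by rewrite mul0r.
  have zr' : normc z < r by apply: lt_trans zr _; case/andP: sr.
  have /andP[h _] := FB z zr'.
  rewrite mul1r subr_ge0 -(real_normK (num_real (Re (f z)))).
  by apply: lerXn2r; rewrite ?nnegrE//; exact: le_trans h.
have mg : rmeas (fun z => (normc z < 1 / 4)%R%:R * (Re (majorant f r z) ^+ 2 - Re (f z) ^+ 2)).
  apply: (rmeas_cut (g := fun z => Re (majorant f r z) ^+ 2 - Re (f z) ^+ 2)).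
  have [mF _] := measurable_hol (hol_sub (ltW (andP sr).2) (majorant_hol Hf r01)).
  have [mf _] := measurable_hol (hol_sub (ltW q1) Hf).
  by apply: measurable_funB; under eq_fun do rewrite expr2; exact: measurable_funM.
have a2 : 0 <= a ^+ 2 / 9 by rewrite divr_ge0// sqr_ge0.
have key : ((a ^+ 2 / 9 * al)%:E <= J + (B ^+ 2 * al)%:E)%E.
  rewrite !EFinM -alE -!int2Z ?lee_fin ?sqr_ge0//.
  have mB : pmeas (fun z => (B ^+ 2)%:E * (chi z)%:E)%E by apply: pmeasM; first exact: rmeas_cst.
  have B2 : 0 <= B ^+ 2 by exact: sqr_ge0.
  rewrite -int2D//; last by move=> y; rewrite -EFinM lee_fin mulr_ge0.
  apply: le_int2 => [||y|y].
  - by apply: pmeasM; first exact: rmeas_cst.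
  - exact: pmeasD.
  - by rewrite -EFinM lee_fin mulr_ge0.
  rewrite -!EFinM -EFinD lee_fin /chi; case: ltP => yr; last by rewrite !mulr0 mul0r addr0.
  have yr' : normc y <= r / 2 by apply: ltW; apply: lt_le_trans yr _; clear - r12; lra.
  have h1 := majorant_harnack Hf r01 yr'; rewrite -/a in h1.
  have [h2 _ _] := HB y (ltW yr).
  have h3 : `|Re (f y)| <= B by exact: le_trans (normr_Re _) h2.
  have h4 : Re (f y) ^+ 2 <= B ^+ 2.
    by rewrite -(real_normK (num_real (Re (f y)))); apply: lerXn2r; rewrite ?nnegrE// ltW.
  have h5 : (a / 3) ^+ 2 <= Re (majorant f r y) ^+ 2.
    by apply: lerXn2r; rewrite ?nnegrE//; [|apply: le_trans h1]; rewrite divr_ge0.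
  rewrite !mulr1 mul1r; clear - h4 h5; move: (Re (f y) ^+ 2) (Re (majorant f r y) ^+ 2) h4 h5 => u v; lra.
have := le_trans key (leeD J1 (lexx _)); rewrite -EFinD lee_fin => {}key.
have h : a ^+ 2 <= K.
  rewrite -(ler_pM2r (x := al / 9)) ?divr_gt0//.
  have -> : K * (al / 9) = (M + 1) / 2 / c + B ^+ 2 * al.
    by rewrite /K; field; rewrite !gt_eqF.
  by apply: le_trans key; lra.
have := ler_norm K; clear - h a0; nra.
Qed.
End MajorantFamily.

(** * The limiting majorant *)

Section MajorantLimit.
Variable R : realType.
Local Notation C := R[i].
Implicit Types (W w V : C -> \bar R) (z : C) (f F : C -> C).

Lemma truncation_cvg (v : \bar R) (d : R) : (0 <= v)%E -> 0 <= d ->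
  (fun n : nat => mine v n%:R%:E * d%:E)%E @ \oo --> (v * d%:E)%E.
Proof.
case: v => [v| |//] v0 d0.
  apply: cvg_near_cst; have [N _ HN] := (cvgryPge (fun n => n%:R : R)).1 cvgr_idn v.
  exists N => // n /= /HN h; congr (_ * _)%E; apply/min_idPl; rewrite lee_fin; exact: h.
have [->|dn0] := eqVneq d 0.
  by rewrite mule0; under eq_fun do rewrite mule0; exact: cvg_cst.
have dp : 0 < d by rewrite lt_def dn0.
rewrite gt0_mulye ?lte_fin//; apply/cvgeyPge => A.
have [N _ HN] := (cvgryPge (fun n => n%:R : R)).1 cvgr_idn (A / d).
exists N => // n /= /HN h; rewrite (_ : mine +oo n%:R%:E = n%:R%:E)%E; last first.
  by apply/min_idPr; exact: leey.
by rewrite -EFinM lee_fin -ler_pdivrMr.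
Qed.

Lemma cvg_EFinM (v : R) (x : nat -> R) (l : R) : x @ \oo --> l ->
  (fun n => v%:E * (x n)%:E)%E @ \oo --> (v%:E * l%:E)%E.
Proof.
move=> L; rewrite -EFinM; apply: cvg_EFin; first by apply: nearW => n; rewrite -EFinM.
by apply: (cvgM _ L); exact: cvg_cst.
Qed.

Lemma ccvg_normc_sqr (x : nat -> C) l : ccvg x l ->
  (fun n => normc (x n) ^+ 2) @ \oo --> normc l ^+ 2.
Proof.
move=> H; have c : (fun n => normc (x n)) @ \oo --> normc l.
  apply/cvgrPdist_le => e /H[N HN]; exists N => // n /= /HN h.
  by rewrite distrC; apply: le_trans (ler_dist_normc _ _) h.
by under eq_fun do rewrite expr2; rewrite expr2; exact: cvgM.
Qed.

(* The weight is truncated because [w z * x] is not continuous in [x] at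
   [x = 0] when [w z] is infinite. *)
Lemma density_fatou w (F : nat -> C -> C) (G : C -> C) (s : nat -> R) (M : \bar R) :
  pmeas w -> (forall z, 0 <= w z)%E ->
  (forall n, rmeas (density (s n) (F n))) -> rmeas (density 1 G) -> (forall n, s n <= 1) ->
  (forall z, normc z < 1 -> exists N, forall n, (N <= n)%N -> normc z < s n) ->
  (forall z, normc z < 1 -> ccvg (fun n => dc (F n) z) (dc G z)) ->
  (forall n, int2 (fun z => w z * (density (s n) (F n) z)%:E) <= M)%E ->
  (int2 (fun z => w z * (density 1 G z)%:E) <= M)%E.
Proof.
move=> mw w0 md mG s1 sl HFG EF.
have mtr k : pmeas (fun z => mine (w z) k%:R%:E).
  by apply: measurable_mine => //; exact: measurable_cst.
have tr0 k z : (0 <= mine (w z) k%:R%:E)%E by rewrite le_min w0 lee_fin ler0n.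
apply: (fatou_bound (F := fun k z => mine (w z) k%:R%:E * (density 1 G z)%:E)%E).
- by move=> k; exact: (pmeasM (mtr k) mG).
- by move=> k z; rewrite mule_ge0// lee_fin density_ge0.
- move=> k; apply: (fatou_bound (F := fun n z => mine (w z) k%:R%:E * (density (s n) (F n) z)%:E)%E).
  + by move=> n; exact: (pmeasM (mtr k) (md n)).
  + by move=> n z; rewrite mule_ge0// lee_fin density_ge0.
  + move=> n; apply: le_trans (EF n); apply: le_int2 => [||z|z].
    * exact: (pmeasM (mtr k) (md n)).
    * exact: (pmeasM mw (md n)).
    * by rewrite mule_ge0// lee_fin density_ge0.
    * apply: lee_wpmul2r; first by rewrite lee_fin density_ge0.
      by rewrite ge_min lexx.
  move=> z; cbv beta.
  have [v ->] : exists v : R, mine (w z) k%:R%:E = v%:E.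
    exists (fine (mine (w z) k%:R%:E)); rewrite fineK// ge0_fin_numE//.
    by apply: (@le_lt_trans _ _ k%:R%:E); [rewrite ge_min lexx orbT|exact: ltry].
  suff L : (fun n => density (s n) (F n) z) @ \oo --> density 1 G z.
    exact: (@cvg_EFinM v (fun n => density (s n) (F n) z) _ L).
  rewrite /density; case: (ltP (normc z) 1) => z1; last first.
    rewrite mul0r; apply: cvg_near_cst; apply: nearW => n.
    rewrite ltNge (_ : s n <= normc z) ?mul0r//; exact: le_trans (s1 n) z1.
  rewrite mul1r; apply: cvg_trans (ccvg_normc_sqr (HFG z z1)).
  apply: near_eq_cvg; have [N HN] := sl z z1; exists N => // n /= /HN ->.
  by rewrite mul1r.
- by move=> z; apply: truncation_cvg => //; exact: density_ge0.
Qed.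

Theorem harmonic_majorant w f : sup_weight w -> hol 1 f ->
  (int2 (fun z => w z * (density 1 f z)%:E) < +oo)%E ->
  exists F, [/\ hol 1 F, (int2 (fun z => w z * (density 1 F z)%:E) < +oo)%E &
    forall z, normc z < 1 -> `|Re (f z)| <= Re (F z)].
Proof.
move=> sw Hf Hfin; have [c c0 Hw] := hopf sw.
have w0 := sw_ge0 sw; have mw := sw_pmeas sw.
set E := int2 _ in Hfin; pose M := fine E.
have E0 : (0 <= E)%E by apply: int2_ge0 => z; rewrite mule_ge0// lee_fin density_ge0.
have HM : (int2 (fun z => w z * (density 1 f z)%:E) <= M%:E)%E.
  by rewrite -/E /M fineK// ge0_fin_numE.
have [A HA] := majorant0_bound sw c0 Hw Hf HM.
(* Starting at 1/3 makes s n = 1 - 2 e n positive and r n = 1 - e n at least 1/2 already for n =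
   0. *)
pose e (n : nat) : R := n.+3%:R^-1.
have e0 n : 0 < e n by rewrite invr_gt0.
have e3 n : e n <= 1 / 3 by rewrite div1r lef_pV2 ?posrE// ler_nat.
have em n m : (n <= m)%N -> e m <= e n by move=> nm; rewrite lef_pV2 ?posrE// ler_nat.
have elim x : 0 < x -> exists N, forall n, (N <= n)%N -> e n < x.
  move=> x0; have [N _ HN] := near_infty_natSinv_lt (PosNum x0).
  exists N => n /HN; apply: le_lt_trans; rewrite lef_pV2 ?posrE// ler_nat; exact: leqW.
pose r n := 1 - e n; pose s n := 1 - 2 * e n.
have r12 n : 1 / 2 <= r n < 1.
  by have := e0 n; have := e3 n; rewrite /r => h1 h2; apply/andP; split; lra.
have r01 n : 0 < r n < 1 by have /andP[h1 h2] := r12 n; rewrite h2 andbT; lra.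
have sr n : 0 < s n < r n.
  by have := e0 n; have := e3 n; rewrite /r /s => h1 h2; apply/andP; split; lra.
have rm n m : (n <= m)%N -> r n <= r m by move=> /em; rewrite /r => h; lra.
pose F n := majorant f (r n); pose a n := Re (F n 0).
have HF n : hol (r n) (F n) by exact: majorant_hol.
have am n m : (n <= m)%N -> a n <= a m.
  move=> /rm; rewrite le_eqVlt /a /F => /orP[/eqP->//|h].
  apply: le_majorantS => //; first by case/andP: (r01 n).
    by rewrite h; case/andP: (r01 m).
  by rewrite normc0; case/andP: (r01 n).
have aA n : a n <= A by exact: HA.
have [G HG HFG] : exists2 G, hol 1 G & forall z, normc z < 1 ->
    ccvg (fun n => F n z) (G z) /\ ccvg (fun n => dc (F n) z) (dc G z).
  apply: (hol_limit am aA) => t /andP[t0 t1].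
  pose t' := (1 + t) / 2.
  have [tt t1'] : t < t' /\ t' < 1 by rewrite /t'; split; lra.
  have [|N HN] := elim (1 - t'); first by lra.
  have tr n : (N <= n)%N -> t' < r n by move=> /HN; rewrite /r; lra.
  exists N, (4 * (t' / (t' - t)) + 1).
  have k0 : 0 <= 4 * (t' / (t' - t)) + 1.
    by apply: addr_ge0 => //; apply: mulr_ge0 => //; apply: divr_ge0; lra.
  split=> // [n /tr h|n m z /andP[Nn nm] zt].
    by apply: hol_sub (HF n); apply: ltW; exact: lt_trans h.
  have := rm _ _ nm; rewrite le_eqVlt => /orP[/eqP rE|rr].
    by rewrite /a /F rE !subrr normc0 mulr0.
  apply: majorant_diff => //; [by rewrite t0|exact: tr|by rewrite rr; case/andP: (r01 m)].
have sl z : normc z < 1 -> exists N, forall n, (N <= n)%N -> normc z < s n.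
  move=> z1; have [|N HN] := elim ((1 - normc z) / 2); first by lra.
  by exists N => n /HN; rewrite /s; lra.
exists G; split; [exact: HG| |]; last first.
  move=> z z1; have [N HN] := sl z z1; apply: (ccvg_Re_ge (HFG z z1).1 (N := N)) => n /HN zs.
  by apply: le_majorant => //; apply: lt_trans zs _; case/andP: (sr n).
apply: (@le_lt_trans _ _ (M + 1)%:E); last exact: ltry.
have EF n : (int2 (fun z => w z * (density (s n) (F n) z)%:E) <= (M + 1)%:E)%E.
  have [T HT] := trace_bounded Hf (r01 n).
  have FB z : normc z < r n -> `|Re (f z)| <= Re (F n z) <= T.
    move=> zr; rewrite le_majorant//=; apply: majorant_le => // t.
    exact: le_trans (ler_norm _) (HT t).
  have /andP[_ r1] := r01 n.
  exact: (energy sw c0 Hw Hf HM (sr n) r1 (HF n) FB (fun e e0 => majorant_boundary Hf (r01 n) e0)).1.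
have mG := rmeas_density HG.
have md n : rmeas (density (s n) (F n)).
  by apply: rmeas_density; apply: hol_sub (HF n); case/andP: (sr n) => _ /ltW.
apply: (density_fatou mw w0 md mG _ sl _ EF) => [n|z z1].
  by have := e0 n; rewrite /s; lra.
exact: (HFG z z1).2.
Qed.
End MajorantLimit.

(** * The weighted Dirichlet space *)

Section Space.
Variable R : realType.
Local Notation C := R[i].
Implicit Types (W : C -> \bar R) (z : C) (f F g h : C -> C).

Lemma ext_val (V : Type) (v : V) (p : unit_disk R -> V) (u : unit_disk R) :
  'valL_v p (val u) = p u.
Proof. by have /(congr1 (fun k => k u)) := valLK v p. Qed.

Lemma ext_out (V : Type) (v : V) (p : unit_disk R -> V) z : ~ unit_disk R z -> 'valL_v p z = v.
Proof. by move=> h; rewrite /valL_ oinv_set_val /= insubN//; apply/negP => /set_mem. Qed.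

Lemma disk_point z : normc z < 1 -> exists u : unit_disk R, val u = z.
Proof. by move=> /unit_diskE z1; exists (exist _ z (mem_set z1)). Qed.

Lemma normc_val (u : unit_disk R) : normc (val u) < 1.
Proof. by apply/unit_diskE; apply: set_mem; exact: valP. Qed.

Lemma subdisk_nbhs (u : unit_disk R) V : nbhs u V -> exists2 e : R, 0 < e &
  forall y : unit_disk R, normc (val y - val u) < e -> V y.
Proof.
rewrite nbhsE => -[U [[U' oU' UE] Uu] UV].
have /nbhs_ballP[e /= e0 He] : nbhs (val u) U'.
  by apply: open_nbhs_nbhs; split=> //; rewrite -UE in Uu.
have eE : e = (normc e)%:C by rewrite -{1}(gtr0_norm e0).
exists (normc e); first by rewrite normc_gt0 gt_eqF.
move=> y yu; apply: UV; rewrite -UE; apply: He.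
by rewrite -ball_normE /= distrC eE; rewrite -(normC_lt (val y - val u)) in yu.
Qed.

Lemma sup_weight_ext (w : unit_disk R -> \bar R) : superharmonic w ->
  (forall u, (0 < w u)%E) -> sup_weight ('valL_0%E w : C -> \bar R).
Proof.
move=> sh w0; split.
- move=> z; case: (ltP (normc z) 1) => [/disk_point[u <-]|z1].
    by rewrite ext_val ltW.
  by rewrite ext_out// => /unit_diskE; rewrite ltNge z1.
- by move=> z /disk_point[u <-]; rewrite ext_val.
- move=> z a z1; have := z1 => /disk_point[u uE]; rewrite -{1}uE ext_val.
  move=> /(superharmonic_lsc sh)[V /subdisk_nbhs[e e0 He] HV].
  exists (Num.min e (1 - normc z)); first by rewrite lt_min e0 subr_gt0.
  move=> y; rewrite lt_min => /andP[h1 h2].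
  have /disk_point[v vE] : normc y < 1 by have := le_normcBD y z; lra.
  by rewrite -vE ext_val; apply: HV; apply: He; rewrite uE vE.
- move=> z r r0 zr; have z1 : normc z < 1 by lra.
  have [u uE] := disk_point z1; rewrite -uE ext_val.
  apply: (superharmonic_mean sh) => // y; rewrite /closed_ball_ /= => hy.
  have {}hy : normc (val u - y) <= r by rewrite -normC_le.
  by apply/unit_diskE; have := le_normcBD y (val u); rewrite normcBC uE in hy *; lra.
- have [u wu] := superharmonic_nontriv sh; exists (val u); first exact: normc_val.
  by rewrite ext_val.
- by move=> z z1; rewrite ext_out// => /unit_diskE; rewrite ltNge z1.
Qed.

(** The Dirichlet space for functions on the plane, only their values on the disk being relevant
    ([dsp_ext]). The factor 1/pi is dropped, as it does not affect finiteness. *)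
Definition dsp W f := hol 1 f /\ (int2 (fun z => W z * (density 1 f z)%:E) < +oo)%E.

Lemma holomorphicE (p : unit_disk R -> plane R) : holomorphic p <-> hol 1 ('valL_0 p : C -> C).
Proof.
split=> [H z /disk_point[u <-]|H u].
  by exists (dc ('valL_0 p) (val u)); apply: derivable_cderiv; exact: H.
by have [d] := H _ (normc_val u) => /cderiv_derivable[].
Qed.

Lemma dirichlet_spaceE (w : unit_disk R -> \bar R) (p : unit_disk R -> plane R) :
  dirichlet_space w p <-> dsp ('valL_0%E w) ('valL_0 p : C -> C).
Proof.
rewrite /dirichlet_space /dsp /= holomorphicE.
suff -> : dirichlet_integral w p =
    (pi^-1%:E * int2 (fun z => ('valL_0 w) z * (density 1 ('valL_0 p : C -> C) z)%:E))%E.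
  have pi0 : (0 < pi^-1 :> R) by rewrite invr_gt0 pi_gt0.
  set J := int2 _; suff -> : (pi^-1%:E * J < +oo)%E = (J < +oo)%E by [].
  case: J => [j| |]; rewrite ?ltry// ?gt0_muley ?gt0_muleNy ?lte_fin//.
rewrite /dirichlet_integral /area_integral; congr (_ * _)%E.
rewrite integral_mkcond; apply: eq_integral => q _; rewrite patchE /density.
case: ifPn => [/set_mem/unit_diskE q1|q1].
  by rewrite (q1 : normc (toC q) < 1) mul1r muleC.
case: ltP => q1'; last by rewrite mul0r mule0.
by move/negP: q1; case; apply: mem_set; apply/unit_diskE.
Qed.

Lemma dc_ext f g z : (forall y, normc y < 1 -> f y = g y) -> hol 1 f -> normc z < 1 ->
  cderiv g z (dc f z).
Proof.
move=> fg Hf z1; have r0 : 0 < (1 - normc z) / 2 by lra.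
apply: (cderiv_ext r0) (hol_cderiv Hf z1) => h hh; apply: fg.
by apply: le_lt_trans (le_normcD _ _) _; lra.
Qed.

Lemma densityE r f z : normc z < r -> density r f z = normc (dc f z) ^+ 2.
Proof. by rewrite /density => ->; rewrite [LHS]mul1r. Qed.

(** The membership test for all later constructions: the constant 1 is allowed in the bound because
    w is integrable. *)
Lemma dsp_le W f g h (K : R) : sup_weight W -> dsp W f -> dsp W g -> hol 1 h -> 0 <= K ->
  (forall z, normc z < 1 ->
     normc (dc h z) ^+ 2 <= K * (normc (dc f z) ^+ 2 + normc (dc g z) ^+ 2 + 1)) ->
  dsp W h.
Proof.
move=> sw [Hf If] [Hg Ig] Hh K0 H; split; first exact: Hh.
have w0 := sw_ge0 sw; have mw := sw_pmeas sw.
have mf := rmeas_density Hf; have mg := rmeas_density Hg; have mh := rmeas_density Hh.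
have wf := pmeasM mw mf; have wg := pmeasM mw mg; have wh := pmeasM mw mh.
have d0 k z : (0 <= W z * (density 1 k z)%:E)%E by rewrite mule_ge0// lee_fin density_ge0.
have wfg := pmeasD wf wg; have wfgw := pmeasD wfg mw.
apply: (@le_lt_trans _ _ (K%:E * (int2 (fun z => W z * (density 1 f z)%:E) +
    int2 (fun z => W z * (density 1 g z)%:E) + int2 W))%E); last first.
  apply: lte_mul_pinfty => //; rewrite -?lte_fin ?lee_fin//.
  exact: (lte_add_pinfty (lte_add_pinfty If Ig) (sw_int sw)).
have fg0 z := adde_ge0 (d0 f z) (d0 g z).
have fgw0 z := adde_ge0 (fg0 z) (w0 z).
rewrite -(int2D wf wg (d0 f) (d0 g)) -(int2D wfg mw fg0 w0).
rewrite -(int2Z wfgw fgw0); last by rewrite lee_fin.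
apply: (le_int2 wh _ (d0 h)); first exact: (pmeasM (rmeas_cst K) wfgw).
move=> z.
have e1 : (W z * (density 1 f z)%:E + W z * (density 1 g z)%:E + W z =
   W z * (density 1 f z + density 1 g z + 1)%:E)%E.
  move: (density_ge0 1 f z) (density_ge0 1 g z) (w0 z); move: (density 1 f z) (density 1 g z) (W z).
  by move=> a b v a0 b0 v0; rewrite !EFinD !ge0_muleDr ?mule1 ?lee_fin// addr_ge0.
cbv beta; rewrite e1; case: (ltP (normc z) 1) => z1; last first.
  rewrite (sw_out sw z1); move: (density 1 h z) (density 1 f z + density 1 g z + 1) => a b.
  by rewrite !mul0e mule0.
rewrite muleCA -EFinM; apply: (lee_wpmul2l (w0 z)); rewrite lee_fin.
by rewrite (densityE h z1) (densityE f z1) (densityE g z1); exact: H.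
Qed.
End Space.

(** * Functionals that do not vanish on nonvanishing functions *)

Section Algebra.
Variable R : realType.
Local Notation C := R[i].

(* [q1^2 - 2 q2] is the sum of the squares of the inverse roots. *)
Lemma newton_bound (M : R) n (q : {poly C}) : (size q <= n.+1)%N -> q`_0 = 1 ->
  (forall m, root q m -> 1 <= M * normc m) ->
  normc (q`_1 ^+ 2 - 2 * q`_2) <= n%:R * M ^+ 2.
Proof.
elim: n q => [|n IH] q sq q0 Hq.
  have q1 : q`_1 = 0 by apply: nth_default.
  have q2 : q`_2 = 0 by apply: nth_default; exact: leq_trans sq _.
  by rewrite q1 q2 expr0n mulr0 subr0 normc0 mul0r.
have [sq1|sq1] := eqVneq (size q) 1%N.
  have q1 : q`_1 = 0 by apply: nth_default; rewrite sq1.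
  have q2 : q`_2 = 0 by apply: nth_default; rewrite sq1.
  by rewrite q1 q2 expr0n mulr0 subr0 normc0 mulr_ge0// sqr_ge0.
have /closed_rootP[m rm] : size q != 1%N by [].
have Mm := Hq _ rm.
have /factor_theorem[p pE] := rm.
have c0 : q`_0 = - m * p`_0.
  by rewrite pE mulrBr coefB coefMX coefMC /= sub0r mulrC mulNr.
have c1 : q`_1 = p`_0 - m * p`_1 by rewrite pE mulrBr coefB coefMX coefMC /= mulrC.
have c2 : q`_2 = p`_1 - m * p`_2 by rewrite pE mulrBr coefB coefMX coefMC /= mulrC.
have m0 : m != 0.
  by apply/eqP => m0; move: q0; rewrite c0 m0 oppr0 mul0r => /eqP; rewrite eq_sym oner_eq0.
have p00 : p`_0 = - m^-1.
  apply: (mulfI (x := - m)); first by rewrite oppr_eq0.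
  by rewrite -c0 q0 mulrNN mulfV.
have pn0 : p != 0 by apply/eqP => p0; move/eqP: p00; rewrite p0 coef0 eq_sym oppr_eq0 invr_eq0 (negPf m0).
(* Scaling by - m restores the constant coefficient 1 after the root m is divided out, and the
   remaining roots are roots of q. *)
have := IH (- m *: p); rewrite !coefZ p00 mulrNN mulfV// => /(_ _ erefl).
have sp : (size (- m *: p) <= n.+1)%N.
  rewrite size_scale ?oppr_eq0//; move: sq; rewrite pE size_Mmonic ?monicXsubC//.
  by rewrite size_XsubC addn2.
move=> /(_ sp) IH'.
have {}IH' : normc ((- m * p`_1) ^+ 2 - 2 * (- m * p`_2)) <= n%:R * M ^+ 2.
  apply: IH' => k; rewrite rootZ ?oppr_eq0// => rk; apply: Hq.
  by rewrite pE rootM rk.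
have -> : q`_1 ^+ 2 - 2 * q`_2 = ((- m * p`_1) ^+ 2 - 2 * (- m * p`_2)) + m^-1 ^+ 2.
  rewrite c1 c2 p00; field; exact: m0.
have -> : n.+1%:R * M ^+ 2 = n%:R * M ^+ 2 + M ^+ 2 by rewrite -natr1; ring.
have m1 : 0 < normc m by rewrite normc_gt0.
have M0 : 0 <= M by rewrite -(pmulr_lge0 _ m1); apply: le_trans Mm.
apply: le_trans (le_normcD _ _) _; apply: lerD IH' _.
rewrite normcX normcV; apply: lerXn2r; rewrite ?nnegrE ?invr_ge0 ?(ltW m1)//.
by rewrite -div1r ler_pdivrMr.
Qed.

(* A square root [e] of [c] with [Re e >= 0] is reached from 1 in small steps along
   the segment [1, e], which stays away from 0; then go from [e] to [e^2]. *)
Lemma multiplicative_reach (P : C -> Prop) (d : R) : 0 < d ->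
  P 1 -> (forall l u, P l -> normc u < d -> P (l * (1 + u))) -> forall c, c != 0 -> P c.
Proof.
move=> d0 P1 Pu.
have half c : c != 0 -> 0 <= Re c -> forall l, P l -> P (l * c).
  (* k/2 bounds |p t|^2 below: as Re c >= 0, |p t|^2 >= (1 - t)^2 + t^2 |c|^2, and (1 - t)^2 + t^2
     >= 1/2. *)
  move=> c0 Rc l Pl; pose k := Num.min 1 (normc c ^+ 2).
  have k0 : 0 < k by rewrite lt_min ltr01 exprn_gt0// normc_gt0.
  have [k1 kc] : k <= 1 /\ k <= normc c ^+ 2 by split; rewrite /k ge_min lexx ?orbT.
  pose p (t : R) : C := 1 + t%:C * (c - 1).
  have pn t : 0 <= t <= 1 -> k / 2 <= normc (p t) ^+ 2.
    move=> /andP[t0 t1]; rewrite normc_sqr /p cReD cImD Re_mulrC Im_mulrC cReD cImD cReN cImN.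
    rewrite [Re 1]/= [Im 1]/= add0r subr0; rewrite normc_sqr in kc.
    move: (Re c) (Im c) Rc kc => x y x0 kc.
    have -> : (1 + t * (x - 1)) ^+ 2 + (t * y) ^+ 2 =
      (1 - t) ^+ 2 + 2 * (t * (1 - t)) * x + t ^+ 2 * (x ^+ 2 + y ^+ 2) by ring.
    have h1 : 0 <= 2 * (t * (1 - t)) * x.
      by apply: mulr_ge0 => //; apply: mulr_ge0 => //; apply: mulr_ge0; lra.
    have h2 : k * t ^+ 2 <= t ^+ 2 * (x ^+ 2 + y ^+ 2).
      by rewrite mulrC; apply: ler_wpM2l kc; exact: sqr_ge0.
    have h3 : k * (1 - t) ^+ 2 <= (1 - t) ^+ 2.
      by rewrite -[leRHS]mul1r; apply: ler_wpM2r k1; exact: sqr_ge0.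
    have h4 : k * (1 / 2) <= k * (t ^+ 2 + (1 - t) ^+ 2).
      apply: ler_wpM2l; first exact: ltW.
      by have := sqr_ge0 (2 * t - 1); nra.
    by lra.
  pose D := normc (c - 1).
  have D0 : 0 <= D by exact: normc_ge0.
  (* Consecutive points differ by D/(N+1) in modulus and have modulus at least the square root of
     k/2, so their ratio is 1 + u with |u| < d. *)
  have [N NE] : exists N : nat, 2 * D ^+ 2 < k * d ^+ 2 * N.+1%:R.
    have kd : 0 < k * d ^+ 2 by rewrite mulr_gt0// exprn_gt0.
    have [N _ HN] := (cvgryPge (fun n => n%:R : R)).1 cvgr_idn (2 * D ^+ 2 / (k * d ^+ 2)).
    exists N; rewrite [ltRHS]mulrC -ltr_pdivrMr//.
    have h : 2 * D ^+ 2 / (k * d ^+ 2) <= N%:R by exact: HN (leqnn N).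
    by apply: le_lt_trans h _; rewrite ltr_nat.
  have N0 : 0 < N.+1%:R :> R by rewrite ltr0n.
  pose t (i : nat) : R := i%:R / N.+1%:R.
  have Pt i : (i <= N.+1)%N -> P (l * p (t i)).
    elim: i => [_|i IH iN]; first by rewrite /p /t mul0r mul0r addr0 mulr1.
    have t01 : 0 <= t i <= 1.
      by rewrite /t divr_ge0//= ler_pdivrMr// mul1r ler_nat ltnW.
    have pt := pn _ t01.
    have p0 : p (t i) != 0.
      by apply/eqP => p0; move: pt; rewrite p0 normc0 expr2 mul0r => h; clear - h k0; lra.
    have tS : t i.+1 = t i + N.+1%:R^-1 by rewrite /t -natr1 mulrDl mul1r.
    pose q := (N.+1%:R^-1)%:C * (c - 1).
    have pS : p (t i.+1) = p (t i) + q by rewrite /p tS rmorphD mulrDl addrA.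
    have -> : l * p (t i.+1) = (l * p (t i)) * (1 + q / p (t i)).
      rewrite pS; move: (p (t i)) p0 => b b0; field; exact: b0.
    apply: Pu (IH (ltnW iN)) _.
    have b0 : 0 < normc (p (t i)) by rewrite normc_gt0.
    rewrite normcM normcV ltr_pdivrMr// /q normcM normc_real gtr0_norm ?invr_gt0// mulrC -/D.
    rewrite ltr_pdivrMr// -(ltr_pXn2r (n := 2))// ?nnegrE ?D0//; last first.
      by apply: mulr_ge0 (ltW N0); apply: mulr_ge0; exact: ltW.
    have N1 : 1 <= N.+1%:R :> R by rewrite ler1n.
    rewrite !exprMn; move: (N.+1%:R : R) (normc (p (t i)) ^+ 2) N0 N1 NE pt => n b n0 n1 ne bk.
    have d2 : 0 < d ^+ 2 by rewrite exprn_gt0.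
    have h1 : k * d ^+ 2 * n <= k * d ^+ 2 * n ^+ 2.
      by apply: ler_wpM2l; [apply: mulr_ge0; exact: ltW|nra].
    have h2 : k / 2 * (d ^+ 2 * n ^+ 2) <= b * (d ^+ 2 * n ^+ 2).
      by apply: ler_wpM2r bk; apply: mulr_ge0; [exact: ltW|exact: sqr_ge0].
    by lra.
  have := Pt N.+1 (leqnn _); rewrite /t divff ?gt_eqF// /p mul1r.
  by rewrite (_ : 1 + (c - 1) = c); last ring.
move=> c c0.
have [e [e0 ee Re0]] : exists e : C, [/\ e != 0, e * e = c & 0 <= Re e].
  have ss : sqrtC c * sqrtC c = c by rewrite -expr2 sqrtCK.
  have s0 : sqrtC c != 0 by rewrite sqrtC_eq0.
  case: (leP 0 (Re (sqrtC c))) => h; first by exists (sqrtC c).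
  exists (- sqrtC c); rewrite oppr_eq0 mulrNN; split=> //.
  by rewrite cReN; lra.
by have := half _ e0 Re0 _ (half _ e0 Re0 _ P1); rewrite mul1r ee.
Qed.
End Algebra.

(** * The algebra of bounded elements *)

Section Closure.
Variable R : realType.
Local Notation C := R[i].
Implicit Types (W : C -> \bar R) (z : C) (f F g h : C -> C).

Definition bounded_on_disk f := exists M, forall z, normc z < 1 -> normc (f z) <= M.

Lemma holMc rad f c : hol rad f -> hol rad (fun z => c * f z).
Proof. by move=> Hf z /Hf[d Hd]; exists (c * d); exact: cderivZ. Qed.

Lemma dcMc rad f c z : hol rad f -> normc z < rad -> dc (fun z => c * f z) z = c * dc f z.
Proof. by move=> Hf zr; apply: dcE; apply: cderivZ; exact: hol_cderiv zr. Qed.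

Lemma normc_sqr_add (a b : C) : normc (a + b) ^+ 2 <= 2 * (normc a ^+ 2 + normc b ^+ 2).
Proof.
have h := le_normcD a b; have n0 := normc_ge0 (a + b).
have : normc (a + b) ^+ 2 <= (normc a + normc b) ^+ 2.
  by apply: lerXn2r; rewrite ?nnegrE ?addr_ge0 ?normc_ge0.
by move=> h2; apply: le_trans h2 _; have := sqr_ge0 (normc a - normc b); lra.
Qed.

Lemma normc_sqr_le (z : C) (M : R) : normc z <= M -> normc z ^+ 2 <= M ^+ 2.
Proof.
move=> zM; have M0 := le_trans (normc_ge0 z) zM.
by apply: lerXn2r zM; rewrite nnegrE ?normc_ge0.
Qed.

Lemma dsp_cst W c : dsp W (fun=> c).
Proof.
split; first exact: hol_cst.
have -> : (fun z => W z * (density 1 (fun=> c) z)%:E)%E = (fun=> 0%E).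
  apply/funext => z; rewrite /density (dcE (cderiv_cst c z)) normc0 expr2 mul0r mulr0.
  by rewrite mule0.
by rewrite /int2 integral0 ltry.
Qed.

Variable W : C -> \bar R.
Hypothesis sw : sup_weight W.

Lemma dsp_lin c f g : dsp W f -> dsp W g -> dsp W (fun z => c * f z + g z).
Proof.
move=> Hf Hg; have Hcf := holMc c Hf.1.
apply: (dsp_le (K := 2 * normc c ^+ 2 + 2) sw Hf Hg); first exact: holD Hcf Hg.1.
  by have := sqr_ge0 (normc c); lra.
move=> z z1; rewrite (dcD Hcf Hg.1 z1) (dcMc c Hf.1 z1).
apply: le_trans (normc_sqr_add _ _) _; rewrite normcM exprMn.
have a1 (x y k : R) : 0 <= x -> 0 <= y -> 0 <= k -> 2 * (k * x + y) <= (2 * k + 2) * (x + y + 1).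
  by move=> x0 y0 k0; have := mulr_ge0 k0 y0; nra.
exact: a1 (sqr_ge0 _) (sqr_ge0 _) (sqr_ge0 _).
Qed.

Lemma dsp_bounded_deriv f B : hol 1 f -> (forall z, normc z < 1 -> normc (dc f z) <= B) -> dsp W f.
Proof.
move=> Hf HB; apply: (dsp_le (K := B ^+ 2) sw (dsp_cst W 0) (dsp_cst W 0)) => //.
  exact: sqr_ge0.
move=> z z1; apply: (@le_trans _ _ (B ^+ 2 * 1)).
  by rewrite mulr1; exact: normc_sqr_le (HB z z1).
apply: ler_wpM2l; first exact: sqr_ge0.
by rewrite lerDr addr_ge0 ?sqr_ge0.
Qed.

(** Despite the name, just a bounded element of the space. *)
Definition multiplier f := dsp W f /\ bounded_on_disk f.

Lemma multiplier_cst c : multiplier (fun=> c).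
Proof. by split; [exact: dsp_cst|exists (normc c)]. Qed.

Lemma multiplier_lin c f g : multiplier f -> multiplier g -> multiplier (fun z => c * f z + g z).
Proof.
move=> [df [M HM]] [dg [N HN]]; split; first exact: dsp_lin.
exists (normc c * M + N) => z z1; apply: le_trans (le_normcD _ _) _; rewrite normcM.
by apply: lerD; [apply: ler_wpM2l; [exact: normc_ge0|exact: HM]|exact: HN].
Qed.

Lemma multiplierM f g : multiplier f -> multiplier g -> multiplier (fun z => f z * g z).
Proof.
move=> [df [M HM]] [dg [N HN]]; split; last first.
  by exists (M * N) => z z1; rewrite normcM; apply: ler_pM; rewrite ?normc_ge0// ?HM ?HN.
apply: (dsp_le (K := 2 * (M ^+ 2 + N ^+ 2)) sw df dg); first exact: holM df.1 dg.1.
  by rewrite mulr_ge0// addr_ge0// sqr_ge0.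
move=> z z1; rewrite (dcM df.1 dg.1 z1); apply: le_trans (normc_sqr_add _ _) _.
rewrite !normcM !exprMn; have fM := HM z z1; have gN := HN z z1.
have f2 := normc_sqr_le fM.
have g2 := normc_sqr_le gN.
have a1 (x y u v m n : R) : u <= m -> v <= n -> 0 <= x -> 0 <= y -> 0 <= u -> 0 <= v ->
    2 * (x * v + u * y) <= 2 * (m + n) * (x + y + 1).
  move=> um vn x0 y0 u0 v0.
  have h1 : x * v <= x * n by exact: ler_wpM2l.
  have h2 : u * y <= m * y by exact: ler_wpM2r.
  have h3 : 0 <= m * x by rewrite mulr_ge0//; exact: le_trans um.
  have h4 : 0 <= n * y by rewrite mulr_ge0//; exact: le_trans vn.
  have h5 : 0 <= m + n by rewrite addr_ge0//; [exact: le_trans um|exact: le_trans vn].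
  by lra.
exact: a1 f2 g2 (sqr_ge0 _) (sqr_ge0 _) (sqr_ge0 _) (sqr_ge0 _).
Qed.

Lemma multiplierX f n : multiplier f -> multiplier (fun z => f z ^+ n).
Proof.
move=> Hf; elim: n => [|n IH].
  by under eq_fun do rewrite expr0; exact: multiplier_cst.
by under eq_fun do rewrite exprS; exact: multiplierM.
Qed.

Lemma multiplier_id : multiplier id.
Proof.
split; last by exists 1 => z /ltW.
apply: (dsp_bounded_deriv (B := 1)) => [|z _]; first exact: hol_id.
by rewrite (dcE (cderiv_id z)) normc1.
Qed.

(** |(1/f)'| = |f'| / |f|^2 <= |f'|, so f itself may be unbounded; this is what makes the factors 1
    - r/G available. *)
Lemma multiplierV f : dsp W f -> (forall z, normc z < 1 -> 1 <= normc (f z)) ->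
  multiplier (fun z => (f z)^-1).
Proof.
move=> df f1; have f0 z : normc z < 1 -> f z != 0.
  by move=> /f1 h; rewrite -normc_gt0; apply: lt_le_trans h.
have V1 z : normc z < 1 -> normc (f z)^-1 <= 1.
  by move=> z1; rewrite normcV invf_le1 ?f1// normc_gt0 f0.
split; last by exists 1.
apply: (dsp_le (K := 1) sw df df) => //; first exact: holV df.1 f0.
move=> z z1; rewrite (dcV df.1 (f0 z z1) z1) normcM normcN mul1r exprMn normcV normcX.
have h : (normc (f z) ^+ 2)^-1 ^+ 2 <= 1.
  rewrite exprn_ile1// ?invr_ge0 ?sqr_ge0// invf_le1 ?exprn_ege1 ?f1//.
  by rewrite exprn_gt0// normc_gt0 f0.
have a1 (x k : R) : k <= 1 -> 0 <= x -> k * x <= x + x + 1 by move=> k1 x0; nra.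
exact: a1 h (sqr_ge0 _).
Qed.

(** On a smaller disk containing a, the quotient g and its derivative are bounded by holomorphy.
    Outside it |z - a| >= d, so g is bounded by 2 M / d, and (z - a) g' = f' - g bounds g' by f' and
    a constant. *)
Lemma multiplier_quotient f a : multiplier f -> normc a < 1 ->
  exists2 g, multiplier g & forall z, normc z < 1 -> f z = f a + (z - a) * g z.
Proof.
move=> [df [M HM]] a1; have [g Hg E] := hol_divided_difference df.1 a1.
exists g; last exact: E.
have a0 := normc_ge0 a.
pose s := (1 + normc a) / 2; pose d := s - normc a.
have s1 : s < 1 by rewrite /s; lra.
have d0 : 0 < d by rewrite /d /s; lra.
have [B B0 HB] := hol_bounded ltr01 Hg s1.
have far z : s < normc z -> d <= normc (z - a).
  by move=> sz; have := le_normcBD z a; rewrite /d; lra.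
have M0 : 0 <= M by exact: le_trans (normc_ge0 _) (HM _ a1).
have gB z : normc z < 1 -> s < normc z -> normc (g z) <= 2 * M / d.
  move=> z1 sz; rewrite ler_pdivlMr//.
  have h : normc ((z - a) * g z) <= 2 * M.
    have -> : (z - a) * g z = f z - f a by rewrite (E z z1); ring.
    by apply: le_trans (le_normcB _ _) _; have := HM z z1; have := HM a a1; lra.
  rewrite normcM in h; apply: le_trans h; rewrite mulrC.
  by apply: ler_wpM2r (far z sz); exact: normc_ge0.
have K0 : 0 <= 2 * M / d by apply: divr_ge0; [rewrite mulr_ge0|exact: ltW].
have gbd z : normc z < 1 -> normc (g z) <= B + 2 * M / d.
  move=> z1; case: (leP (normc z) s) => sz.
    by have [h _ _] := HB z sz; lra.
  by have := gB z z1 sz; lra.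
split; last by exists (B + 2 * M / d).
pose N := B + 2 * M / d; have N0 : 0 <= N by rewrite /N; lra.
have {}gbd : forall z, normc z < 1 -> normc (g z) <= N := gbd.
clear gB K0; clearbody N; clearbody d; clearbody s.
have d2 : 0 < d ^+ 2 by rewrite exprn_gt0.
apply: (dsp_le (K := B ^+ 2 + 2 * (1 + N ^+ 2) / d ^+ 2) sw df df Hg).
  apply: addr_ge0; first exact: sqr_ge0.
  by apply: divr_ge0; [rewrite mulr_ge0// addr_ge0// sqr_ge0|exact: ltW].
have b1 (x y : R) : 0 <= x -> y <= B ^+ 2 ->
    y <= (B ^+ 2 + 2 * (1 + N ^+ 2) / d ^+ 2) * (x + x + 1).
  move=> x0 yB; apply: le_trans yB _.
  have k0 : 0 <= 2 * (1 + N ^+ 2) / d ^+ 2.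
    by apply: divr_ge0; [rewrite mulr_ge0// addr_ge0// sqr_ge0|exact: ltW].
  by have := sqr_ge0 B; nra.
have a2 (x y e : R) : 0 <= x -> 0 <= y -> d ^+ 2 <= e -> e * y <= 2 * (x + N ^+ 2) ->
    y <= (B ^+ 2 + 2 * (1 + N ^+ 2) / d ^+ 2) * (x + x + 1).
  move=> x0 y0 de h.
  have hy : y * d ^+ 2 <= 2 * (x + N ^+ 2).
    by apply: le_trans h; rewrite mulrC; exact: ler_wpM2r.
  apply: (@le_trans _ _ (2 * (x + N ^+ 2) / d ^+ 2)); first by rewrite ler_pdivlMr.
  have -> : (B ^+ 2 + 2 * (1 + N ^+ 2) / d ^+ 2) * (x + x + 1) =
    B ^+ 2 * (x + x + 1) + 2 * (1 + N ^+ 2) * (x + x + 1) / d ^+ 2 by ring.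
  have h1 : 0 <= B ^+ 2 * (x + x + 1) by apply: mulr_ge0; [exact: sqr_ge0|lra].
  apply: le_trans (_ : 2 * (1 + N ^+ 2) * (x + x + 1) / d ^+ 2 <= _); last by rewrite lerDr.
  apply: ler_wpM2r; first by rewrite invr_ge0 ltW.
  by have := mulr_ge0 (sqr_ge0 N) x0; have := sqr_ge0 N; nra.
move=> z z1; case: (leP (normc z) s) => sz.
  have [_ h _] := HB z sz.
  exact: b1 (sqr_ge0 _) (normc_sqr_le h).
have zE : dc f z = g z + (z - a) * dc g z.
  have Ha : cderiv (fun z => z + - a) z (1 + 0).
    by apply: cderivD; [exact: cderiv_id|exact: cderiv_cst].
  have H1 := cderivM Ha (hol_cderiv Hg z1).
  have H2 := cderivD (cderiv_cst (f a) z) H1.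
  rewrite -[RHS](_ : 0 + ((1 + 0) * g z + (z + - a) * dc g z) = _); last by rewrite add0r addr0 mul1r.
  apply: dcE; apply: (cderiv_ext (r := (1 - normc z) / 2)) H2; first by lra.
  move=> h hh; rewrite -E//; apply: le_lt_trans (le_normcD _ _) _; lra.
have pE : (z - a) * dc g z = dc f z + - g z by rewrite zE [RHS]addrC addrA addNr add0r.
have h1 := normc_sqr_add (dc f z) (- g z); rewrite -pE normcM exprMn normcN in h1.
have hd : d ^+ 2 <= normc (z - a) ^+ 2.
  by apply: lerXn2r (far z sz); rewrite nnegrE ?normc_ge0// ltW.
apply: (a2 _ _ _ (sqr_ge0 _) (sqr_ge0 _) hd); apply: le_trans h1 _.
apply: ler_wpM2l => //; rewrite lerD2l; exact: normc_sqr_le (gbd z z1).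
Qed.
End Closure.

(** * Identification of the functional *)

Section Functional.
Variable R : realType.
Local Notation C := R[i].
Implicit Types (z : C) (f F g h : C -> C).
Variables (W : C -> \bar R) (L : (C -> C) -> C).
Hypotheses (sw : sup_weight W)
  (L_lin : forall c f g, dsp W f -> dsp W g -> L (fun z => c * f z + g z) = c * L f + L g)
  (L_loc : forall f g, (forall z, normc z < 1 -> f z = g z) -> L f = L g)
  (L_one : L (fun=> 1) = 1)
  (L_neq0 : forall g, dsp W g -> (forall z, normc z < 1 -> g z != 0) -> L g != 0).

Let d1 (c : C) : dsp W (fun=> c) := dsp_cst W c.

Lemma L_zero : L (fun=> 0) = 0.
Proof.
have H := L_lin (-1) (d1 1) (d1 1); rewrite L_one mulN1r addNr in H.
by rewrite -[RHS]H; congr L; apply/funext => z; rewrite mulN1r addNr.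
Qed.

Lemma L_scale c f : dsp W f -> L (fun z => c * f z) = c * L f.
Proof.
move=> df; have := L_lin c df (d1 0); rewrite L_zero addr0 => <-.
by congr L; apply/funext => z; rewrite addr0.
Qed.

Lemma L_cst c : L (fun=> c) = c.
Proof.
have H := L_scale c (d1 1); rewrite L_one mulr1 in H.
by rewrite -[RHS]H; congr L; apply/funext => z; rewrite mulr1.
Qed.

(** f - L f is killed by [L], so it must have a zero. Applied to the identity function, this puts a
    in the disk. *)
Lemma L_range f : dsp W f -> exists2 z, normc z < 1 & L f = f z.
Proof.
move=> df; apply: contrapT => H.
have dg := dsp_lin sw 1 df (d1 (- L f)).
have /negP[] : L (fun z => 1 * f z + - L f) != 0.
  apply: L_neq0 => // z z1; rewrite mul1r subr_eq0; apply/eqP => fz.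
  by apply: H; exists z.
by rewrite (L_lin 1 df (d1 _)) L_cst mul1r subrr.
Qed.

Lemma L_sum n (c : nat -> C) (F : nat -> C -> C) : (forall k, dsp W (F k)) ->
  dsp W (fun z => \sum_(k < n) c k * F k z) /\
  L (fun z => \sum_(k < n) c k * F k z) = \sum_(k < n) c k * L (F k).
Proof.
move=> dF; elim: n => [|n [IHd IHL]].
  under eq_fun do rewrite big_ord0; rewrite big_ord0 L_zero; split=> //; exact: d1.
have E : (fun z => \sum_(k < n.+1) c k * F k z) = (fun z => c n * F n z + \sum_(k < n) c k * F k z).
  by apply/funext => z; rewrite big_ord_recr addrC.
rewrite E; split; first exact: (dsp_lin sw (c n) (dF n) IHd).
by rewrite (L_lin (c n) (dF n) IHd) IHL big_ord_recr addrC.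
Qed.

(* For [q(X) = L ((1 - X f)^n)], a root [m] forces [m f] to take the value 1. *)
Lemma L_power_bound f M n : multiplier W f -> (forall z, normc z < 1 -> normc (f z) <= M) ->
  (2 <= n)%N ->
  normc ((n%:R * L f) ^+ 2 - (n * n.-1)%:R * L (fun z => f z ^+ 2)) <= n%:R * M ^+ 2.
Proof.
move=> mf HM n2.
have mX k : multiplier W (fun z => f z ^+ k) by exact: multiplierX.
pose e k : C := 'C(n, k)%:R * (-1) ^+ k.
pose q := \poly_(k < n.+1) (e k * L (fun z => f z ^+ k)).
have rq m : root q m -> 1 <= M * normc m.
  move=> /rootP; rewrite horner_poly => qm; rewrite leNgt; apply/negP => Mm.
  have [_ LS] := L_sum n.+1 (fun k => e k * m ^+ k) (fun k => (mX k).1).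
  have E : (fun z => \sum_(k < n.+1) e k * m ^+ k * f z ^+ k) = (fun z => (- m * f z + 1) ^+ n).
    apply/funext => z; rewrite addrC exprDn; apply: eq_bigr => k _.
    by rewrite expr1n mul1r mulNr exprNn exprMn -mulr_natl /e !mulrA.
  have dP : dsp W (fun z => (- m * f z + 1) ^+ n).
    apply: (multiplierX sw n _).1; apply: (multiplier_lin sw) => //; exact: multiplier_cst.
  have /negP[] : L (fun z => (- m * f z + 1) ^+ n) != 0.
    apply: L_neq0 dP _ => z z1; apply: expf_neq0; apply/eqP => h0.
    have : normc (m * f z) = 1 by rewrite (_ : m * f z = 1) ?normc1//; apply/eqP; rewrite -subr_eq0 -oppr_eq0 opprB addrC -mulNr h0.
    rewrite normcM => h1; have := HM z z1; have := normc_ge0 m; nra.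
  apply/eqP; rewrite -E LS -[RHS]qm; apply: eq_bigr => k _; ring.
have q0 : q`_0 = 1.
  rewrite coef_poly /= /e bin0 expr0 mulr1 mul1r -[RHS]L_one; congr L.
have q1 : q`_1 = - (n%:R * L f).
  rewrite coef_poly ltnS (ltnW n2) /e bin1 expr1 mulrN1 mulNr; congr (- (_ * L _)).
have q2 : 2 * q`_2 = (n * n.-1)%:R * L (fun z => f z ^+ 2).
  rewrite coef_poly ltnS n2 /e sqrrN expr1n mulr1 mulrA; congr (_ * _).
  by rewrite -natrM -mul_bin_diag bin1.
by rewrite -q2 -sqrrN -q1; apply: newton_bound => //; exact: size_poly.
Qed.

(** The left side of [L_power_bound] is n^2 |L(f)^2 - L(f^2)| up to a term linear in n, and the
    right side is linear in n; a large n excludes a nonzero difference. *)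
Lemma L_sqr f : multiplier W f -> L (fun z => f z ^+ 2) = L f ^+ 2.
Proof.
move=> mf; have [_ [M HM]] := mf.
set y := L (fun z => f z ^+ 2); set x := L f.
apply/eqP; rewrite -subr_eq0 -normc_eq0; apply/eqP; apply/le_anti; rewrite normc_ge0 andbT.
rewrite leNgt; apply/negP => D0; set D := normc _ in D0.
have [N _ HN] := (cvgryPge (fun n => n%:R : R)).1 cvgr_idn ((M ^+ 2 + normc y) / D).
have h : (M ^+ 2 + normc y) / D <= N%:R by exact: HN (leqnn N).
have := L_power_bound mf HM (isT : (2 <= N.+2)%N); rewrite -/x -/y.
have -> : (N.+2%:R * x) ^+ 2 - (N.+2 * N.+2.-1)%:R * y = - (N.+2%:R ^+ 2 * (y - x ^+ 2) - N.+2%:R * y).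
  by rewrite natrM [N.+2.-1]/= -[N.+2%:R]natr1; ring.
rewrite normcN => P; have n0 : 0 < N.+2%:R :> R by rewrite ltr0n.
have nn : normc (N.+2%:R : C) = N.+2%:R.
  by rewrite -(rmorph_nat (real_complex R)) normc_real ger0_norm.
have Q := le_normcBD (N.+2%:R ^+ 2 * (y - x ^+ 2)) (N.+2%:R * y).
rewrite (normcM (N.+2%:R ^+ 2)) (normcM _ y) normcX nn -/D in Q.
have S : N.+2%:R ^+ 2 * D <= N.+2%:R * (M ^+ 2 + normc y) by rewrite mulrDr; exact: le_trans Q (lerD P (lexx _)).
rewrite expr2 -mulrA ler_pM2l// in S.
have : N%:R * D < N.+2%:R * D by rewrite ltr_pM2r// ltr_nat.
by move: h; rewrite ler_pdivrMr//; lra.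
Qed.

Lemma L_mul f g : multiplier W f -> multiplier W g -> L (fun z => f z * g z) = L f * L g.
Proof.
move=> mf mg; have mfg := multiplierM sw mf mg.
have mf2 := multiplierX sw 2 mf; have mg2 := multiplierX sw 2 mg.
have mD := multiplier_lin sw 1 mf mg.
have := L_sqr mD; rewrite (L_lin 1 mf.1 mg.1) mul1r.
have -> : (fun z => (1 * f z + g z) ^+ 2) =
    (fun z => 2 * (f z * g z) + (1 * f z ^+ 2 + g z ^+ 2)).
  by apply/funext => z; ring.
rewrite (L_lin 2 mfg.1 (dsp_lin sw 1 mf2.1 mg2.1)) (L_lin 1 mf2.1 mg2.1) mul1r !L_sqr//.
move=> H; apply: (mulfI (x := 2)); first by rewrite pnatr_eq0.
move: H; move: (L _) (L f) (L g) => p x y H.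
have -> : 2 * p = (2 * p + (x ^+ 2 + y ^+ 2)) - (x ^+ 2 + y ^+ 2) by ring.
rewrite H; ring.
Qed.

Let a := L id.

Lemma L_id_disk : normc a < 1.
Proof. by have [z z1] := L_range (multiplier_id sw).1; rewrite /a => ->. Qed.

(** f - f(a) = (z - a) g with g in the algebra, and [L] kills z - a by the choice of a. *)
Lemma L_multiplier f : multiplier W f -> L f = f a.
Proof.
move=> mf; have [g mg E] := multiplier_quotient sw mf L_id_disk.
have mid := multiplier_id sw; have ma := multiplier_cst W (- a).
have mza := multiplier_lin sw 1 mid ma.
have -> : L f = L (fun z => 1 * ((1 * id z + - a) * g z) + f a).
  by apply: L_loc => z z1; rewrite E// !mul1r addrC.
rewrite (L_lin 1 (multiplierM sw mza mg).1 (d1 _)) L_cst (L_mul mza mg).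
by rewrite (L_lin 1 mid.1 (d1 _)) L_cst !mul1r -/a subrr mul0r add0r.
Qed.

(* If [L G != G a], multiply [G] by factors [1 - r / G] with [|r| < 1], which never
   vanish, until the value at [a] has become [G a - L G]: the outcome is
   [G + b] with [b] bounded and [L (G + b) = 0]. *)
Lemma L_half_plane G : dsp W G -> (forall z, normc z < 1 -> 1 <= Re (G z)) -> L G = G a.
Proof.
move=> dG G1; have Gn z : normc z < 1 -> 1 <= normc (G z).
  by move=> /G1 h; apply: le_trans h (le_trans (ler_norm _) (normr_Re _)).
have G0 z : normc z < 1 -> G z != 0.
  by move=> /Gn h; rewrite -normc_gt0; apply: lt_le_trans h.
have mV := multiplierV sw dG Gn; have a1 := L_id_disk.
have g0 := G0 a a1; apply: contrapT => /eqP xg.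
pose reached (l : C) := exists b, [/\ multiplier W b,
  forall z, normc z < 1 -> G z + b z != 0 & G a + b a = G a * l].
have [x1 x11 xE] := L_range dG.
(* For this value b(a) = - L G, so L (G + b) = L G + b(a) = 0. *)
have [b [mb nb bE]] : reached (1 - L G / G a).
  have gn : 0 < (normc (G a))^-1 by rewrite invr_gt0 normc_gt0.
  apply: (multiplicative_reach gn) => [|l u [b [mb nb bE]] ul|].
  - exists (fun=> 0); split; first exact: multiplier_cst.
      by move=> z z1; rewrite addr0 G0.
    by rewrite addr0 mulr1.
  - have fE (x y s : C) : x != 0 ->
        x + (- s * (y * x^-1) + (1 * y + - s)) = (x + y) * (1 - s / x).
      by move=> x0; field.
    pose r := - (G a * u).
    have r1 : normc r < 1.
      by rewrite normcN normcM mulrC -ltr_pdivlMr ?normc_gt0// div1r.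
    (* (G + b)(1 - r/G) = G + (b - r b/G - r), where b/G is bounded. At a the factor is 1 + u since
       r = - G(a) u, and |u| < 1/|G(a)| means |r| < 1. *)
    exists (fun z => - r * (b z * (G z)^-1) + (1 * b z + - r)); split.
    + exact: (multiplier_lin sw (- r) (multiplierM sw mb mV)
        (multiplier_lin sw 1 mb (multiplier_cst W (- r)))).
    + move=> z z1; rewrite (fE _ _ _ (G0 z z1)).
      apply: mulf_neq0; first exact: nb.
      rewrite subr_eq0; apply/eqP => h.
      have : normc (r / G z) = 1 by rewrite -h normc1.
      rewrite normcM normcV => /eqP; apply/negP; rewrite lt_eqF//.
      rewrite ltr_pdivrMr ?normc_gt0 ?G0// mul1r; apply: lt_le_trans r1 (Gn z z1).
    + rewrite (fE _ _ _ g0).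
      by rewrite bE /r; move: (G a) g0 => x x0'; field.
  rewrite subr_eq0 eq_sym; apply: contraNneq xg => h.
  by rewrite -(divfK g0 (L G)) h mul1r.
have dH := dsp_lin sw 1 dG mb.1.
have /negP[] : L (fun z => 1 * G z + b z) != 0.
  by apply: L_neq0 dH _ => z z1; rewrite mul1r nb.
rewrite (L_lin 1 dG mb.1) mul1r (L_multiplier mb).
have -> : b a = (G a + b a) - G a by rewrite addrC addKr.
by rewrite bE; apply/eqP; field.
Qed.

Lemma L_point f : dsp W f -> L f = f a.
Proof.
move=> df; have [F [HF IF uF]] := harmonic_majorant sw df.1 df.2.
have dF : dsp W F by split.
have dF1 := dsp_lin sw 1 dF (d1 1).
have R1 z : normc z < 1 -> 1 <= Re (1 * F z + 1).
  by move=> z1; rewrite mul1r cReD [Re 1]/= lerDr; apply: le_trans (uF z z1).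
have R2 z : normc z < 1 -> 1 <= Re (1 * f z + (1 * F z + 1)).
  move=> z1; rewrite !mul1r !cReD [Re 1]/= addrA lerDr.
  by have := uF z z1; rewrite ler_norml => /andP[h _]; lra.
have := L_half_plane (dsp_lin sw 1 df dF1) R2.
rewrite (L_lin 1 df dF1) (L_half_plane dF1 R1); cbv beta.
by rewrite (mul1r (L f)) (mul1r (f a)) => /addIr.
Qed.
End Functional.

(** * Transfer to functions on the disk *)

Section Restriction.
Variable R : realType.
Local Notation C := R[i].
Implicit Types (W : C -> \bar R) (f g : C -> C).

(** The analysis is done with functions on the whole plane; composing [L] with this map gives a
    functional on them that depends only on their values in the disk. *)
Definition restriction f : unit_disk R -> plane R := fun u => f (val u).

Lemma dsp_ext W f g : sup_weight W -> (forall z, normc z < 1 -> f z = g z) -> dsp W f -> dsp W g.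
Proof.
move=> sw fg df.
apply: (dsp_le (K := 1) sw df df) => // [z z1|z z1].
  by exists (dc f z); exact: (dc_ext fg df.1 z1).
rewrite (dcE (dc_ext fg df.1 z1)) mul1r.
have a1 (x : R) : 0 <= x -> x <= x + x + 1 by move=> x0; lra.
exact: a1 (sqr_ge0 _).
Qed.

Lemma restriction_ext f z : normc z < 1 -> f z = 'valL_0 (restriction f) z.
Proof. by move=> /disk_point[u <-]; rewrite ext_val. Qed.

Lemma restriction_space (w : unit_disk R -> \bar R) f : superharmonic w ->
  (forall u, (0 < w u)%E) -> dsp ('valL_0%E w) f -> dirichlet_space w (restriction f).
Proof.
move=> sh w0 df; apply/dirichlet_spaceE.
by apply: dsp_ext df; [exact: sup_weight_ext|move=> z; exact: restriction_ext].
Qed.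
End Restriction.

Theorem theorem1p3 (R : realType) (w : unit_disk R -> \bar R)
    (w_sh : superharmonic w) (w_gt0 : forall z, (0 < w z)%E)
    (L : (unit_disk R -> plane R) -> R[i])
    (L_lin : linear_on (dirichlet_space w) L)
    (L1 : L (fun=> 1) = 1)
    (L_neq0 : forall g, dirichlet_space w g -> (forall z, g z != 0) ->
       L g != 0) :
  exists a : unit_disk R, forall f, dirichlet_space w f -> L f = f a.
Proof.
have sw := sup_weight_ext w_sh w_gt0.
pose L' (f : R[i] -> R[i]) := L (restriction f).
have lin' c f g : dsp ('valL_0%E w) f -> dsp ('valL_0%E w) g ->
    L' (fun z => c * f z + g z) = c * L' f + L' g.
  move=> /(restriction_space w_sh w_gt0) df /(restriction_space w_sh w_gt0) dg.
  exact: (L_lin c _ _ df dg).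
have loc' (f g : R[i] -> R[i]) : (forall z, normc z < 1 -> f z = g z) -> L' f = L' g.
  by move=> fg; congr L; apply/funext => u; rewrite /restriction fg// normc_val.
have nz' (g : R[i] -> R[i]) : dsp ('valL_0%E w) g -> (forall z, normc z < 1 -> g z != 0) -> L' g != 0.
  move=> /(restriction_space w_sh w_gt0) dg g0; apply: L_neq0 dg _ => u.
  by apply: g0; exact: normc_val.
have [a aE] := disk_point (L_id_disk sw lin' L1 nz').
exists a => f /dirichlet_spaceE df.
rewrite -(ext_val 0 f a) aE -(L_point sw lin' loc' L1 nz' df).
by congr L; apply/funext => u; rewrite /restriction ext_val.
Qed.
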